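(* The mapping $$\breve q\mapsto (q^k)_{k\in\mathbb Z},$$ which sends $\breve q$ to the sequence of Fourier coefficients with respect to the angular variable $\theta$ of its expression $q$ in cylindrical coordinates, is an isometric isomorphism between $L^2_0(\breve\Omega)$ (with the $L^2(\breve\Omega)$-norm) and the $l_2$-sum $\bigoplus_2\{L^2_{(k),0}(\Omega)\colon k\in\mathbb Z\}$, where $$L^2_{(k),0}(\Omega):=\begin{cases}L^2_{1,0}(\Omega), & k=0,\\ L^2_1(\Omega), & k\ne0,\end{cases}$$ and, for all $k\in\mathbb Z$, $\|q^k\|_{L^2_{(k),0}(\Omega)}=\|q^k\|_{L^2_1(\Omega)}$.
   Context: Domain. $\breve\Omega\subset\mathbb R^3$ is a bounded domain invariant by rotation around the $z$-axis. Its half section (meridian domain) $\Omega\subset\{(r,z): r>0\}$ is polygonal; $\Gamma_0$ denotes the interior of the part of $\partial\Omega$ contained in the axis $r=0$, and $\breve\Omega$ is obtained by rotating $\Omega$ (together with $\Gamma_0$) around the $z$-axis. Cylindrical coordinates are $x=r\cos\theta$, $y=r\sin\theta$, $z$, with $\theta\in(-\pi,\pi]$. All functions are complex-valued. Fourier coefficients. For $\breve q$ on $\breve\Omega$ write $\breve q(x,y,z)=q(r,\theta,z)$ and $q(r,\theta,z)=\frac1{\sqrt{2\pi}}\sum_{k\in\mathbb Z}q^k(r,z)e^{ik\theta}$, i.e. $q^k(r,z)=\frac1{\sqrt{2\pi}}\int_{-\pi}^{\pi}q(r,\theta,z)e^{-ik\theta}\,d\theta$. Spaces. $L^2_0(\breve\Omega)=\{\breve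 q\in L^2(\breve\Omega):\int_{\breve\Omega}\breve q\,dx\,dy\,dz=0\}$. $L^2_1(\Omega)$ is the space of measurable $v:\Omega\to\mathbb C$ with $\|v\|_{L^2_1(\Omega)}^2=\int_\Omega|v|^2\,r\,dr\,dz<\infty$, and $L^2_{1,0}(\Omega)=\{q\in L^2_1(\Omega):\int_\Omega q\,r\,dr\,dz=0\}$. $l_2$-sum. For normed spaces $X_k$, $k\in\mathbb Z$, $\bigoplus_2\{X_k\colon k\in\mathbb Z\}$ is the subspace of the Cartesian product of the $X_k$ consisting of all sequences $(x^k)$ with $\|(x^k)\|=(\sum_{k\in\mathbb Z}\|x^k\|_{X_k}^2)^{1/2}<\infty$. *)

(* Defs.v *)
From HB Require Import structures.
From mathcomp Require Import all_boot all_order all_algebra generic_quotient.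
From mathcomp Require Import all_classical all_reals all_analysis measurable_realfun.
From mathcomp Require Import complex.
From mathcomp Require Import ring lra.

Set Implicit Arguments.
Unset Strict Implicit.
Unset Printing Implicit Defensive.

Import Order.TTheory GRing.Theory Num.Theory.
Import numFieldNormedType.Exports.

Local Open Scope classical_set_scope.
Local Open Scope ring_scope.

(* The norm of a normed space over [R[i]] takes its values in [R[i]]; [rnorm]
   is the same norm as a real number. *)
Definition rnorm (R : realType) (V : normedZmodType R[i]) (x : V) : R :=
  complex.Re `|x|.

Section rnorm_theory.
Context (R : realType) (V : normedZmodType R[i]).
Implicit Types x y : V.

Lemma rnormE x : (rnorm x)%:C%C = `|x|.
Proof.
by rewrite /rnorm RRe_real// realE normr_ge0.
Qed.

Lemma rnorm_ge0 x : 0 <= rnorm x.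
Proof. by rewrite -lecR rnormE normr_ge0. Qed.

Lemma rnorm0_eq0 x : rnorm x = 0 -> x = 0.
Proof. by move=> x0; apply/normr0_eq0; rewrite -rnormE x0. Qed.

Lemma rnorm0 : rnorm (0 : V) = 0.
Proof. by rewrite /rnorm normr0. Qed.

Lemma ler_rnormD x y : rnorm (x + y) <= rnorm x + rnorm y.
Proof. by rewrite -lecR rmorphD/= !rnormE ler_normD. Qed.

Lemma sqr_rnormD (s u : R) x y : 0 < s -> 0 < u ->
  rnorm (x + y) ^+ 2 <=
  ((s + u) / s) * rnorm x ^+ 2 + ((s + u) / u) * rnorm y ^+ 2.
Proof.
move=> s0 u0.
have := ler_rnormD x y; have := rnorm_ge0 (x + y).
have := rnorm_ge0 x; have := rnorm_ge0 y.
move: (rnorm x) (rnorm y) (rnorm (x + y)) => a b c b0 a0 c0 cab.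
apply: (@le_trans _ _ ((a + b) ^+ 2)); first by rewrite lerXn2r ?nnegrE ?addr_ge0.
rewrite -subr_ge0.
have -> : (s + u) / s * a ^+ 2 + (s + u) / u * b ^+ 2 - (a + b) ^+ 2 =
  (u * a - s * b) ^+ 2 / (s * u) by field; lra.
by rewrite divr_ge0 ?sqr_ge0// mulr_ge0// ltW.
Qed.

End rnorm_theory.

Section rnorm_complex.
Context (R : realType).
Implicit Types z w : R[i].

Lemma rnormZ (V : normedModType R[i]) z (x : V) :
  rnorm (z *: x) = rnorm z * rnorm x.
Proof. by apply: (@complexI R); rewrite rmorphM/= !rnormE normrZ. Qed.

Lemma rnormM z w : rnorm (z * w) = rnorm z * rnorm w.
Proof. by apply: (@complexI R); rewrite rmorphM/= !rnormE normrM. Qed.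

Lemma sqr_rnormE z : rnorm z ^+ 2 = complex.Re z ^+ 2 + complex.Im z ^+ 2.
Proof.
case: z => a b; rewrite /rnorm normc_def/= sqr_sqrtr//.
by rewrite addr_ge0 ?sqr_ge0.
Qed.

End rnorm_complex.

Section square_integrable.
Context d (T : measurableType d) (R : realType).
Variable mu : {measure set T -> \bar R}.
Implicit Types (f g : T -> R[i]) (z : R[i]).

Definition cmeasurable f :=
  measurable_fun setT (fun x => complex.Re (f x)) /\
  measurable_fun setT (fun x => complex.Im (f x)).

Definition L2int f : \bar R := (\int[mu]_x (rnorm (f x) ^+ 2)%:E)%E.

Definition L2pred : {pred T -> R[i]} :=
  mem [set f | cmeasurable f /\ (L2int f < +oo)%E].

Lemma cmeasurable0 : cmeasurable 0.
Proof. by split; exact: measurable_cst. Qed.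

Lemma cmeasurableD f g : cmeasurable f -> cmeasurable g -> cmeasurable (f + g).
Proof.
move=> [f1 f2] [g1 g2]; split.
  rewrite [X in measurable_fun _ X](_ : _ =
    (fun x => complex.Re (f x)) \+ (fun x => complex.Re (g x))).
    exact: measurable_funD.
  by apply/funext => x /=; rewrite -raddfD.
rewrite [X in measurable_fun _ X](_ : _ =
  (fun x => complex.Im (f x)) \+ (fun x => complex.Im (g x))).
  exact: measurable_funD.
by apply/funext => x /=; rewrite -raddfD.
Qed.

Lemma cmeasurableZ z f : cmeasurable f -> cmeasurable (z *: f).
Proof.
case: z => a b [f1 f2]; split.
  rewrite [X in measurable_fun _ X](_ : _ =
    (fun x => a * complex.Re (f x)) \- (fun x => b * complex.Im (f x))).
    by apply: measurable_funB; exact: measurable_funM.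
  by apply/funext => x /=; rewrite /GRing.scale/=; case: (f x).
rewrite [X in measurable_fun _ X](_ : _ =
  (fun x => a * complex.Im (f x)) \+ (fun x => b * complex.Re (f x))).
  by apply: measurable_funD; exact: measurable_funM.
by apply/funext => x /=; rewrite /GRing.scale/=; case: (f x).
Qed.

Lemma measurable_sqr_rnorm f : cmeasurable f ->
  measurable_fun setT (fun x => (rnorm (f x) ^+ 2)%:E).
Proof.
move=> [f1 f2]; apply/measurable_EFinP.
under eq_fun do rewrite sqr_rnormE.
by apply: measurable_funD; exact: measurable_funX.
Qed.

Lemma sqr_rnorm_ge0 f x : (0 <= (rnorm (f x) ^+ 2)%:E)%E.
Proof. by rewrite lee_fin sqr_ge0. Qed.

Lemma L2int_ge0 f : (0 <= L2int f)%E.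
Proof. by apply: integral_ge0 => x _; exact: sqr_rnorm_ge0. Qed.

Lemma L2int0 : L2int 0 = 0%E.
Proof.
rewrite /L2int; under eq_integral do rewrite [X in rnorm X](_ : _ = 0)// rnorm0 expr0n/=.
exact: integral0.
Qed.

Lemma L2intZ z f : cmeasurable f ->
  L2int (z *: f) = ((rnorm z ^+ 2)%:E * L2int f)%E.
Proof.
move=> mf; rewrite /L2int -ge0_integralZl//; last 3 first.
- exact: measurable_sqr_rnorm.
- by move=> x _; exact: sqr_rnorm_ge0.
- by rewrite lee_fin sqr_ge0.
apply: eq_integral => x _; rewrite -EFinM -exprMn -rnormM; congr (_%:E).
Qed.

Lemma L2int_le f g (s u : R) : cmeasurable f -> cmeasurable g ->
  0 < s -> 0 < u ->
  (L2int (f + g)%R <=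
    ((s + u) / s)%R%:E * L2int f + ((s + u) / u)%R%:E * L2int g)%E.
Proof.
move=> mf mg s0 u0; rewrite /L2int.
have a0 : 0 <= (s + u) / s by rewrite divr_ge0 ?addr_ge0 ?ltW.
have b0 : 0 <= (s + u) / u by rewrite divr_ge0 ?addr_ge0 ?ltW.
have mf' := measurable_sqr_rnorm mf; have mg' := measurable_sqr_rnorm mg.
rewrite -!ge0_integralZl//;
  try by [rewrite lee_fin|move=> x _; exact: sqr_rnorm_ge0].
rewrite -ge0_integralD//; last 4 first.
- by move=> x _; rewrite mule_ge0// ?lee_fin// sqr_ge0.
- exact: measurable_funeM.
- by move=> x _; rewrite mule_ge0// ?lee_fin// sqr_ge0.
- exact: measurable_funeM.
apply: ge0_le_integral => //.
- by move=> x _; exact: sqr_rnorm_ge0.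
- by apply: measurable_sqr_rnorm; exact: cmeasurableD.
- by apply: emeasurable_funD; exact: measurable_funeM.
- by move=> x _; rewrite -!EFinM -EFinD lee_fin; exact: sqr_rnormD.
Qed.

Lemma L2pred_submod_closed : submod_closed L2pred.
Proof.
split; first by rewrite inE/= L2int0; split => //; exact: cmeasurable0.
move=> z f g /[!inE]/= -[mf lf] [mg lg].
have mzf := cmeasurableZ z mf; split; first exact: cmeasurableD.
apply: le_lt_trans (L2int_le mzf mg ltr01 ltr01) _.
rewrite L2intZ// lte_add_pinfty// !lte_mul_pinfty// ?lee_fin ?sqr_ge0//.
Qed.

HB.instance Definition _ :=
  GRing.isSubmodClosed.Build _ _ L2pred L2pred_submod_closed.

Record L2fun := MkL2fun { L2fun_val :> T -> R[i] ; _ : L2fun_val \in L2pred }.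

HB.instance Definition _ := [isSub for L2fun_val].
HB.instance Definition _ := [Choice of L2fun by <:].
HB.instance Definition _ := [SubChoice_isSubLmodule of L2fun by <:].

Lemma L2funP (f : L2fun) : cmeasurable f /\ (L2int f < +oo)%E.
Proof. by have := valP f; rewrite inE. Qed.

Lemma L2int_fin (f : L2fun) : L2int f \is a fin_num.
Proof. by rewrite ge0_fin_numE ?L2int_ge0//; have [] := L2funP f. Qed.

Definition L2fnorm f : R := Num.sqrt (fine (L2int f)).

Lemma L2fnorm_ge0 f : 0 <= L2fnorm f. Proof. exact: sqrtr_ge0. Qed.

Lemma sqr_L2fnorm (f : L2fun) : (L2fnorm f ^+ 2)%:E = L2int f.
Proof. by rewrite sqr_sqrtr ?fine_ge0 ?L2int_ge0// fineK// L2int_fin. Qed.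

Lemma ler_L2fnormD (f g : L2fun) :
  L2fnorm (f + g) <= L2fnorm f + L2fnorm g.
Proof.
apply/ler_addgt0Pr => e e0.
set s := L2fnorm f + e / 2; set u := L2fnorm g + e / 2.
have s0 : 0 < s by have := L2fnorm_ge0 f; rewrite /s; lra.
have u0 : 0 < u by have := L2fnorm_ge0 g; rewrite /u; lra.
rewrite (_ : _ + e = s + u); last by rewrite /s /u; field.
have su0 : 0 <= s + u by lra.
rewrite -ler_sqr ?nnegrE ?L2fnorm_ge0// -lee_fin sqr_L2fnorm.
have [mf _] := L2funP f; have [mg _] := L2funP g.
apply: le_trans (L2int_le mf mg s0 u0) _.
rewrite -!sqr_L2fnorm -!EFinM -EFinD lee_fin.
rewrite (_ : (s + u) ^+ 2 = (s + u) / s * s ^+ 2 + (s + u) / u * u ^+ 2).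
  have le1 : L2fnorm f ^+ 2 <= s ^+ 2.
    by rewrite lerXn2r ?nnegrE ?L2fnorm_ge0 ?(ltW s0)// /s; lra.
  have le2 : L2fnorm g ^+ 2 <= u ^+ 2.
    by rewrite lerXn2r ?nnegrE ?L2fnorm_ge0 ?(ltW u0)// /u; lra.
  by apply: lerD; rewrite ler_wpM2l// divr_ge0// ltW.
by field; lra.
Qed.

Lemma L2fnormZ z (f : L2fun) : L2fnorm (z *: f) = rnorm z * L2fnorm f.
Proof.
have [mf _] := L2funP f.
rewrite /L2fnorm -[L2fun_val (z *: f)]/(z *: (f : T -> R[i])) L2intZ// fineM// ?L2int_fin//=.
by rewrite sqrtrM ?sqr_ge0// sqrtr_sqr ger0_norm ?rnorm_ge0.
Qed.

Lemma L2fnorm0_ae (f : L2fun) :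
  L2fnorm f = 0 <-> \forall x \ae mu, f x = 0.
Proof.
have [mf _] := L2funP f; have mf2 := measurable_sqr_rnorm mf.
have E : L2fnorm f = 0 <-> (L2int f = 0)%E.
  rewrite -(sqr_L2fnorm f); split => [->|[]]; first by rewrite expr0n.
  by move/eqP; rewrite sqrf_eq0 => /eqP.
rewrite E /L2int.
have := ae_eq_integral_abs mu measurableT mf2.
under eq_integral do rewrite gee0_abs ?sqr_rnorm_ge0//.
move=> ->; split; apply: filterS => x.
  move=> /(_ I)/= [] /eqP; rewrite sqrf_eq0 => /eqP; exact: rnorm0_eq0.
by move=> -> _ /=; rewrite rnorm0 expr0n.
Qed.

Lemma L2fnorm_ae (f g : L2fun) :
  (\forall x \ae mu, f x = g x) -> L2fnorm f = L2fnorm g.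
Proof.
move=> fg; have [mf _] := L2funP f; have [mg _] := L2funP g.
congr (Num.sqrt (fine _)); apply: ae_eq_integral => //.
- exact: measurable_sqr_rnorm.
- exact: measurable_sqr_rnorm.
- by apply: filterS fg => x -> _.
Qed.

End square_integrable.

Section L2_space.
Context d (T : measurableType d) (R : realType).
Variable mu : {measure set T -> \bar R}.
Local Notation L2fun := (L2fun mu).
Implicit Types (f g : L2fun) (z : R[i]).

Definition L2equiv f g : bool := `[< \forall x \ae mu, f x = g x >].

Lemma L2equiv_refl : reflexive L2equiv.
Proof. by move=> f; apply/asboolP/nearW. Qed.

Lemma L2equiv_sym : symmetric L2equiv.
Proof. by move=> f g; apply/asboolP/asboolP; apply: filterS => x ->. Qed.

Lemma L2equiv_trans : transitive L2equiv.
Proof.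
move=> f g h /asboolP gf /asboolP fh; apply/asboolP.
by apply: filterS2 gf fh => x -> ->.
Qed.

Canonical L2equiv_canonical :=
  EquivRel L2equiv L2equiv_refl L2equiv_sym L2equiv_trans.

Local Open Scope quotient_scope.

(* Two functions are identified when they agree [mu]-almost everywhere.  For a
   measure concentrated on a set [D], such as [body_measure] and
   [meridian_measure] below, functions defined on [D] are represented by any
   extension to the whole type. *)
Definition L2 : Type := {eq_quot L2equiv}.
HB.instance Definition _ := Choice.on L2.
HB.instance Definition _ := EqQuotient.on L2.


Definition L2class f : L2 := \pi_L2 f.

Lemma L2classP f g : L2class f = L2class g <-> \forall x \ae mu, f x = g x.
Proof. by split=> [/eqmodP/asboolP//|fg]; apply/eqmodP/asboolP. Qed.

Lemma L2class_repr (u : L2) : L2class (repr u) = u.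
Proof. exact: reprK. Qed.

Lemma repr_L2class f : \forall x \ae mu, repr (L2class f) x = f x.
Proof. by apply/L2classP; rewrite L2class_repr. Qed.

Definition L2zero : L2 := L2class 0.
Definition L2opp (u : L2) : L2 := L2class (- repr u).
Definition L2add (u v : L2) : L2 := L2class (repr u + repr v).
Definition L2scale z (u : L2) : L2 := L2class (z *: repr u).

Lemma L2class_opp f : L2opp (L2class f) = L2class (- f).
Proof. by apply/L2classP; apply: filterS (repr_L2class f) => x e; congr (- _). Qed.

Lemma L2class_add f g : L2add (L2class f) (L2class g) = L2class (f + g).
Proof.
apply/L2classP.
by apply: filterS2 (repr_L2class f) (repr_L2class g) => x /= e1 e2; congr (_ + _).
Qed.

Lemma L2class_scale z f : L2scale z (L2class f) = L2class (z *: f).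
Proof.
by apply/L2classP; apply: filterS (repr_L2class f) => x /= e; congr (_ *: _).
Qed.

Lemma L2addA : associative L2add.
Proof.
by move=> u v w; rewrite -(L2class_repr u) -(L2class_repr v) -(L2class_repr w)
  !L2class_add addrA.
Qed.

Lemma L2addC : commutative L2add.
Proof. by move=> u v; rewrite /L2add addrC. Qed.

Lemma L2add0 : left_id L2zero L2add.
Proof. by move=> u; rewrite -(L2class_repr u) L2class_add add0r. Qed.

Lemma L2addN : left_inverse L2zero L2opp L2add.
Proof. by move=> u; rewrite -(L2class_repr u) L2class_opp L2class_add addNr. Qed.

HB.instance Definition _ :=
  GRing.isZmodule.Build L2 L2addA L2addC L2add0 L2addN.

Lemma L2scaleA (a b : R[i]) (u : L2) :
  L2scale a (L2scale b u) = L2scale (a * b) u.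
Proof. by rewrite -(L2class_repr u) !L2class_scale scalerA. Qed.

Lemma L2scale1 : left_id 1 L2scale.
Proof. by move=> u; rewrite -(L2class_repr u) L2class_scale scale1r. Qed.

Lemma L2scaleDr : right_distributive L2scale +%R.
Proof.
move=> a u v; rewrite -(L2class_repr u) -(L2class_repr v).
by rewrite /GRing.add/= L2class_add !L2class_scale L2class_add scalerDr.
Qed.

Lemma L2scaleDl (u : L2) : {morph L2scale^~ u : a b / a + b}.
Proof.
move=> a b; rewrite -(L2class_repr u).
by rewrite [RHS]/GRing.add/= !L2class_scale L2class_add scalerDl.
Qed.

HB.instance Definition _ := GRing.Zmodule_isLmodule.Build R[i] L2
  L2scaleA L2scale1 L2scaleDr L2scaleDl.

Lemma L2classD f g : L2class (f + g) = L2class f + L2class g.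
Proof. by rewrite -L2class_add. Qed.

Lemma L2classZ z f : L2class (z *: f) = z *: L2class f.
Proof. by rewrite -L2class_scale. Qed.

Definition L2norm (u : L2) : R[i] := (L2fnorm mu (repr u))%:C%C.

Lemma L2norm_class f : L2norm (L2class f) = (L2fnorm mu f)%:C%C.
Proof. by congr (_%:C%C); apply: L2fnorm_ae; exact: repr_L2class. Qed.

Lemma ler_L2normD u v : L2norm (u + v) <= L2norm u + L2norm v.
Proof.
rewrite -(L2class_repr u) -(L2class_repr v) -L2classD !L2norm_class.
by rewrite -rmorphD lecR ler_L2fnormD.
Qed.

Lemma L2normZ z u : L2norm (z *: u) = `|z| * L2norm u.
Proof.
rewrite -(L2class_repr u) -L2classZ !L2norm_class L2fnormZ.
by rewrite rmorphM/= rnormE.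
Qed.

Lemma L2norm_eq0 u : L2norm u = 0 -> u = 0.
Proof.
rewrite -(L2class_repr u) L2norm_class => /(@complexI R) /L2fnorm0_ae u0.
by apply/L2classP; apply: filterS u0 => x ->.
Qed.

HB.instance Definition _ := Lmodule_isNormed.Build R[i] L2
  ler_L2normD L2normZ L2norm_eq0.

Lemma norm_L2class f : `|L2class f| = (L2fnorm mu f)%:C%C.
Proof. exact: L2norm_class. Qed.

(* [f] itself is square integrable, and [u] is its class. *)
Definition L2represents (f : T -> R[i]) (u : L2) : Prop :=
  exists g : L2fun, (g : T -> R[i]) = f /\ L2class g = u.

End L2_space.

Arguments L2represents {d T R} mu f u.

Section subspace.
Context (K : numFieldType) (V : normedModType K) (S : submodClosed V).

Record subspace := MkSubspace { subspace_val :> V ; _ : subspace_val \in S }.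

HB.instance Definition _ := [isSub for subspace_val].
HB.instance Definition _ := [Choice of subspace by <:].
HB.instance Definition _ := [SubChoice_isSubLmodule of subspace by <:].

Definition subspace_norm (x : subspace) : K := `|\val x|.

Lemma ler_subspace_normD x y :
  subspace_norm (x + y) <= subspace_norm x + subspace_norm y.
Proof. exact: ler_normD. Qed.

Lemma subspace_normZ a x : subspace_norm (a *: x) = `|a| * subspace_norm x.
Proof. exact: normrZ. Qed.

Lemma subspace_norm_eq0 x : subspace_norm x = 0 -> x = 0.
Proof. by move=> /normr0_eq0 x0; exact: val_inj. Qed.

HB.instance Definition _ := Lmodule_isNormed.Build K subspace
  ler_subspace_normD subspace_normZ subspace_norm_eq0.

End subspace.

Section l2_sum.
Context (R : realType) (I : choiceType) (X : I -> normedModType R[i]).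
Implicit Types (x y : forall k, X k) (z : R[i]).

Definition sumsq x : \bar R := \esum_(k in [set: I]) (rnorm (x k) ^+ 2)%:E.

Record l2sum := MkL2sum {
  l2seq :> forall k, X k ;
  l2seq_fin : (sumsq l2seq < +oo)%E }.

HB.instance Definition _ := gen_eqMixin l2sum.
HB.instance Definition _ := gen_choiceMixin l2sum.

Lemma l2sum_eq (x y : l2sum) : (forall k, x k = y k) -> x = y.
Proof.
case: x y => [x xf] [y yf] /= xy; have {}xy : x = y by exact: functional_extensionality_dep.
by subst y; congr MkL2sum; exact: Prop_irrelevance.
Qed.

Lemma sumsq_ge0 x : (0 <= sumsq x)%E.
Proof. by apply: esum_ge0 => k _; rewrite lee_fin sqr_ge0. Qed.

Lemma le_esumZ (c : R) (f : I -> R) : 0 <= c -> (forall k, 0 <= f k) ->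
  (\esum_(k in [set: I]) (c * f k)%:E <= c%:E * \esum_(k in [set: I]) (f k)%:E)%E.
Proof.
move=> c0 f0; apply: ub_ereal_sup => _ [A fA <-].
under eq_fsbigr do rewrite EFinM.
rewrite -ge0_mule_fsumr; last by move=> k; rewrite lee_fin.
by rewrite lee_wpmul2l ?lee_fin//; apply: ereal_sup_ubound; exists A.
Qed.

Lemma sumsqZ z x : sumsq (fun k => z *: x k) = ((rnorm z ^+ 2)%:E * sumsq x)%E.
Proof.
have le w y : (sumsq (fun k => w *: y k) <= (rnorm w ^+ 2)%:E * sumsq y)%E.
  rewrite /sumsq; under eq_esum do rewrite rnormZ exprMn.
  by apply: le_esumZ => *; rewrite sqr_ge0.
have [->|z0] := eqVneq z 0.
  rewrite rnorm0 expr0n/= mul0e; apply: esum1 => k _.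
  by rewrite scale0r rnorm0 expr0n.
apply/eqP; rewrite eq_le le/=.
have rz : 0 < rnorm z.
  rewrite lt_neqAle rnorm_ge0 andbT eq_sym; apply: contra_neq z0.
  exact: rnorm0_eq0.
have := le z^-1 (fun k => z *: x k).
have -> : (fun k => z^-1 *: (z *: x k)) = x.
  by apply: functional_extensionality_dep => k; rewrite scalerA mulVf// scale1r.
move=> /(@lee_wpmul2l _ (rnorm z ^+ 2)%:E); rewrite lee_fin sqr_ge0 => /(_ isT).
rewrite muleA -EFinM -exprMn -rnormM mulfV// => /le_trans; apply.
by rewrite /rnorm normr1/= expr1n mul1e.
Qed.

Lemma sumsqD x y (s u : R) : 0 < s -> 0 < u ->
  (sumsq (fun k => x k + y k)%R <=
    ((s + u) / s)%R%:E * sumsq x + ((s + u) / u)%R%:E * sumsq y)%E.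
Proof.
move=> s0 u0.
have a0 : 0 <= (s + u) / s by rewrite divr_ge0 ?addr_ge0 ?ltW.
have b0 : 0 <= (s + u) / u by rewrite divr_ge0 ?addr_ge0 ?ltW.
apply: (@le_trans _ _ (\esum_(k in [set: I])
    (((s + u) / s * rnorm (x k) ^+ 2)%:E + ((s + u) / u * rnorm (y k) ^+ 2)%:E)))%E.
  by apply: le_esum => k _; rewrite -EFinD lee_fin sqr_rnormD.
rewrite esumD; last 2 first.
- by move=> k _; rewrite lee_fin mulr_ge0// sqr_ge0.
- by move=> k _; rewrite lee_fin mulr_ge0// sqr_ge0.
by apply: leeD; apply: le_esumZ => // k; rewrite sqr_ge0.
Qed.

Lemma l2zero_fin : (sumsq (fun=> 0%R) < +oo)%E.
Proof. by rewrite /sumsq esum1// => k _; rewrite rnorm0 expr0n. Qed.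

Lemma l2scale_fin z (x : l2sum) : (sumsq (fun k => z *: x k) < +oo)%E.
Proof. by rewrite sumsqZ lte_mul_pinfty ?lee_fin ?sqr_ge0// l2seq_fin. Qed.

Lemma l2add_fin (x y : l2sum) : (sumsq (fun k => x k + y k)%R < +oo)%E.
Proof.
apply: le_lt_trans (sumsqD x y ltr01 ltr01) _.
by rewrite lte_add_pinfty// lte_mul_pinfty ?lee_fin ?divr_ge0// l2seq_fin.
Qed.

Definition l2zero := MkL2sum l2zero_fin.
Definition l2scale z (x : l2sum) := MkL2sum (l2scale_fin z x).
Definition l2add (x y : l2sum) := MkL2sum (l2add_fin x y).
Definition l2opp (x : l2sum) := l2scale (-1) x.

Lemma l2addA : associative l2add.
Proof. by move=> x y v; apply: l2sum_eq => k; exact: addrA. Qed.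

Lemma l2addC : commutative l2add.
Proof. by move=> x y; apply: l2sum_eq => k; exact: addrC. Qed.

Lemma l2add0 : left_id l2zero l2add.
Proof. by move=> x; apply: l2sum_eq => k; exact: add0r. Qed.

Lemma l2addN : left_inverse l2zero l2opp l2add.
Proof. by move=> x; apply: l2sum_eq => k; rewrite /= scaleN1r addNr. Qed.

HB.instance Definition _ :=
  GRing.isZmodule.Build l2sum l2addA l2addC l2add0 l2addN.

Lemma l2scaleA a b (x : l2sum) : l2scale a (l2scale b x) = l2scale (a * b) x.
Proof. by apply: l2sum_eq => k; exact: scalerA. Qed.

Lemma l2scale1 : left_id 1 l2scale.
Proof. by move=> x; apply: l2sum_eq => k; exact: scale1r. Qed.

Lemma l2scaleDr : right_distributive l2scale +%R.
Proof. by move=> a x y; apply: l2sum_eq => k; exact: scalerDr. Qed.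

Lemma l2scaleDl (x : l2sum) : {morph l2scale^~ x : a b / a + b}.
Proof. by move=> a b; apply: l2sum_eq => k; exact: scalerDl. Qed.

HB.instance Definition _ := GRing.Zmodule_isLmodule.Build R[i] l2sum
  l2scaleA l2scale1 l2scaleDr l2scaleDl.

Definition l2rnorm (x : l2sum) : R := Num.sqrt (fine (sumsq x)).

Definition l2norm (x : l2sum) : R[i] := (l2rnorm x)%:C%C.

Lemma l2rnorm_ge0 (x : l2sum) : 0 <= l2rnorm x. Proof. exact: sqrtr_ge0. Qed.

Lemma sumsq_fin (x : l2sum) : sumsq x \is a fin_num.
Proof. by rewrite ge0_fin_numE ?sumsq_ge0 ?l2seq_fin. Qed.

Lemma sqr_l2rnorm (x : l2sum) : (l2rnorm x ^+ 2)%:E = sumsq x.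
Proof. by rewrite sqr_sqrtr ?fine_ge0 ?sumsq_ge0// fineK// sumsq_fin. Qed.

Lemma ler_l2normD (x y : l2sum) : l2norm (x + y) <= l2norm x + l2norm y.
Proof.
rewrite -rmorphD lecR.
apply/ler_addgt0Pr => e e0.
set s := l2rnorm x + e / 2; set u := l2rnorm y + e / 2.
have s0 : 0 < s by have := l2rnorm_ge0 x; rewrite /s; lra.
have u0 : 0 < u by have := l2rnorm_ge0 y; rewrite /u; lra.
rewrite (_ : _ + e = s + u); last by rewrite /s /u; field.
have su0 : 0 <= s + u by lra.
rewrite -ler_sqr ?nnegrE ?l2rnorm_ge0// -lee_fin sqr_l2rnorm.
apply: le_trans (sumsqD x y s0 u0) _.
rewrite -!sqr_l2rnorm -!EFinM -EFinD lee_fin.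
rewrite (_ : (s + u) ^+ 2 = (s + u) / s * s ^+ 2 + (s + u) / u * u ^+ 2).
  have le1 : l2rnorm x ^+ 2 <= s ^+ 2.
    by rewrite lerXn2r ?nnegrE ?l2rnorm_ge0 ?(ltW s0)// /s; lra.
  have le2 : l2rnorm y ^+ 2 <= u ^+ 2.
    by rewrite lerXn2r ?nnegrE ?l2rnorm_ge0 ?(ltW u0)// /u; lra.
  by apply: lerD; rewrite ler_wpM2l// divr_ge0// ltW.
by field; lra.
Qed.

Lemma l2normZ z (x : l2sum) : l2norm (z *: x) = `|z| * l2norm x.
Proof.
rewrite -rnormE -rmorphM/=; congr (_%:C%C).
rewrite /l2rnorm [sumsq _]sumsqZ fineM ?sumsq_fin//=.
by rewrite sqrtrM ?sqr_ge0// sqrtr_sqr ger0_norm ?rnorm_ge0.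
Qed.

Lemma l2norm_eq0 (x : l2sum) : l2norm x = 0 -> x = 0.
Proof.
move=> /(@complexI R) x0; apply: l2sum_eq => k; apply: rnorm0_eq0.
have : ((rnorm (x k) ^+ 2)%:E <= sumsq x)%E.
  rewrite -(@esum_set1 _ _ k (fun k => (rnorm (x k) ^+ 2)%:E)) ?lee_fin ?sqr_ge0//.
  apply: le_ereal_sup => _ [A [fA Ak] <-]; exists A => //.
rewrite -sqr_l2rnorm x0 expr0n lee_fin/= => xk.
by apply/eqP; rewrite -sqrf_eq0 eq_le xk sqr_ge0.
Qed.

HB.instance Definition _ := Lmodule_isNormed.Build R[i] l2sum
  ler_l2normD l2normZ l2norm_eq0.

Lemma norm_l2sum (x : l2sum) : `|x| = (l2rnorm x)%:C%C.
Proof. by []. Qed.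

End l2_sum.

Section complex_integral.
Context d (T : measurableType d) (R : realType).
Variable mu : {measure set T -> \bar R}.

Definition cintegral (D : set T) (f : T -> R[i]) : R[i] :=
  Complex (\int[mu]_(x in D) complex.Re (f x))
          (\int[mu]_(x in D) complex.Im (f x)).

End complex_integral.

Section zero_mean.
Context d (T : measurableType d) (R : realType).
Variable mu : {finite_measure set T -> \bar R}.

Lemma L2fun_integrable (f : L2fun mu) :
  mu.-integrable setT (EFin \o (fun x => complex.Re (f x))) /\
  mu.-integrable setT (EFin \o (fun x => complex.Im (f x))).
Proof.
have [mf lf] := L2funP f; have [f1 f2] := mf.
have i1 : mu.-integrable setT (fun x => (1 + rnorm (f x) ^+ 2)%:E).
  rewrite (_ : (fun _ => _) = (cst 1%E \+ fun x => (rnorm (f x) ^+ 2)%:E)%E)//.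
  apply: integrableD => //; first exact: finite_measure_integrable_cst.
  apply/integrableP; split; first exact: measurable_sqr_rnorm.
  by under eq_integral do rewrite gee0_abs ?lee_fin ?sqr_ge0//.
have le1 (a b : R) : `|a| <= 1 + (a ^+ 2 + b ^+ 2).
  by rewrite ler_norml; apply/andP; split; nra.
split; apply: le_integrable i1 => //; try exact/measurable_EFinP.
  move=> x _ /=; rewrite lee_fin sqr_rnormE [leRHS]ger0_norm//.
  by rewrite addr_ge0// addr_ge0 ?sqr_ge0.
move=> x _ /=; rewrite lee_fin sqr_rnormE [leRHS]ger0_norm.
  by rewrite [in leRHS](addrC (_ ^+ 2)).
by rewrite addr_ge0// addr_ge0 ?sqr_ge0.
Qed.

Lemma cintegral_ae (f g : L2fun mu) : (\forall x \ae mu, f x = g x) ->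
  cintegral mu setT f = cintegral mu setT g.
Proof.
move=> fg; have [[f1 f2] _] := L2funP f; have [[g1 g2] _] := L2funP g.
congr Complex; congr fine; apply: ae_eq_integral => //;
  try exact/measurable_EFinP; by apply: filterS fg => x -> _.
Qed.

Lemma cintegralD (f g : L2fun mu) :
  cintegral mu setT (f + g) = cintegral mu setT f + cintegral mu setT g.
Proof.
have [f1 f2] := L2fun_integrable f; have [g1 g2] := L2fun_integrable g.
rewrite /cintegral /GRing.add/= -!RintegralD//.
by congr Complex; apply: eq_Rintegral => x _; rewrite -raddfD.
Qed.

Lemma cintegralZ (z : R[i]) (f : L2fun mu) :
  cintegral mu setT (z *: f) = z * cintegral mu setT f.
Proof.
have [f1 f2] := L2fun_integrable f; case: z => a b.
rewrite /cintegral [RHS]/GRing.mul/= -!RintegralZl// -RintegralB//; last 2 first.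
- by rewrite [X in integrable _ _ X](_ : _ = (fun x => a%:E * (complex.Re (f x))%:E)%E)//; exact: integrableZl.
- by rewrite [X in integrable _ _ X](_ : _ = (fun x => b%:E * (complex.Im (f x))%:E)%E)//; exact: integrableZl.
rewrite -RintegralD//; last 2 first.
- by rewrite [X in integrable _ _ X](_ : _ = (fun x => a%:E * (complex.Im (f x))%:E)%E)//; exact: integrableZl.
- by rewrite [X in integrable _ _ X](_ : _ = (fun x => b%:E * (complex.Re (f x))%:E)%E)//; exact: integrableZl.
by congr Complex; apply: eq_Rintegral => x _; rewrite /= /GRing.scale/=; case: (f x).
Qed.

(* The choice of the representative is irrelevant, see [zero_meanE]. *)
Definition zero_mean : {pred L2 mu} :=
  [pred u : L2 mu | cintegral mu setT (repr u) == 0].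

Lemma zero_meanE (f : L2fun mu) :
  (L2class f \in zero_mean) = (cintegral mu setT f == 0).
Proof. by rewrite inE (cintegral_ae (repr_L2class f)). Qed.

Lemma zero_mean_submod_closed : submod_closed zero_mean.
Proof.
split.
  have -> : 0 = L2class (0 : L2fun mu) by [].
  have -> : (0 : L2fun mu) = 0 *: 0 by rewrite scale0r.
  by rewrite zero_meanE cintegralZ mul0r.
move=> z u v; rewrite -(L2class_repr u) -(L2class_repr v) -L2classZ -L2classD.
rewrite !zero_meanE cintegralD cintegralZ => /eqP-> /eqP->.
by rewrite mulr0 addr0.
Qed.

HB.instance Definition _ :=
  GRing.isSubmodClosed.Build _ _ zero_mean zero_mean_submod_closed.

End zero_mean.

Arguments zero_mean {d T R} mu.

Section geometry.
Context (R : realType).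

Definition frontier (T : topologicalType) (D : set T) : set T :=
  closure D `\` D°.

Definition segment (a b : R * R) : set (R * R) :=
  [set p | exists2 t, 0 <= t <= 1 & p = (1 - t) *: a + t *: b].

(* The segments are nondegenerate, so that a polygonal domain has no isolated
   boundary point; the boundary need not be connected, and no local Lipschitz
   condition is required. *)
Definition polygonal (D : set (R * R)) :=
  [/\ open D, connected D, bounded_set D &
    exists2 s : seq ((R * R) * (R * R)), all (fun e => e.1 != e.2) s &
      frontier D = [set p | exists2 e, e \in s & segment e.1 e.2 p]].

Definition cylindrical (r t z : R) : R * R * R := (r * cos t, r * sin t, z).

Definition rotate_z (t : R) (x : R * R * R) : R * R * R :=
  (x.1.1 * cos t - x.1.2 * sin t, x.1.1 * sin t + x.1.2 * cos t, x.2).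

Definition half_section (B : set (R * R * R)) : set (R * R) :=
  [set p | 0 < p.1 /\ B (p.1, 0, p.2)].

Definition axis_boundary (D : set (R * R)) : set (R * R) :=
  [set p | p.1 = 0 /\ [set z | frontier D (0, z)]° p.2].

Definition revolve (D : set (R * R)) : set (R * R * R) :=
  [set x | exists p t, D p /\ x = cylindrical p.1 t p.2].

(* [axis_boundary] plays the role of Gamma_0: the interior, relative to the
   axis r = 0, of the part of the boundary lying on the axis. [body_nonempty] is
   needed for a domain because the empty set is [connected] in the library. *)
Record axisymmetric_domain := AxisymmetricDomain {
  body :> set (R * R * R) ;
  body_open : open body ;
  body_connected : connected body ;
  body_nonempty : body !=set0 ;
  body_bounded : bounded_set body ;
  body_rotate : forall t x, body x -> body (rotate_z t x) ;
  body_polygonal : polygonal (half_section body) ;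
  body_revolve :
    body = revolve (half_section body `|` axis_boundary (half_section body)) }.

End geometry.

Section measurable_open.

Let mbase (T : topologicalType) (m : set (set T)) :=
  exists B : nat -> set T, (forall n, m (B n)) /\
    forall x U, nbhs x U -> exists n, B n x /\ B n `<=` U.

Let mbase_open (T : topologicalType) (m : set (set T)) (U : set T) :
  mbase m -> m set0 ->
  (forall F : nat -> set T, (forall n, m (F n)) -> m (\bigcup_n F n)) ->
  open U -> m U.
Proof.
move=> [B [mB BP]] m0 mU oU.
have -> : U = \bigcup_n (if `[< B n `<=` U >] then B n else set0).
  apply/seteqP; split => [x Ux|x [n _]].
    have [n [Bx BU]] := BP x U (open_nbhs_nbhs (conj oU Ux)).
    by exists n => //; rewrite asboolT.
  by case: asboolP => // BU /BU.
by apply: mU => n; case: asboolP.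
Qed.

Let mbase_prod (T1 T2 : topologicalType) (m1 : set (set T1))
    (m2 : set (set T2)) (m : set (set (T1 * T2))) :
  mbase m1 -> mbase m2 -> (forall A B, m1 A -> m2 B -> m (A `*` B)) -> mbase m.
Proof.
move=> [B1 [mB1 B1P]] [B2 [mB2 B2P]] mX.
exists (fun n => let: (i, j) := odflt (0, 0)%N (unpickle n) in B1 i `*` B2 j).
split=> [n|[x y] U [[U1 U2] /= [U1x U2y] UU]].
  by case: (odflt _ _) => i j; exact: mX.
have [i [Bi BiU]] := B1P _ _ U1x; have [j [Bj BjU]] := B2P _ _ U2y.
exists (pickle (i, j)); rewrite pickleK/=; split=> [//|[a b] [/= Ba Bb]].
by apply: UU; split; [exact: BiU|exact: BjU].
Qed.

Context (R : realType).
Local Notation mR := (measurableTypeR R).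

Let mbaseR : @mbase R (@measurable _ mR).
Proof.
exists (fun n => let: (q, i) := odflt (0 : rat, 0%N) (unpickle n) in
  ball (ratr q : R) i.+1%:R^-1); split=> [n|x U].
  case: (odflt _ _) => q i; apply: open_measurable.
  by apply: ball_open; rewrite invr_gt0.
rewrite -nbhs_ballE => -[e /= e0 eU].
have e20 : 0 < e / 2 by rewrite divr_gt0.
pose i := Num.truncn (e / 2)^-1.
have ie : i.+1%:R^-1 < e / 2.
  by rewrite invf_plt ?posrE//; exact: truncnS_gt.
have : x - i.+1%:R^-1 < x + i.+1%:R^-1 by rewrite ltrD2l gtrN// invr_gt0.
move=> /rat_in_itvoo[q]; rewrite in_itv/= => /andP[q1 q2].
have bqx : ball (ratr q : R) i.+1%:R^-1 x.
  rewrite -ball_normE/= ltr_norml.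
  by move: q1 q2; move: (_^-1) (ratr q) => r s q1 q2; apply/andP; split; lra.
exists (pickle (q, i)); rewrite pickleK/=; split => // y qy.
apply: eU; rewrite (splitr e); apply: (@ball_triangle _ _ (ratr q : R)).
  by apply/ball_sym; apply: le_ball bqx; exact: ltW.
by apply: le_ball qy; exact: ltW.
Qed.

Let mbaseRR : @mbase (R * R)%type (@measurable _ (mR * mR)%type).
Proof. by apply: (mbase_prod mbaseR mbaseR) => A B; exact: measurableX. Qed.

Let mbaseRRR : @mbase (R * R * R)%type (@measurable _ (mR * mR * mR)%type).
Proof. by apply: (mbase_prod mbaseRR mbaseR) => A B; exact: measurableX. Qed.

Lemma open_measurable_RR (D : set (R * R)) :
  open D -> measurable (D : set (mR * mR)).
Proof.
apply: (mbase_open mbaseRR) => [|F mF]; first exact: measurable0.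
exact: bigcupT_measurable.
Qed.

Lemma open_measurable_RRR (D : set (R * R * R)) :
  open D -> measurable (D : set (mR * mR * mR)).
Proof.
apply: (mbase_open mbaseRRR) => [|F mF]; first exact: measurable0.
exact: bigcupT_measurable.
Qed.

End measurable_open.

Lemma product_sigma_finite d1 d2 (T1 : measurableType d1)
    (T2 : measurableType d2) (R : realType)
    (m1 : {sigma_finite_measure set T1 -> \bar R})
    (m2 : {sigma_finite_measure set T2 -> \bar R}) :
  sigma_finite setT (m1 \x m2)%E.
Proof.
have /sigma_finiteP[F [TF ndF Foo]] := sigma_finiteT m1.
have /sigma_finiteP[G [TG ndG Goo]] := sigma_finiteT m2.
exists (fun n => F n `*` G n).
  rewrite -setXTT TF TG predeqE => -[x y]; split.
    move=> [/= [n _ Fnx] [k _ Gky]]; exists (maxn n k) => //; split.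
    - by move: x Fnx; exact/subsetPset/ndF/leq_maxl.
    - by move: y Gky; exact/subsetPset/ndG/leq_maxr.
  by move=> [n _ []/= ? ?]; split; exists n.
move=> k; have [? ?] := Foo k; have [? ?] := Goo k.
split; first exact: measurableX.
by rewrite product_measure1E// lte_mul_pinfty// ge0_fin_numE.
Qed.

Section domain_measures.
Context (R : realType).
Local Notation mR := (measurableTypeR R).

Definition lebesgue2 : set (mR * mR) -> \bar R :=
  (@lebesgue_measure R \x @lebesgue_measure R)%E.

HB.instance Definition _ := Measure.on lebesgue2.

HB.instance Definition _ := Measure_isSigmaFinite.Build _ _ _ lebesgue2
  (product_sigma_finite (@lebesgue_measure R) (@lebesgue_measure R)).

Definition lebesgue3 : set (mR * mR * mR)%type -> \bar R :=
  (lebesgue2 \x @lebesgue_measure R)%E.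

HB.instance Definition _ := Measure.on lebesgue3.
HB.instance Definition _ := Measure_isSigmaFinite.Build _ _ _ lebesgue3
  (product_sigma_finite lebesgue2 (@lebesgue_measure R)).

Lemma bounded_set_ball (V : normedModType R) (D : set V) :
  bounded_set D -> exists2 M, 0 < M & forall x, D x -> `|x| < M.
Proof. by move=> /ex_strict_bound_gt0[M M0 DM]; exists M. Qed.

Let box (M : R) : set R := `]-M, M[.

Let mbox M : measurable (box M : set mR). Proof. exact: measurable_itv. Qed.

Let lboxoo M : (lebesgue_measure (box M) < +oo)%E.
Proof. by rewrite lebesgue_measure_itv/=; case: ifP => //= _; rewrite -EFinB ltry. Qed.

Let mul_lty (x y : \bar R) :
  (0 <= x -> x < +oo -> y < +oo -> x * y < +oo)%E.
Proof. by move=> x0 xoo yoo; rewrite lte_mul_pinfty// ge0_fin_numE. Qed.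

Let lbox2oo M : (lebesgue2 (box M `*` box M) < +oo)%E.
Proof.
rewrite /lebesgue2 product_measure1E//.
exact: mul_lty (measure_ge0 _ _) (lboxoo M) (lboxoo M).
Qed.

Lemma bounded_lebesgue2 (D : set (R * R)) : measurable (D : set (mR * mR)) ->
  bounded_set D -> (lebesgue2 D < +oo)%E.
Proof.
move=> mD /bounded_set_ball[M M0 DM].
apply: (@le_lt_trans _ _ (lebesgue2 (box M `*` box M))).
  apply: le_measure; rewrite ?inE//; first exact: measurableX.
  move=> [x y] /DM; rewrite prod_normE/= gt_max => /andP[xM yM].
  by split; rewrite /box /= in_itv/= -ltr_norml.
exact: lbox2oo.
Qed.

Lemma bounded_lebesgue3 (D : set (R * R * R)) :
  measurable (D : set (mR * mR * mR)) -> bounded_set D -> (lebesgue3 D < +oo)%E.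
Proof.
move=> mD /bounded_set_ball[M M0 DM].
apply: (@le_lt_trans _ _ (lebesgue3 (box M `*` box M `*` box M))).
  apply: le_measure; rewrite ?inE//.
    by apply: measurableX => //; exact: measurableX.
  move=> [[x y] z] /DM; rewrite !prod_normE/= !gt_max => /andP[/andP[xM yM] zM].
  by split; [split|]; rewrite /box /= in_itv/= -ltr_norml.
rewrite /lebesgue3 product_measure1E//; last exact: measurableX.
apply: mul_lty (lboxoo M); first exact: measure_ge0.
exact: lbox2oo.
Qed.

Variable B : axisymmetric_domain R.

Lemma body_measurable : measurable (B : set (mR * mR * mR)).
Proof. by apply: open_measurable_RRR; exact: body_open. Qed.

Definition body_measure : set (mR * mR * mR)%type -> \bar R :=
  mrestr lebesgue3 body_measurable.

HB.instance Definition _ := Measure.on body_measure.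

Lemma body_measure_fin : fin_num_fun body_measure.
Proof.
move=> A mA; rewrite ge0_fin_numE ?measure_ge0//.
have mB := body_measurable.
have leB : (lebesgue3 (A `&` (B : set (R * R * R))) <= lebesgue3 B)%E.
  by apply: (le_measure lebesgue3); rewrite ?inE//; exact: measurableI.
exact: le_lt_trans leB (bounded_lebesgue3 mB (body_bounded B)).
Qed.

HB.instance Definition _ :=
  Measure_isFinite.Build _ _ _ body_measure body_measure_fin.

Let Om : set (mR * mR) := half_section B.

Lemma half_section_measurable : measurable Om.
Proof. by apply: open_measurable_RR; have [] := body_polygonal B. Qed.

(* The measure r dr dz on the half section. *)
Definition meridian_measure (A : set (mR * mR)) : \bar R :=
  (\int[lebesgue2]_(p in A `&` Om) p.1%:E)%E.

Let Om_ge0 (A : set (mR * mR)) p : (A `&` Om) p -> (0 <= p.1%:E)%E.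
Proof. by move=> [_ [p0 _]]; rewrite lee_fin; exact: ltW. Qed.

Let meridian_measure0 : meridian_measure set0 = 0%E.
Proof. by rewrite /meridian_measure set0I integral_set0. Qed.

Let meridian_measure_ge0 A : (0 <= meridian_measure A)%E.
Proof. by apply: integral_ge0 => p; exact: Om_ge0. Qed.

Let mfst (A : set (mR * mR)) :
  measurable_fun A (fun p : mR * mR => (p.1 : R)%:E).
Proof. by apply/measurable_EFinP; apply: measurable_funTS; exact: measurable_fst. Qed.

Let meridian_measure_sigma_additive : semi_sigma_additive meridian_measure.
Proof.
move=> /= F mF tF mUF; rewrite /meridian_measure setI_bigcupl.
rewrite ge0_integral_bigcup//=.
- by apply: is_cvg_ereal_nneg_natsum_cond => n _ _; exact: meridian_measure_ge0.
- by move=> k; apply: measurableI => //; exact: half_section_measurable.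
- by move=> p [n _ /Om_ge0].
- exact: trivIset_setIr.
Qed.

HB.instance Definition _ := isMeasure.Build _ _ _ meridian_measure
  meridian_measure0 meridian_measure_ge0 meridian_measure_sigma_additive.

Lemma meridian_measure_fin : fin_num_fun meridian_measure.
Proof.
move=> A mA; rewrite ge0_fin_numE ?measure_ge0//.
have [oD _ bD _] := body_polygonal B.
have mO := half_section_measurable.
have mAO : measurable (A `&` Om) by exact: measurableI.
have [M M0 DM] := bounded_set_ball bD.
have lO : (lebesgue2 (A `&` Om) < +oo)%E.
  apply: le_lt_trans (bounded_lebesgue2 mO bD).
  by apply: le_measure; rewrite ?inE.
apply: (@le_lt_trans _ _ (\int[lebesgue2]_(p in A `&` Om) M%:E)%E).
  apply: ge0_le_integral => //.
  - by move=> p; exact: Om_ge0.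
  - move=> [r z] [_ /DM]; rewrite prod_normE/= gt_max lee_fin => /andP[+ _].
    by move=> /ltW; apply: le_trans; exact: ler_norm.
by rewrite integral_cst// lte_mul_pinfty// lee_fin ltW.
Qed.

HB.instance Definition _ :=
  Measure_isFinite.Build _ _ _ meridian_measure meridian_measure_fin.

End domain_measures.

Section spaces.
Context (R : realType) (B : axisymmetric_domain R).

Definition L2_0 : normedModType R[i] := subspace (zero_mean (body_measure B)).

Definition L2_1 : normedModType R[i] := L2 (meridian_measure B).

(* Both cases are realized as subspaces of [L2_1], which makes the norm of
   every [L2_k0 k] the one of [L2_1]. *)
Definition L2_k0_pred (k : int) : {pred L2 (meridian_measure B)} :=
  [pred u | if k == 0 then u \in zero_mean (meridian_measure B) else true].

Lemma L2_k0_pred_submod_closed k : submod_closed (L2_k0_pred k).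
Proof.
have [z0 zD] := zero_mean_submod_closed (meridian_measure B).
split; rewrite /L2_k0_pred; first by rewrite inE; case: ifP.
by move=> a u v; rewrite !inE; case: ifP => // _; exact: zD.
Qed.

HB.instance Definition _ k :=
  GRing.isSubmodClosed.Build _ _ (L2_k0_pred k) (L2_k0_pred_submod_closed k).

Definition L2_k0 (k : int) : normedModType R[i] := subspace (L2_k0_pred k).

End spaces.

Section fourier.
Context (R : realType).

(* [expi x] is e^{i x}. *)
Definition expi (x : R) : R[i] := Complex (cos x) (sin x).

(* For [p] in the half section of a domain, the integrand only involves values
   of [f] on the domain. *)
Definition fourier_coef (f : R * R * R -> R[i]) (k : int) (p : R * R) : R[i] :=
  ((Num.sqrt (2 * pi))^-1)%:C%C *
  cintegral (@lebesgue_measure R) `]-pi, pi]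
    (fun t => f (cylindrical p.1 t p.2) * expi (- (k%:~R * t))).

End fourier.

(* Main.v *)
(* In cylindrical coordinates the Lebesgue measure of the body is the product of
   r dr dz on the half section and of dt on ]-pi, pi], because polar coordinates
   are a composition of two one-variable substitutions and Tonelli's theorem. On
   almost every circle, expanding the square of h - c e_k gives
     |h - c e_k|^2 + |h^k|^2 = |h|^2 + |h^k - c|^2,
   and integrating over the half section yields the same identity between the
   coefficient maps F_k : L2(body) -> L2_1 and the synthesis maps
   E_k x = x(r, z) e^{i k t} / sqrt(2 pi), which satisfy F_j E_k = delta_jk.
   Bessel's inequality, Riesz-Fischer (by completeness of L2) and Parseval follow
   formally, once F_k f = 0 for all k implies f = 0. For the latter, the bounded
   functions multiplying the annihilator of the trigonometric system into itself
   form an algebra closed under bounded pointwise limits; it contains cos and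
   sin, hence the indicators of half-lines, hence those of all Borel sets.
   Finally f has zero mean if and only if F_0 f has. *)
Require Import Defs.
From HB Require Import structures.
From mathcomp Require Import all_boot all_order all_algebra.
From mathcomp Require Import all_classical all_reals all_analysis measurable_realfun.
From mathcomp Require Import complex.
From mathcomp Require Import ring lra.

Set Implicit Arguments.
Unset Strict Implicit.
Unset Printing Implicit Defensive.

Import Order.TTheory GRing.Theory Num.Theory.
Import numFieldNormedType.Exports.

Local Open Scope classical_set_scope.
Local Open Scope ring_scope.

(** * Weighted integrals and changes of variable *)

(** A coefficient is an integral over each circle, so it is treated pointwise in [(r, z)] and passed
    to classes only afterwards. One identity between sums of squared norms replaces the inner
    product: [c = h^k] in it gives Bessel's inequality, [h = 0] the isometry of synthesis, and
    Bessel's inequality for a null function shows that coefficients respect almost everywhere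
    equality. Its terms are all nonnegative, so it survives integration even where finiteness is not
    yet known. On the circle the function is merely integrable when uniqueness is proved. Iterating
    a cubic polynomial turns [cos] and [sin] into indicators as bounded pointwise limits, so
    dominated convergence takes the place of a density theorem for trigonometric polynomials.
    Completeness is stated for sequences with an explicit rate. The partial sums in Riesz-Fischer
    are chosen to meet that rate, which avoids extracting subsequences. Parseval follows by
    comparing a function with the one rebuilt from its coefficients. *)

Section weighted_integral.
Local Open Scope ereal_scope.
Context d1 d2 (X : measurableType d1) (Y : measurableType d2) (R : realType).
Variables (mu : {measure set X -> \bar R}) (nu : {measure set Y -> \bar R}).
Variables (D : set X) (w : X -> R) (phi : X -> Y).
Hypotheses (mD : measurable D) (mw : measurable_fun D w).
Hypotheses (w0 : forall x, D x -> (0 <= w x)%R) (mphi : measurable_fun D phi).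
Hypothesis nuE : forall A, measurable A ->
  nu A = \int[mu]_(x in D) (w x * \1_A (phi x))%:E.

Import HBNNSimple.

(** The hypothesis [nuE] is the case of indicators; linearity and monotone convergence do the rest.
    With [phi] the identity this integrates against a density, with general [phi] against a weighted
    push-forward. *)
Lemma ge0_integral_weighted (f : Y -> \bar R) :
  measurable_fun setT f -> (forall y, 0 <= f y) ->
  \int[nu]_y f y = \int[mu]_(x in D) ((w x)%:E * f (phi x)).
Proof.
move=> mf f0; pose f_ := nnsfun_approx measurableT mf.
have cf y : (f_ n y)%:E @[n --> \oo] --> f y by exact: cvg_nnsfun_approx.
have mwf n : measurable_fun D (fun x => (w x * f_ n (phi x))%:E).
  by apply/measurable_EFinP/measurable_funM => //; exact: measurableT_comp.
transitivity (limn (fun n => \int[nu]_y (f_ n y)%:E)).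
  rewrite -monotone_convergence//.
  - by apply: eq_integral => y _; apply/esym/cvg_lim.
  - by move=> n; exact/measurable_EFinP/measurable_funP.
  - by move=> n y _; rewrite lee_fin.
  - by move=> y _ m n mn; rewrite lee_fin; exact/lefP/nd_nnsfun_approx.
transitivity (limn (fun n => \int[mu]_(x in D) (w x * f_ n (phi x))%:E)); last first.
  rewrite -monotone_convergence//.
  - apply: eq_integral => x /[!inE] Dx; apply/cvg_lim => //.
    under eq_fun do rewrite EFinM.
    by apply: cvgeZl => //; exact: cf.
  - by move=> n x Dx; rewrite lee_fin mulr_ge0// w0.
  - move=> x Dx m n mn; rewrite lee_fin ler_wpM2l ?w0//.
    exact/lefP/nd_nnsfun_approx.
congr (limn _); apply/funext => n.
have mA r : measurable (f_ n @^-1` [set r]) by [].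
under eq_integral do rewrite fimfunE -fsumEFin//.
rewrite ge0_integral_fsum//; last 2 first.
- by move=> y; exact/measurable_EFinP/measurable_funM.
- by move=> y x _; rewrite nnfun_muleindic_ge0.
transitivity (\int[mu]_(x in D)
    (\sum_(r \in range (f_ n)) (w x * (r * \1_(f_ n @^-1` [set r]) (phi x)))%:E)).
  rewrite ge0_integral_fsum//; last 2 first.
  - move=> r; apply/measurable_EFinP/measurable_funM => //.
    by apply: measurable_funM => //; apply: measurableT_comp.
  - move=> r x Dx; rewrite EFinM mule_ge0 ?lee_fin ?w0//.
    by have := nnfun_muleindic_ge0 (f_ n) r (phi x); rewrite lee_fin.
  apply: eq_fsbigr => r _.
  (* A negative [r] is not a value of [f_ n], so its level set is empty; pulling [r] out of the
     integral below requires [0 <= r]. *)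
  have [r0|r0] := ltP r 0%R.
    rewrite preimage_nnfun0// indic0 !integral0_eq// => x _;
    by rewrite !mulr0.
  rewrite integralZl_indic_nnsfun// integral_indic// setIT nuE//.
  rewrite -ge0_integralZl//.
  - by apply: eq_integral => x _; rewrite -EFinM mulrCA.
  - apply/measurable_EFinP/measurable_funM => //.
    by apply: measurableT_comp.
  - by move=> x Dx; rewrite lee_fin mulr_ge0 ?w0.
apply: eq_integral => x /[!inE] Dx; rewrite fimfunE.
rewrite EFinM -fsumEFin// ge0_mule_fsumr; last first.
  by move=> r; exact: nnfun_muleindic_ge0.
by apply: eq_fsbigr => r _; rewrite -EFinM.
Qed.

End weighted_integral.

Section integral_mrestr.
Local Open Scope ereal_scope.
Context d (T : measurableType d) (R : realType).
Variables (mu : {measure set T -> \bar R}) (D : set T) (mD : measurable D).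

Lemma ge0_integral_mrestr (f : T -> \bar R) :
  measurable_fun setT f -> (forall x, 0 <= f x) ->
  \int[mrestr mu mD]_x f x = \int[mu]_(x in D) f x.
Proof.
move=> mf f0.
rewrite (@ge0_integral_weighted _ _ _ _ _ mu _ D (cst 1%R) id)//.
  by apply: eq_integral => x _; rewrite mul1e.
move=> A mA; transitivity (mu (A `&` D)) => //; rewrite -integral_indic//.
by apply: eq_integral => x _; rewrite mul1r.
Qed.

Lemma integral_mrestr (f : T -> \bar R) : measurable_fun setT f ->
  \int[mrestr mu mD]_x f x = \int[mu]_(x in D) f x.
Proof.
move=> mf; rewrite [LHS]integralE [RHS]integralE !ge0_integral_mrestr//.
- exact: measurable_funeneg.
- exact: measurable_funepos.
Qed.

End integral_mrestr.

Section weighted_measure.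
Local Open Scope ereal_scope.
Context d1 d2 (X : measurableType d1) (Y : measurableType d2) (R : realType).
Variables (mu : {measure set X -> \bar R}).
Variables (D : set X) (w : X -> R) (phi : X -> Y).
Hypotheses (mD : measurable D) (mw : measurable_fun D w).
Hypotheses (w0 : forall x, D x -> (0 <= w x)%R) (mphi : measurable_fun D phi).

(* The hypotheses are arguments so that the measure structure can be inferred. *)
Definition weighted_measure of measurable D & measurable_fun D w &
    (forall x, D x -> (0 <= w x)%R) & measurable_fun D phi :=
  fun A : set Y => \int[mu]_(x in D) (w x * \1_A (phi x))%:E.

Let nu := weighted_measure mD mw w0 mphi.

Let nu0 : nu set0 = 0.
Proof.
by rewrite /nu /weighted_measure integral0_eq// => x _; rewrite indic0 mulr0.
Qed.

Let nu_ge0 A : 0 <= nu A.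
Proof. by apply: integral_ge0 => x Dx; rewrite lee_fin mulr_ge0 ?w0. Qed.

Let nu_sigma_additive : semi_sigma_additive nu.
Proof.
move=> F mF tF mUF.
rewrite [X in _ --> X](_ : _ = \sum_(n <oo) nu (F n)).
  by apply: is_cvg_ereal_nneg_natsum_cond => n _ _; exact: nu_ge0.
rewrite /nu /weighted_measure -integral_nneseries//.
- apply: eq_integral => x /[!inE] Dx.
  rewrite EFinM.
  (* Countable additivity of the Dirac measure at [phi x] sums the indicators of the disjoint sets
     [F n]. *)
  transitivity ((w x)%:E * \sum_(n <oo) (\1_(F n) (phi x))%:E).
    congr (_ * _).
    apply/esym/(cvg_lim (@ereal_hausdorff R)).
    exact: (@measure_semi_sigma_additive _ _ _
      (@dirac _ _ (phi x) R) F mF tF mUF).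
  by rewrite -nneseriesZl.
- move=> n; apply/measurable_EFinP/measurable_funM => //.
  by apply: measurableT_comp.
- by move=> n x Dx; rewrite lee_fin mulr_ge0 ?w0.
Qed.

HB.instance Definition _ := isMeasure.Build _ _ _
  (weighted_measure mD mw w0 mphi) nu0 nu_ge0 nu_sigma_additive.

End weighted_measure.

(** * Substitution in one-dimensional Lebesgue integrals *)

Section lebesgue_substitution.
Local Open Scope ereal_scope.
Context d (X : measurableType d) (R : realType).
Variables (mu : {measure set X -> \bar R}).
Variables (D : set X) (w : X -> R) (phi : X -> measurableTypeR R).
Hypotheses (mD : measurable D) (mw : measurable_fun D w).
Hypotheses (w0 : forall x, D x -> (0 <= w x)%R) (mphi : measurable_fun D phi).
Hypothesis itvE : forall a b : R, (a < b)%R ->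
  \int[mu]_(x in D `&` phi @^-1` `]a, b]) (w x)%:E = (b - a)%:E.

(** A measure that gives every []a, b]] its length is Lebesgue measure. A substitution rule thus
    reduces to the computation [itvE] on intervals. *)
Lemma ge0_lebesgue_substitution (f : R -> \bar R) :
  measurable_fun setT f -> (forall y, 0 <= f y) ->
  \int[lebesgue_measure]_y f y = \int[mu]_(x in D) ((w x)%:E * f (phi x)).
Proof.
move=> mf f0; apply: ge0_integral_weighted => //.
pose nu := weighted_measure mu mD mw w0 mphi.
apply: (@lebesgue_measure_unique R nu) => _ [[a b] _ <-]/=.
rewrite /nu /weighted_measure.
transitivity (\int[mu]_(x in D `&` phi @^-1` `]a, b]) (w x)%:E); last first.
  rewrite integral_mkcondr; apply: eq_integral => x /[!inE] Dx.
  rewrite patchE indicE (_ : (x \in _) = (phi x \in `]a, b]%classic)).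
    by case: ifPn; rewrite ?mulr1 ?mulr0.
  by apply/idP/idP; rewrite !inE.
rewrite lebesgue_measure_itv/= lte_fin.
case: ltP => [ab|ba]; first by rewrite itvE.
by rewrite set_itv_ge ?bnd_simp -?leNgt// preimage_set0 setI0 integral_set0.
Qed.

End lebesgue_substitution.

Section real_measurable.
Context (R : realType).

(** Inversion is continuous away from 0, and the remaining singleton is measurable. *)
Lemma measurable_inv : measurable_fun setT (@GRing.inv R).
Proof.
rewrite (_ : setT = [set 0] `|` ~` [set 0 : R]); last by rewrite setUv.
apply/measurable_funU => //; first exact: measurableC.
split; first exact: measurable_fun_set1.
apply: open_continuous_measurable_fun.
  apply/closed_openC/accessible_closed_set1/hausdorff_accessible/Rhausdorff.
by move=> x; rewrite inE/= => /eqP x0; exact: inv_continuous.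
Qed.

Lemma measurable_cos : measurable_fun setT (@cos R).
Proof. by apply: continuous_measurable_fun; exact: continuous_cos. Qed.

Lemma measurable_sin : measurable_fun setT (@sin R).
Proof. by apply: continuous_measurable_fun; exact: continuous_sin. Qed.

Lemma measurable_tan : measurable_fun setT (@tan R).
Proof.
apply: measurable_funM; first exact: measurable_sin.
by apply: measurableT_comp; [exact: measurable_inv|exact: measurable_cos].
Qed.

Lemma measurable_sqrt : measurable_fun setT (@Num.sqrt R).
Proof. by apply: continuous_measurable_fun; exact: sqrt_continuous. Qed.

End real_measurable.

(** Differentiability at the endpoints as well provides the one-sided limits of [F] that the
    fundamental theorem of calculus asks for. *)
Lemma integral_derive (R : realType) (F f : R -> R) (a b : R) : a < b ->
  {in `[a, b], forall t : R, {for t, continuous f}} ->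
  {in `[a, b], forall t : R, is_derive t 1 F (f t)} ->
  (\int[lebesgue_measure]_(t in `[a, b]) (f t)%:E = (F b - F a)%:E)%E.
Proof.
move=> ab cf dF; rewrite EFinB.
have cF t : t \in `[a, b] -> {for t, continuous F}.
  move=> /dF Ft; apply: differentiable_continuous.
  exact/derivable1_diffP/(@ex_derive _ _ _ _ _ _ _ Ft).
have [aI bI] : a \in `[a, b] /\ b \in `[a, b].
  by rewrite !in_itv/= !lexx !ltW.
have sub t : t \in `]a, b[ -> t \in `[a, b].
  by rewrite !in_itv/= => /andP[? ?]; rewrite !ltW.
apply: continuous_FTC2 => //.
- apply: continuous_in_subspaceT => t /[!inE]; exact: cf.
- split.
  + by move=> t /sub/dF Ft; exact: (@ex_derive _ _ _ _ _ _ _ Ft).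
  + exact/cvg_at_right_filter/cF.
  + exact/cvg_at_left_filter/cF.
- by move=> t /sub/dF Ft; rewrite derive1E; exact: (@derive_val _ _ _ _ _ _ _ Ft).
Qed.

Section one_variable_substitutions.
Context (R : realType).
Local Notation mR := (measurableTypeR R).
Local Notation mu := (@lebesgue_measure R).
Local Notation Ipi2 := (`](- (pi / 2)), (pi / 2)[%classic : set R).
Implicit Types (f : R -> \bar R) (c d x : R).

Lemma ge0_integral_affine c d f : (c != 0)%R ->
  measurable_fun setT f -> (forall y, 0 <= f y)%E ->
  (\int[mu]_y f y = \int[mu]_y (`|c|%R%:E * f (c * y + d)%R))%E.
Proof.
move=> c0 mf f0.
rewrite (@ge0_lebesgue_substitution _ _ _ mu setT (cst `|c|%R) (fun y => c * y + d)%R)//.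
- by apply: measurable_funD => //; exact: measurable_funM.
- move=> a b ab; rewrite setTI (eq_integral (cst `|c|%R%:E))//.
  have [c_gt0|c_lt0|/eqP] := ltgtP 0%R c; last by rewrite eq_sym (negPf c0).
  + rewrite (_ : _ @^-1` _ = `](a - d) / c, (b - d) / c]%classic); last first.
      apply/seteqP; split => y /=; rewrite !in_itv/= ltr_pdivrMr// ler_pdivlMr//;
        by move=> /andP[? ?]; apply/andP; split; lra.
    rewrite integral_cst//= lebesgue_measure_itv/= lte_fin ltr_pM2r ?invr_gt0//.
    rewrite ltrD2r ab gtr0_norm// -EFinD -EFinM; congr (_%:E); field.
    by rewrite gt_eqF.
  (* A negative slope reverses the order, so the closed end moves to the left. *)
  + rewrite (_ : _ @^-1` _ = `[(b - d) / c, (a - d) / c[%classic); last first.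
      apply/seteqP; split => y /=; rewrite !in_itv/= ltr_ndivlMr// ler_ndivrMr//;
        by move=> /andP[? ?]; apply/andP; split; lra.
    rewrite integral_cst//= lebesgue_measure_itv/= lte_fin ltr_nM2r ?invr_lt0//.
    rewrite ltrD2r ab ltr0_norm// -EFinD -EFinM; congr (_%:E); field.
    by rewrite lt_eqF.
Qed.

(** The increasing map [t |-> x * tan t] pulls []a, b]] back to []atan (a / x), atan (b / x)]], over
    which its derivative integrates to [b - a]. *)
Lemma ge0_integral_tan x f : (0 < x)%R ->
  measurable_fun setT f -> (forall y, 0 <= f y)%E ->
  (\int[mu]_y f y =
  \int[mu]_(t in Ipi2)
    ((x * (1 + tan t ^+ 2))%R%:E * f (x * tan t)%R))%E.
Proof.
move=> x0 mf f0.
have x_gt0 := x0.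
rewrite (@ge0_lebesgue_substitution _ _ _ mu `](- (pi / 2)), (pi / 2)[
    (fun t => x * (1 + tan t ^+ 2)) (fun t => x * tan t))//.
- apply: measurable_funM => //; apply: measurable_funD => //.
  by apply: measurable_funX; apply: measurable_funTS; exact: measurable_tan.
- by move=> t _; rewrite mulr_ge0 ?ltW// ltr_pwDl// sqr_ge0.
- by apply: measurable_funM => //; apply: measurable_funTS; exact: measurable_tan.
move=> a b ab.
have atI c : (atan c \in `](- (pi / 2)), (pi / 2)[)%R.
  by rewrite in_itv/= atan_gtNpi2 atan_ltpi2.
have cos_neq0 t : (t \in `](- (pi / 2)), (pi / 2)[ -> cos t != 0)%R.
  by rewrite in_itv/= => /cos_gt0_pihalf/gt_eqF ->.
rewrite (_ : _ `&` _ = `]atan (a / x), atan (b / x)]%classic); last first.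
  apply/seteqP; split => t /=.
    rewrite in_itv/= => -[tI]; rewrite in_itv/= => /andP[ta tb].
    rewrite in_itv/= -(tanK tI); apply/andP; split.
      by apply: lt_atan; rewrite ltr_pdivrMr// mulrC.
    by apply: le_atan; rewrite ler_pdivlMr// mulrC.
  rewrite in_itv/= => /andP[ta tb].
  have tI : (t \in `](- (pi / 2)), (pi / 2)[)%R.
    by rewrite in_itv/= (lt_trans _ ta) ?atan_gtNpi2//= (le_lt_trans tb)// atan_ltpi2.
  split=> //; rewrite in_itv/=; apply/andP; split.
    by move: ta; rewrite -ltr_tan ?atI// atanK ltr_pdivrMr// mulrC.
  move: tb; rewrite leNgt -ltr_tan ?atI// atanK -leNgt ler_pdivlMr// mulrC//.
have ab' : (atan (a / x) < atan (b / x))%R by apply: lt_atan; rewrite ltr_pM2r ?invr_gt0.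
have sub t : (t \in `[atan (a / x), atan (b / x)] -> t \in `](- (pi / 2)), (pi / 2)[)%R.
  rewrite !in_itv/= => /andP[t1 t2].
  by rewrite (lt_le_trans _ t1) ?atan_gtNpi2//= (le_lt_trans t2)// atan_ltpi2.
rewrite integral_itv_obnd_cbnd; last first.
  apply/measurable_EFinP/measurable_funTS; apply: measurable_funM => //; apply: measurable_funD => //.
  by apply: measurable_funX; exact: measurable_tan.
pose F t := x * tan t; pose G t := x * (1 + tan t ^+ 2).
transitivity ((F (atan (b / x)) - F (atan (a / x)))%:E); last first.
  rewrite /F !atanK -mulrBr -mulrBl mulrCA divff ?mulr1// gt_eqF//.
apply: (@integral_derive _ F G) => //.
- move=> t /sub/cos_neq0 ct; rewrite /G.
  have ctt : tan s @[s --> t] --> tan t by exact: continuous_tan.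
  apply: cvgM; first exact: cvg_cst.
  by apply: cvgD; [exact: cvg_cst|exact: (cvgM ctt ctt)].
- move=> t /sub/cos_neq0 ct; have dt := is_derive_tan ct.
  rewrite /G -cos2_tan2// /F.
  rewrite -[X in is_derive _ _ X _]/(x \*: (@tan R)).
  exact: is_deriveZ.
Qed.

End one_variable_substitutions.

(** * Polar coordinates *)

Section polar.
Context (R : realType).
Local Notation mR := (measurableTypeR R).
Local Notation mu := (@lebesgue_measure R).
Local Notation Ipi2 := (`](- (pi / 2)), (pi / 2)[%classic : set R).
Implicit Types g : mR * mR -> \bar R.

Let mgc g d (T : measurableType d) (a b : T -> mR) : measurable_fun setT g ->
  measurable_fun setT a -> measurable_fun setT b ->
  measurable_fun setT (fun t => g (a t, b t)).
Proof.
by move=> mg ma mb; apply: measurableT_comp => //; exact: measurable_fun_pair.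
Qed.

Let max_ge0 (r : R) : 0 <= Num.max r 0.
Proof. by rewrite le_max lexx orbT. Qed.

(** The inner integral over [r > 0] with weight [r] in polar coordinates. The weight is extended by
    zero, so that Tonelli's theorem applies on the whole plane. *)
Definition radial_integral g (t : R) : \bar R :=
  (\int[mu]_r ((Num.max r 0)%:E * g (r * cos t, r * sin t)%R))%E.

Lemma measurable_radial_integral g : measurable_fun setT g ->
  (forall p, (0 <= g p)%E) -> measurable_fun setT (radial_integral g).
Proof.
move=> mg g0; have mKi : measurable_fun setT (fun p : mR * mR =>
    (Num.max p.2 0)%:E * g (p.2 * cos p.1, p.2 * sin p.1)%R)%E.
  apply: emeasurable_funM.
    by apply/measurable_EFinP/measurable_maxr => //; exact: measurable_snd.
  by apply: mgc => //; apply: measurable_funM => //; apply: measurableT_comp => //;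
    [exact: measurable_cos|exact: measurable_sin].
apply: (measurable_fun_fubini_tonelli_F (m2 := mu) _ mKi).
by move=> p; rewrite mule_ge0// lee_fin.
Qed.

Lemma radial_integral_ge0 g t : (forall p, (0 <= g p)%E) ->
  (0 <= radial_integral g t)%E.
Proof. by move=> g0; apply: integral_ge0 => r _; rewrite mule_ge0// lee_fin. Qed.

(* Substitute [y = x tan t] at fixed [x], then [x = r cos t] at fixed [t]. *)
Lemma integral_right_half_plane g : measurable_fun setT g ->
  (forall p, (0 <= g p)%E) ->
  (\int[mu]_x \int[mu]_y ((\1_[set r : R | 0 < r] x)%:E * g (x, y)) =
   \int[mu]_t ((\1_Ipi2 t)%:E * radial_integral g t))%E.
Proof.
move=> mg g0.
pose w (x t : R) := Num.max x 0 * (1 + tan t ^+ 2) * \1_Ipi2 t.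
have w0 x t : 0 <= w x t.
  by rewrite /w !mulr_ge0 ?max_ge0// addr_ge0// sqr_ge0.
transitivity (\int[mu]_x \int[mu]_t ((w x t)%:E * g (x, x * tan t)%R))%E.
  apply: eq_integral => x _; have [x0|x0] := ltP 0 x.
    rewrite indicE mem_set//; under eq_integral do rewrite mul1e.
    rewrite (ge0_integral_tan (f := fun y => g (x, y)) x0)//; last first.
      exact: (@mgc _ _ _ (cst x) id mg (measurable_cst x)).
    rewrite integral_mkcond; apply: eq_integral => t _.
    rewrite patchE /w indicE; case: ifPn => _; last by rewrite mulr0 mul0e.
    by rewrite mulr1 max_l// ltW.
  rewrite !integral0_eq// => y _; first by rewrite /w max_r// !mul0r mul0e.
  by rewrite indicE memNset ?mul0e//= ltNge x0.
rewrite (@fubini_tonelli _ _ _ _ _ mu mu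
  (fun p => (w p.1 p.2)%:E * g (p.1, p.1 * tan p.2)%R)%E)/=; last 2 first.
- apply: emeasurable_funM.
    apply/measurable_EFinP; rewrite /w; apply: measurable_funM.
      apply: measurable_funM; first by apply: measurable_maxr => //; exact: measurable_fst.
      apply: measurable_funD => //; apply: measurable_funX.
      by apply: measurableT_comp => //; exact: measurable_tan.
    by apply: measurableT_comp => //; exact: measurable_indic.
  apply: mgc => //; apply: measurable_funM => //.
  by apply: measurableT_comp => //; exact: measurable_tan.
- by move=> p; rewrite mule_ge0// lee_fin.
apply: eq_integral => t _; rewrite indicE.
case: (boolP (t \in Ipi2)) => tI; last first.
  rewrite mul0e integral0_eq// => x _.
  by rewrite /w indicE (negPf tI) mulr0 mul0e.
rewrite mul1e.
have ct : 0 < cos t by move: tI; rewrite inE/= in_itv/= => /cos_gt0_pihalf.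
rewrite (@ge0_integral_affine _ (cos t) 0) ?gt_eqF//; last 2 first.
- apply: emeasurable_funM.
    apply/measurable_EFinP; rewrite /w; apply: measurable_funM => //.
    by apply: measurable_funM => //; exact: measurable_maxr.
  by apply: mgc => //; exact: measurable_funM.
- by move=> x; rewrite mule_ge0// lee_fin.
apply: eq_integral => r _; rewrite addr0 gtr0_norm// muleA -EFinM.
have ct0 : cos t != 0 by rewrite gt_eqF.
(* The two Jacobians multiply to [cos t * (r * cos t) * (1 + tan t ^+ 2) = r]. *)
congr (_%:E * g (_, _))%E.
- rewrite /w indicE tI mulr1 -cos2_tan2//.
  rewrite (_ : Num.max _ 0 = cos t * Num.max r 0); last by rewrite maxr_pMr ?ltW// mulr0.
  by field.
- by rewrite mulrC.
- by rewrite /tan; field.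
Qed.

(** The axis [x = 0] is null, and the reflection through the origin maps the left half plane to the
    right one while adding [pi] to the angle. *)
Lemma integral_half_planes g : measurable_fun setT g ->
  (forall p, (0 <= g p)%E) ->
  (\int[mu]_x \int[mu]_y g (x, y) =
   \int[mu]_t ((\1_Ipi2 t)%:E * radial_integral g t) +
   \int[mu]_t ((\1_Ipi2 t)%:E * radial_integral g (t + pi)))%E.
Proof.
move=> mg g0.
have mi (h : mR -> mR) : measurable_fun setT h ->
    measurable_fun setT (fun p : mR * mR => ((\1_[set r : R | 0 < r] (h p.1))%:E * g p)%E).
  move=> mh; apply: emeasurable_funM => //; apply/measurable_EFinP.
  apply: measurableT_comp; last by apply: measurableT_comp.
  apply: measurable_indic; rewrite (_ : [set _ | _] = `]0, +oo[%classic)//.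
  by apply/seteqP; split => x /=; rewrite in_itv/= andbT.
have mio (h : mR -> mR) : measurable_fun setT h ->
    measurable_fun setT (fun x : mR =>
      (\int[mu]_y ((\1_[set r : R | 0 < r] (h x))%:E * g (x, y)))%E).
  move=> mh; apply: (measurable_fun_fubini_tonelli_F (m2 := mu) _ (mi _ mh)).
  by move=> p; rewrite mule_ge0// lee_fin.
have i0 (h : mR -> mR) x y : (0 <= (\1_[set r : R | 0 < r] (h x))%:E * g (x, y))%E.
  by rewrite mule_ge0// lee_fin.
have posE x : \1_[set r : R | 0 < r] x = (0 < x)%R%:R :> R.
  by rewrite indicE (_ : (x \in _) = (0 < x)%R)//; apply/idP/idP; rewrite inE.
pose right := (\int[mu]_x \int[mu]_y
  ((\1_[set r : R | (0 < r)%R] x)%:E * g (x, y)))%E.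
pose left := (\int[mu]_x \int[mu]_y
  ((\1_[set r : R | (0 < r)%R] (- x)%R)%:E * g (x, y)))%E.
have gE : (\int[mu]_x \int[mu]_y g (x, y) = right + left)%E.
  rewrite /right /left -ge0_integralD//; last 4 first.
  - by move=> x _; apply: integral_ge0 => y _; exact: (i0 id).
  - exact: (mio id).
  - by move=> x _; apply: integral_ge0 => y _; exact: (i0 -%R).
  - by apply: (mio -%R).
  apply: ge0_ae_eq_integral => //.
  - exact: (measurable_fun_fubini_tonelli_F (m2 := mu) _ mg).
  - by apply: emeasurable_funD; [exact: (mio id)|exact: (mio -%R)].
  - by move=> x _; exact: integral_ge0.
  - move=> x _; apply: adde_ge0; apply: integral_ge0 => y _.
      exact: (i0 id).
    exact: (i0 -%R).
  exists [set 0]; split; [exact: measurable_set1|exact: lebesgue_measure_set1|].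
  move=> x /= /not_implyP[_ +]; apply: contra_notP => /eqP x0.
  rewrite !posE oppr_gt0; have [x_gt0|x_lt0|/eqP] := ltgtP 0 x; rewrite /= ?mulr1n ?mulr0n; last first.
  - by rewrite eq_sym (negPf x0).
  - rewrite [X in (X + _)%E]integral0_eq; last by move=> y _; exact: mul0e.
    by rewrite add0e; apply: eq_integral => y _; rewrite mul1e.
  - rewrite [X in (_ + X)%E]integral0_eq; last by move=> y _; exact: mul0e.
    by rewrite adde0; apply: eq_integral => y _; rewrite mul1e.
rewrite gE; congr (_ + _)%E; first exact: integral_right_half_plane.
pose gN p := g (- p.1, - p.2).
have mgN : measurable_fun setT gN.
  by apply: mgc => //; apply: measurableT_comp.
transitivity (\int[mu]_t ((\1_Ipi2 t)%:E * radial_integral gN t))%E; last first.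
  apply: eq_integral => t _; congr (_ * _)%E; apply: eq_integral => r _.
  by rewrite /gN/= cosDpi sinDpi !mulrN.
have gN0 p : (0 <= gN p)%E by exact: g0.
rewrite -(integral_right_half_plane mgN gN0).
have N1 : -1 != 0 :> R by rewrite oppr_eq0 oner_eq0.
rewrite [LHS](@ge0_integral_affine _ (-1) 0 (fun x => (\int[mu]_y
  ((\1_[set r : R | (0 < r)%R] (- x)%R)%:E * g (x, y)))%E) N1); last 2 first.
- exact: (mio -%R).
- by move=> x; apply: integral_ge0 => y _; exact: (i0 -%R).
apply: eq_integral => x _.
rewrite normrN normr1 mul1e addr0 mulN1r opprK.
rewrite [LHS](@ge0_integral_affine _ (-1) 0
  (fun y => (\1_[set r : R | (0 < r)%R] x)%:E * g (- x, y)%R)%E N1); last 2 first.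
- apply: emeasurable_funM => //.
  exact: (@mgc _ _ _ (cst (- x)) id mg (measurable_cst (- x))).
- by move=> y; rewrite mule_ge0// lee_fin.
by apply: eq_integral => y _; rewrite normrN normr1 mul1e addr0 mulN1r.
Qed.

End polar.

(** * The circle as the interval []-pi, pi]] *)

Section circle.
Context (R : realType).
Local Notation mR := (measurableTypeR R).
Local Notation mu := (@lebesgue_measure R).
Local Notation Ipi := (`]-pi, pi]%classic : set R).

(** A finite measure on the whole line, so that [L2fun] and Tonelli's theorem apply to the circle as
    they stand. *)
Definition circle_measure : set mR -> \bar R :=
  mrestr mu (measurable_itv `]-pi, pi]).

HB.instance Definition _ := Measure.on circle_measure.

Lemma circle_measure_fin : fin_num_fun circle_measure.
Proof.
move=> A mA; rewrite ge0_fin_numE ?measure_ge0//.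
apply: (@le_lt_trans _ _ (mu `]-pi, pi]%classic)).
  by apply: le_measure; rewrite ?inE//; exact: measurableI.
by rewrite lebesgue_measure_itv/=; case: ifP => //= _; rewrite -EFinB ltry.
Qed.

HB.instance Definition _ :=
  Measure_isFinite.Build _ _ _ circle_measure circle_measure_fin.

Lemma integral_circle (f : mR -> \bar R) : measurable_fun setT f ->
  (\int[circle_measure]_t f t = \int[mu]_(t in Ipi) f t)%E.
Proof. exact: integral_mrestr. Qed.

(** The left half plane carries the angles of []pi / 2, pi + pi / 2[]. Those beyond [pi] return to
    []-pi, - (pi / 2)[] by periodicity of [K]. *)
Lemma ge0_integral_polar (g : mR * mR -> \bar R) : measurable_fun setT g ->
  (forall p, (0 <= g p)%E) ->
  (\int[mu]_x \int[mu]_y g (x, y) =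
   \int[circle_measure]_t radial_integral g t)%E.
Proof.
move=> mg g0; rewrite integral_half_planes//.
set K := radial_integral g.
have mK : measurable_fun setT K by exact: measurable_radial_integral.
have K0 t : (0 <= K t)%E by exact: radial_integral_ge0.
have Kper t : K (t + 2 * pi) = K t.
  by apply: eq_integral => r _; rewrite mulr_natl cosD2pi sinD2pi.
have mKD (D : set mR) : measurable D -> measurable_fun setT (fun t => ((\1_D t)%:E * K t)%E).
  by move=> mD; apply: emeasurable_funM => //; exact/measurable_EFinP/measurable_indic.
have KD0 (D : set mR) t : (0 <= (\1_D t)%:E * K t)%E by rewrite mule_ge0// lee_fin.
have KDE (D : set mR) : (\int[mu]_t ((\1_D t)%:E * K t) = \int[mu]_(t in D) K t)%E.
  rewrite [RHS]integral_mkcond; apply: eq_integral => t _.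
  by rewrite patchE indicE; case: ifP => _; rewrite ?mul1e ?mul0e.
have shift c (D D' : set mR) : measurable D -> (forall t, D (t + c) <-> D' t) ->
    (\int[mu]_(t in D) K t = \int[mu]_(t in D') K (t + c)%R)%E.
  move=> mD DD'; rewrite -KDE.
  rewrite (@ge0_integral_affine _ 1 c _ (oner_neq0 _) (mKD _ mD) (KD0 D)).
  rewrite [RHS]integral_mkcond; apply: eq_integral => t _.
  rewrite patchE indicE normr1 mul1e mul1r (_ : (t + c \in D) = (t \in D')).
    by case: ifP => _; rewrite ?mul1e ?mul0e.
  by apply/idP/idP; rewrite !inE => /DD'.
have pi_gt0 := pi_gt0 R.
pose I1 : set mR := `](-pi), (- (pi / 2))[%classic.
pose I2 : set mR := `](- (pi / 2)), (pi / 2)[%classic.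
pose I3 : set mR := `](pi / 2), pi]%classic.
pose I3' : set mR := `]pi, (pi + pi / 2)[%classic.
have -> : (\int[mu]_t ((\1_I2 t)%:E * K (t + pi)%R) =
    \int[mu]_(t in I1) K t + \int[mu]_(t in I3) K t)%E.
  transitivity (\int[mu]_(t in I3 `|` I3') K t)%E.
    rewrite (@shift pi _ I2)//.
    - rewrite [RHS]integral_mkcond; apply: eq_integral => t _.
      by rewrite patchE indicE; case: ifP => _; rewrite ?mul1e ?mul0e.
    - by apply: measurableU; exact: measurable_itv.
    - move=> t; rewrite /I3 /I3' /I2 /= !in_itv/=; split=> [[]/andP[? ?]|/andP[? ?]].
      + by apply/andP; split; lra.
      + by apply/andP; split; lra.
      + by have [?|?] := leP t 0; [left|right]; apply/andP; split; lra.
  rewrite ge0_integral_setU//; [|exact: measurable_itv..|exact: measurable_funTS|]; last first.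
    apply/disj_setPS => t []; rewrite /I3 /I3'/= !in_itv/= => /andP[? ?] /andP[? ?]; lra.
  rewrite addeC; congr (_ + _)%E.
  rewrite (@shift (2 * pi) I3' I1); [|exact: measurable_itv|].
    by apply: eq_integral => t _; rewrite Kper.
  move=> t; rewrite /I3' /I1/= !in_itv/=.
  by split=> /andP[? ?]; apply/andP; split; lra.
have mKI (D : set mR) : measurable_fun D K by exact: measurable_funTS.
(* [J1] and [J2] add one endpoint each to [I1] and [I2], so as to tile []-pi, pi]] together with
   [I3]; single points do not change the integrals. *)
pose J1 : set mR := `](-pi), (- (pi / 2))]%classic.
pose J2 : set mR := `](- (pi / 2)), (pi / 2)]%classic.
have mJ1 : measurable J1 by exact: measurable_itv.
have mJ2 : measurable J2 by exact: measurable_itv.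
have mI3 : measurable I3 by exact: measurable_itv.
rewrite integral_circle//.
have -> : (`]-pi, pi]%classic : set mR) = (J1 `|` J2) `|` I3.
  rewrite /J1 /J2 /I3 -itv_bndbnd_setU ?bnd_simp; [|lra..].
  by rewrite -itv_bndbnd_setU ?bnd_simp//; lra.
rewrite ge0_integral_setU//; [|exact: measurableU|]; last first.
  apply/disj_setPS => t []; rewrite /J1 /J2 /I3/= => -[]; rewrite !in_itv/= =>
    /andP[? ?] /andP[? ?]; lra.
rewrite ge0_integral_setU//; last first.
  apply/disj_setPS => t []; rewrite /J1 /J2/= !in_itv/= => /andP[? ?] /andP[? ?]; lra.
rewrite KDE addeCA addeA.
by congr (_ + _ + _)%E; exact: integral_itv_bndo_bndc (mKI _).

Qed.

End circle.

(** * Cylindrical coordinates on the body *)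

Section body_polar.
Context (R : realType) (B : axisymmetric_domain R).
Local Notation mR := (measurableTypeR R).
Local Notation mu := (@lebesgue_measure R).
Local Notation nu := (@circle_measure R).
Local Notation M := (meridian_measure B).

Lemma ge0_integral_lebesgue2 (g : mR * mR -> \bar R) :
  measurable_fun setT g -> (forall p, (0 <= g p)%E) ->
  (\int[@lebesgue2 R]_p g p = \int[mu]_x \int[mu]_y g (x, y))%E.
Proof. exact: fubini_tonelli1. Qed.

(** Rotation by [t] carries [(r, 0, z)] to [cylindrical r t z], and rotation by [- t] carries it
    back. *)
Lemma body_cylindrical (r t z : R) :
  0 < r -> body B (cylindrical r t z) <-> half_section B (r, z).
Proof.
have rotE s (x : R * R * R) : body B x -> body B (rotate_z s x).
  exact: body_rotate.
move=> r0; split => [Bx|[_ Bx]].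
  split => //=; have := rotE (- t) _ Bx.
  rewrite /rotate_z/= cosN sinN !mulrN !opprK.
  rewrite (_ : _ + _ = r); last first.
    by rewrite -!mulrA -mulrDr -!expr2 cos2Dsin2 mulr1.
  by rewrite mulrAC [X in (_, X, _)]addrC subrr.
have := rotE t _ Bx.
by rewrite /rotate_z/= !mul0r subr0 addr0.
Qed.

Lemma measurable_cylindrical :
  measurable_fun setT (fun q : mR * mR * mR =>
    cylindrical q.1.1 q.2 q.1.2 : mR * mR * mR).
Proof.
have mr : measurable_fun setT (fun q : mR * mR * mR => q.1.1).
  exact: measurableT_comp measurable_fst measurable_fst.
have mz : measurable_fun setT (fun q : mR * mR * mR => q.1.2).
  exact: measurableT_comp measurable_snd measurable_fst.
apply: measurable_fun_pair => //.
apply: measurable_fun_pair => /=; apply: measurable_funM => //;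
  apply: measurableT_comp => //.
  exact: measurable_cos.
exact: measurable_sin.
Qed.

Lemma ge0_integral_meridian (h : mR * mR -> \bar R) :
  measurable_fun setT h -> (forall p, (0 <= h p)%E) ->
  (\int[M]_p h p =
   \int[@lebesgue2 R]_(p in half_section B) (p.1%:E * h p))%E.
Proof.
move=> mh h0.
apply: (@ge0_integral_weighted _ _ _ _ _ (@lebesgue2 R) _ (half_section B)
  (fst : mR * mR -> R) id) => //.
- exact: half_section_measurable.
- by apply: measurable_funTS; exact: measurable_fst.
- by move=> p [/ltW].
- move=> A mA.
  transitivity (\int[@lebesgue2 R]_(p in A `&` half_section B) p.1%:E)%E => //.
  rewrite integral_mkcondl; apply: eq_integral => p _.
  by rewrite patchE indicE; case: ifP; rewrite ?mulr1 ?mulr0.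
Qed.

(** With [f] extended by zero outside the body, polar coordinates are applied in each plane at
    height [z]. Tonelli's theorem then moves the angle to the innermost place. *)
Lemma ge0_integral_body (f : mR * mR * mR -> \bar R) :
  measurable_fun setT f -> (forall x, (0 <= f x)%E) ->
  (\int[body_measure B]_x f x =
   \int[M]_p \int[nu]_t f (cylindrical p.1 t p.2))%E.
Proof.
move=> mf f0.
pose G (x : mR * mR * mR) := ((\1_(B : set (mR * mR * mR)) x)%:E * f x)%E.
have mG : measurable_fun setT G.
  apply: emeasurable_funM => //; apply/measurable_EFinP.
  by apply: measurable_indic; exact: body_measurable.
have G0 x : (0 <= G x)%E by rewrite mule_ge0// lee_fin.
have mGc : measurable_fun setT (fun q : mR * mR * mR =>
    ((Num.max q.1.1 0)%:E * G (cylindrical q.1.1 q.2 q.1.2))%E).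
  apply: emeasurable_funM.
    apply/measurable_EFinP/measurable_maxr => //.
    exact: measurableT_comp measurable_fst measurable_fst.
  exact: measurableT_comp mG measurable_cylindrical.
have max_ge0 (r : R) : 0 <= Num.max r 0 by rewrite le_max lexx orbT.
have Gc0 q : (0 <= (Num.max q.1.1 0)%:E * G (cylindrical q.1.1 q.2 q.1.2))%E.
  by rewrite mule_ge0// lee_fin.
have mG2 : measurable_fun setT (fun p : mR * mR => \int[nu]_t
    ((Num.max p.1 0)%:E * G (cylindrical p.1 t p.2)))%E.
  exact: (measurable_fun_fubini_tonelli_F (m2 := nu) _ mGc Gc0).
have G20 (p : mR * mR) : (0 <= \int[nu]_t
    ((Num.max p.1 0)%:E * G (cylindrical p.1 t p.2)))%E.
  by apply: integral_ge0 => t _; exact: (Gc0 (p, t)).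
have mfc : measurable_fun setT (fun q : mR * mR * mR =>
    f (cylindrical q.1.1 q.2 q.1.2)).
  exact: measurableT_comp mf measurable_cylindrical.
have mf2 : measurable_fun setT (fun p : mR * mR => \int[nu]_t
    f (cylindrical p.1 t p.2))%E.
  by apply: (measurable_fun_fubini_tonelli_F (m2 := nu) _ mfc).
transitivity (\int[@lebesgue3 R]_x G x)%E.
  rewrite [LHS]ge0_integral_mrestr// [LHS]integral_mkcond.
  apply: eq_integral => x _; rewrite patchE /G indicE.
  by case: ifP => _; rewrite ?mul1e ?mul0e.
rewrite [LHS](fubini_tonelli2 (m1 := @lebesgue2 R) (m2 := mu) G)//.
transitivity (\int[mu]_z \int[mu]_r \int[nu]_t
    ((Num.max r 0)%:E * G (cylindrical r t z)))%E.
  apply: eq_integral => z _.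
  have mGz : measurable_fun setT (fun p : mR * mR => G (p, z)).
    by apply: measurableT_comp => //; exact: measurable_fun_pair.
  transitivity (\int[mu]_x \int[mu]_y G (x, y, z))%E.
    have Gz0 p : (0 <= G (p, z))%E by exact: G0.
    exact: (ge0_integral_lebesgue2 mGz Gz0).
  rewrite [LHS](ge0_integral_polar mGz)//.
  rewrite [RHS](fubini_tonelli (m1 := mu) (m2 := nu)
    (fun rt => (Num.max rt.1 0)%:E * G (cylindrical rt.1 rt.2 z))%E)//.
  - have mp : measurable_fun setT (fun rt : mR * mR => (rt.1, z, rt.2) : mR * mR * mR).
      by apply: measurable_fun_pair => //; exact: measurable_fun_pair.
    exact: measurableT_comp mGc mp.
  - by move=> rt; exact: (Gc0 (rt.1, z, rt.2)).
rewrite -(fubini_tonelli (m1 := mu) (m2 := mu) (fun p => \int[nu]_t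
    ((Num.max p.1 0)%:E * G (cylindrical p.1 t p.2)))%E)//.
rewrite -(ge0_integral_lebesgue2 mG2)//.
rewrite ge0_integral_meridian//; last by move=> p; exact: integral_ge0.
rewrite [RHS]integral_mkcond; apply: eq_integral => p _.
rewrite patchE; case: ifPn => [|pO].
  rewrite inE => -[p0 Bp]; rewrite -ge0_integralZl//; last 2 first.
  - have mp : measurable_fun setT (fun t : mR => (p, t) : mR * mR * mR).
      exact: measurable_fun_pair.
    exact: measurableT_comp mfc mp.
  - by rewrite lee_fin ltW.
  apply: eq_integral => t _; rewrite max_l ?ltW// /G indicE mem_set ?mul1e//.
  by apply/body_cylindrical.
(* Off the half section the integrand is zero for one of two reasons: the weight vanishes when
   [r <= 0], and for [r > 0] the whole circle misses the body. *)
rewrite integral0_eq// => t _.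
have [p0|p0] := ltP 0 p.1; last by exact: mul0e.
rewrite /G indicE memNset ?mul0e ?mule0// => /(body_cylindrical _ _ p0) Bp.
by move/negP: pO; apply; rewrite inE; case: p p0 Bp.
Qed.

End body_polar.

(** * Uniqueness for the trigonometric system *)

Section smoothstep.
Context (R : realType).
Implicit Types x : R.

(** The cubic [3 x^2 - 2 x^3] fixes 0, 1/2 and 1. On [[0, 1]] the first and last attract everything
    on their side of 1/2, so its iterates approximate a step function by polynomials. *)
Definition smoothstep x := x ^+ 2 * (3 - 2 * x).

Lemma smoothstep01 x : 0 <= x <= 1 -> 0 <= smoothstep x <= 1.
Proof.
move=> /andP[x0 x1]; rewrite /smoothstep; apply/andP; split.
  by rewrite mulr_ge0 ?sqr_ge0//; lra.
rewrite -subr_ge0 (_ : _ - _ = (1 - x) ^+ 2 * (1 + 2 * x)); last by ring.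
by rewrite mulr_ge0 ?sqr_ge0//; lra.
Qed.

Lemma iter_smoothstep01 n x : 0 <= x <= 1 -> 0 <= iter n smoothstep x <= 1.
Proof. by move=> x01; elim: n => //= n; exact: smoothstep01. Qed.

Lemma cvg_iter_smoothstep0 x : 0 <= x < 2^-1 ->
  iter n smoothstep x @[n --> \oo] --> (0 : R).
Proof.
(* One iteration multiplies [y] by [y * (3 - 2 * y)]. For [0 <= y <= x < 1/2] this factor is at most
   its value [q] at [x], and [q < 1], whence geometric decay. *)
move=> /andP[x0 x1]; pose q := x * (3 - 2 * x).
have q0 : 0 <= q by rewrite /q; nra.
have q1 : q < 1 by rewrite /q; nra.
have itP n : 0 <= iter n smoothstep x <= x * q ^+ n.
  elim: n => [|n /andP[]]; first by rewrite expr0 mulr1 x0 lexx.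
  rewrite iterS exprSr mulrA; move: (iter n _ _) => y y0 yx.
  have qn1 : q ^+ n <= 1 by rewrite exprn_ile1// ltW.
  have yx' : y <= x by apply: le_trans yx _; rewrite ler_piMr.
  have -> : smoothstep y = y * (y * (3 - 2 * y)) by rewrite /smoothstep; ring.
  have yq : y * (3 - 2 * y) <= q by rewrite /q; nra.
  have y0' : 0 <= y * (3 - 2 * y) by nra.
  by rewrite mulr_ge0//= ler_pM.
apply: (@squeeze_cvgr _ _ _ _ (cst 0) (fun n => x * q ^+ n)).
- by apply: nearW => n; exact: itP.
- exact: cvg_cst.
- by apply: cvg_geometric; rewrite ger0_norm.
Qed.

(** The symmetry [smoothstep (1 - x) = 1 - smoothstep x] exchanges the two halves of [[0, 1]]. The
    sign function records the three limits 0, 1/2 and 1 in one formula. *)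
Lemma cvg_iter_smoothstep x : 0 <= x <= 1 ->
  iter n smoothstep x @[n --> \oo] --> (1 + Num.sg (x - 2^-1)) / 2.
Proof.
move=> /andP[x0 x1].
have [xlt|xgt|->] := ltgtP x 2^-1.
- rewrite ltr0_sg ?subr_lt0// subrr mul0r; apply: cvg_iter_smoothstep0.
  by rewrite x0.
- rewrite gtr0_sg ?subr_gt0// divff//.
  have E n : iter n smoothstep x = 1 - iter n smoothstep (1 - x).
    elim: n => [|n IH]; first by rewrite /=; ring.
    by rewrite !iterS IH /smoothstep; ring.
  rewrite (_ : (fun _ => _) = fun n => 1 - iter n smoothstep (1 - x)); last first.
    exact/funext.
  rewrite -[X in _ --> X]subr0; apply: cvgB; first exact: cvg_cst.
  by apply: cvg_iter_smoothstep0; apply/andP; split; lra.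
- rewrite subrr sgr0 addr0 (_ : (fun _ => _) = cst (1 / 2)).
    exact: cvg_cst.
  apply/funext => n; elim: n => [|n IH]; first by rewrite /= mul1r.
  by rewrite iterS IH /smoothstep/=; field.
Qed.

End smoothstep.

(** * Integrable functions annihilated by all cosines and sines *)

Section trigonometric_uniqueness.
Context (R : realType).
Local Notation mR := (measurableTypeR R).
Local Notation nu := (@circle_measure R).
Variable u : mR -> R.
Hypothesis iu : nu.-integrable setT (EFin \o u).
Implicit Types (phi psi : mR -> R) (k : int).

Let bm phi := measurable_fun setT phi /\ exists M, forall t, `|phi t| <= M.

Let I phi : R := \int[nu]_t (u t * phi t).

Let mu_ : measurable_fun setT u.
Proof. by apply/measurable_EFinP; exact: (measurable_int nu iu). Qed.

Let bm_cst c : bm (cst c).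
Proof. by split; [exact: measurable_cst|exists `|c|]. Qed.

Let bmD phi psi : bm phi -> bm psi -> bm (phi \+ psi).
Proof.
move=> [m1 [M1 b1]] [m2 [M2 b2]]; split; first exact: measurable_funD.
exists (M1 + M2) => t; rewrite (le_trans (ler_normD _ _))//.
by apply: lerD.
Qed.

Let bmM phi psi : bm phi -> bm psi -> bm (phi \* psi).
Proof.
move=> [m1 [M1 b1]] [m2 [M2 b2]]; split; first exact: measurable_funM.
by exists (M1 * M2) => t; rewrite normrM ler_pM.
Qed.

Let bm_cos k : bm (fun t => cos (k%:~R * t)).
Proof.
split; last by exists 1 => t; exact: cos_max.
by apply: measurableT_comp; [exact: measurable_cos|exact: measurable_funM].
Qed.

Let bm_sin k : bm (fun t => sin (k%:~R * t)).
Proof.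
split; last by exists 1 => t; exact: sin_max.
by apply: measurableT_comp; [exact: measurable_sin|exact: measurable_funM].
Qed.

Let integrable_bm phi : bm phi ->
  nu.-integrable setT (EFin \o (fun t => u t * phi t)).
Proof.
move=> [mphi [M bM]].
apply: (@le_integrable _ _ _ _ _ measurableT _ (fun t => (M * u t)%:E)).
- by apply/measurable_EFinP; exact: measurable_funM.
- by move=> t _; rewrite /= lee_fin !normrM mulrC ler_wpM2r// (le_trans (bM t))// ler_norm.
- exact: (integrableZl measurableT M iu).
Qed.

Let ID phi psi : bm phi -> bm psi -> I (phi \+ psi) = I phi + I psi.
Proof.
move=> b1 b2; rewrite /I -RintegralD//; try exact: integrable_bm.
by apply: eq_Rintegral => t _; rewrite mulrDr.
Qed.

Let IZ c phi : bm phi -> I (fun t => c * phi t) = c * I phi.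
Proof.
move=> b1; rewrite /I -RintegralZl//; last exact: integrable_bm.
by apply: eq_Rintegral => t _; rewrite mulrCA.
Qed.

(** All Fourier coefficients of the product [u * phi] vanish. *)
Let orth phi := bm phi /\ forall k,
  I (fun t => phi t * cos (k%:~R * t)) = 0 /\
  I (fun t => phi t * sin (k%:~R * t)) = 0.

Let orthD phi psi : orth phi -> orth psi -> orth (phi \+ psi).
Proof.
move=> [b1 o1] [b2 o2]; split=> [|k]; first exact: bmD.
have [c1 s1] := o1 k; have [c2 s2] := o2 k.
split.
  rewrite (_ : (fun _ => _) = (fun t => phi t * cos (k%:~R * t)) \+
    (fun t => psi t * cos (k%:~R * t))); last by apply/funext => t /=; rewrite mulrDl.
  rewrite ID ?c1 ?c2 ?addr0//; exact: bmM.
rewrite (_ : (fun _ => _) = (fun t => phi t * sin (k%:~R * t)) \+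
  (fun t => psi t * sin (k%:~R * t))); last by apply/funext => t /=; rewrite mulrDl.
rewrite ID ?s1 ?s2 ?addr0//; exact: bmM.
Qed.

Let orthZ c phi : orth phi -> orth (fun t => c * phi t).
Proof.
move=> [b o]; split=> [|k]; first exact: (@bmM (cst c)).
have [c1 s1] := o k; split.
  rewrite (_ : (fun _ => _) = (fun t => c * (phi t * cos (k%:~R * t)))); last first.
    by apply/funext => t /=; rewrite mulrA.
  by rewrite IZ ?c1 ?mulr0//; exact: bmM.
rewrite (_ : (fun _ => _) = (fun t => c * (phi t * sin (k%:~R * t)))); last first.
  by apply/funext => t /=; rewrite mulrA.
by rewrite IZ ?s1 ?mulr0//; exact: bmM.
Qed.

(* The bounded functions that multiply the annihilator of the trigonometric
   system into itself form an algebra closed under bounded pointwise limits. *)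
Let mult psi := bm psi /\ forall phi, orth phi -> orth (phi \* psi).

Let mult_cst c : mult (cst c).
Proof.
split=> // phi ophi; rewrite (_ : _ \* _ = fun t => c * phi t); first exact: orthZ.
by apply/funext => t /=; rewrite mulrC.
Qed.

Let multD psi1 psi2 : mult psi1 -> mult psi2 -> mult (psi1 \+ psi2).
Proof.
move=> [b1 m1] [b2 m2]; split; first exact: bmD.
move=> phi ophi; rewrite (_ : _ \* _ = (phi \* psi1) \+ (phi \* psi2)).
  by apply: orthD; [exact: m1|exact: m2].
by apply/funext => t /=; rewrite mulrDr.
Qed.

Let multM psi1 psi2 : mult psi1 -> mult psi2 -> mult (psi1 \* psi2).
Proof.
move=> [b1 m1] [b2 m2]; split; first exact: bmM.
move=> phi ophi; rewrite (_ : _ \* _ = (phi \* psi1) \* psi2).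
  exact/m2/m1.
by apply/funext => t /=; rewrite mulrA.
Qed.

(** The product-to-sum formulas turn multiplication by [cos t] into averaging over the frequencies
    [k + 1] and [k - 1], both covered by [orth phi]. *)
Let mult_cos : mult (@cos R).
Proof.
have bc : bm (@cos R) by have := bm_cos 1; under eq_fun do rewrite mul1r.
split=> // phi [b o]; split=> [|k]; first exact: bmM.
have kD t : (k + 1)%:~R * t = k%:~R * t + t :> R by rewrite rmorphD/= mulrDl mul1r.
have kB t : (k - 1)%:~R * t = k%:~R * t - t :> R by rewrite rmorphB/= mulrBl mul1r.
have [cD sD] := o (k + 1); have [cB sB] := o (k - 1).
split.
  rewrite (_ : (fun _ => _) = fun t => 2^-1 * ((fun t => phi t * cos ((k + 1)%:~R * t)) \+
    (fun t => phi t * cos ((k - 1)%:~R * t))) t).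
    rewrite IZ ?ID ?cD ?cB ?addr0 ?mulr0//; try exact: bmM.
    by apply: bmD; exact: bmM.
  by apply/funext => t /=; rewrite kD kB cosB cosD; field.
rewrite (_ : (fun _ => _) = fun t => 2^-1 * ((fun t => phi t * sin ((k + 1)%:~R * t)) \+
  (fun t => phi t * sin ((k - 1)%:~R * t))) t).
  rewrite IZ ?ID ?sD ?sB ?addr0 ?mulr0//; try exact: bmM.
  by apply: bmD; exact: bmM.
by apply/funext => t /=; rewrite kD kB sinB sinD; field.
Qed.

Let mult_sin : mult (@sin R).
Proof.
have bs : bm (@sin R) by have := bm_sin 1; under eq_fun do rewrite mul1r.
split=> // phi [b o]; split=> [|k]; first exact: bmM.
have kD t : (k + 1)%:~R * t = k%:~R * t + t :> R by rewrite rmorphD/= mulrDl mul1r.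
have kB t : (k - 1)%:~R * t = k%:~R * t - t :> R by rewrite rmorphB/= mulrBl mul1r.
have [cD sD] := o (k + 1); have [cB sB] := o (k - 1).
split.
  rewrite (_ : (fun _ => _) = (fun t => 2^-1 * (phi t * sin ((k + 1)%:~R * t))) \+
    (fun t => - 2^-1 * (phi t * sin ((k - 1)%:~R * t)))).
    rewrite ID ?IZ ?sD ?sB ?mulr0 ?addr0//; try exact: bmM;
      apply: (@bmM (cst _)) => //; exact: bmM.
  by apply/funext => t /=; rewrite kD kB sinB sinD; field.
rewrite (_ : (fun _ => _) = (fun t => 2^-1 * (phi t * cos ((k - 1)%:~R * t))) \+
  (fun t => - 2^-1 * (phi t * cos ((k + 1)%:~R * t)))).
  rewrite ID ?IZ ?cD ?cB ?mulr0 ?addr0//; try exact: bmM;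
    apply: (@bmM (cst _)) => //; exact: bmM.
by apply/funext => t /=; rewrite kD kB cosB cosD; field.
Qed.

(** Dominated convergence, with majorant [|M * u * phi * h|] where [h] is a cosine or a sine. *)
Let mult_lim (psi_ : (mR -> R)^nat) psi M : (forall n, mult (psi_ n)) ->
  (forall n t, `|psi_ n t| <= M) ->
  (forall t, psi_ n t @[n --> \oo] --> psi t) -> mult psi.
Proof.
move=> mpsi_ psiM psil.
have mpsi : measurable_fun setT psi.
  by apply: (@measurable_fun_cvg _ _ _ _ psi_) => // n; have [[]] := mpsi_ n.
have bpsi : bm psi.
  split => //; exists M => t.
  rewrite -(cvg_lim (@Rhausdorff R) (cvg_norm (psil t))).
  apply: limr_le; first by apply/cvg_ex; eexists; exact: cvg_norm (psil t).
  by apply: nearW => n; exact: psiM.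
split=> // phi ophi; have [bphi _] := ophi; split; first exact: bmM.
have lim0 (h : mR -> R) : bm h -> (forall n, I (fun t => (phi \* psi_ n) t * h t) = 0) ->
    I (fun t => (phi \* psi) t * h t) = 0.
  move=> bh I0.
  pose g t := (M * (u t * (phi t * h t)))%:E : \bar R.
  have ig : nu.-integrable setT (fun t => `|g t|)%E.
    apply: integrable_abse.
    exact: (integrableZl measurableT M (integrable_bm (bmM bphi bh))).
  have bn n : bm (fun t => (phi \* psi_ n) t * h t).
    by apply: bmM => //; apply: bmM => //; have [] := mpsi_ n.
  have c := @dominated_cvg _ _ _ nu setT measurableT
    (fun n t => (u t * ((phi \* psi_ n) t * h t))%:E)
    (fun t => (u t * ((phi \* psi) t * h t))%:E) (fun t => `|g t|)%E.
  rewrite /I /Rintegral.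
  rewrite -(cvg_lim _ (c _ _ _ _ _))//.
  - rewrite (_ : (fun _ => _) = cst 0%E) ?lim_cst//; apply/funext => n.
    rewrite -[LHS]fineK; first by have := I0 n; rewrite /I /Rintegral => ->.
    exact: integrable_fin_num (integrable_bm (bn n)).
  - move=> n; have /integrableP[] // := integrable_bm (bn n).
  - move=> t _; apply: cvg_EFin; first exact: nearW.
    apply: cvgM; first exact: cvg_cst.
    apply: cvgM; last exact: cvg_cst.
    by apply: cvgM; [exact: cvg_cst|exact: psil].
  - move=> n t _; rewrite /g lee_fin [in leRHS]normrM.
    rewrite (_ : u t * _ = psi_ n t * (u t * (phi t * h t)))/=; last by ring.
    by rewrite normrM ler_wpM2r// (le_trans (psiM n t))// ler_norm.
move=> k; split; apply: lim0 => // n; have [_ /(_ _ ophi)[_ /(_ k)[]]//] := mpsi_ n.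
Qed.

(** The integrals see only []-pi, pi]]. This is what lets periodic expressions in [cos] and [sin]
    stand for the indicator of a half-line. *)
Let mult_ext psi psi' : mult psi -> bm psi' ->
  {in `]-pi, pi], psi =1 psi'} -> mult psi'.
Proof.
move=> [b m] b' e; split=> // phi ophi; have [bphi _] := ophi.
have [_ o] := m _ ophi; split=> [|k]; first exact: bmM.
have IE h : bm h -> I (fun t => (phi \* psi') t * h t) = I (fun t => (phi \* psi) t * h t).
  move=> bh; rewrite /I /Rintegral; congr fine.
  have mi f : bm f -> measurable_fun setT (fun t => (u t * f t)%:E).
    by move=> /integrable_bm/integrableP[].
  rewrite !integral_circle; [|apply: mi; by do 2 apply: bmM => //..].
  by apply: eq_integral => t; rewrite inE/= => /e ->.
by rewrite !IE//; exact: o.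
Qed.

Let mult_smoothstep psi : mult psi -> mult (fun t => smoothstep (psi t)).
Proof.
move=> m; rewrite (_ : (fun _ => _) = (psi \* psi) \* (cst 3 \+ (cst (- 2) \* psi))).
  by apply: multM; [exact: multM|apply: multD => //; exact: multM].
by apply/funext => t; rewrite /smoothstep/= expr2 mulNr.
Qed.

Let mult_gt psi a : mult psi -> (forall t, `|psi t| <= 1) -> `|a| <= 1 ->
  mult (\1_[set t | a < psi t] : mR -> R).
Proof.
(* Since [|psi t - a| <= 2], division by 4 brings [x] into [[0, 1]], with the threshold [psi t = a]
   at the unstable point 1/2. *)
move=> m b1 a1; pose x t := (psi t - a) / 4 + 2^-1.
have x01 t : 0 <= x t <= 1.
  have := b1 t; have := a1; rewrite /x !ler_norml => /andP[? ?] /andP[? ?].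
  by apply/andP; split; lra.
have mx : mult x.
  rewrite (_ : x = (cst 4^-1 \* psi) \+ cst (2^-1 - a / 4)).
    by apply: multD => //; exact: multM.
  by apply/funext => t; rewrite /x /=; field.
pose e (t : mR) : R := (1 + Num.sg (psi t - a)) / 2.
have msg : mult e.
  apply: (@mult_lim (fun n t => iter n (@smoothstep R) (x t)) e 1).
  - by elim=> [|n IH] //=; exact: mult_smoothstep.
  - by move=> n t; have /andP[? ?] := iter_smoothstep01 n (x01 t); rewrite ger0_norm.
  - move=> t; have := cvg_iter_smoothstep (x01 t).
    by rewrite {2}/x addrK sgrM [Num.sg 4^-1]gtr0_sg ?mulr1.
(* The limit [e] takes the values 0, 1/2 and 1; the polynomial [2 e^2 - e] sends them to 0, 0 and 1,
   which makes the inequality strict. *)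
rewrite (_ : \1__ = (cst 2 \* (e \* e)) \+ (cst (-1) \* e)).
  by apply: multD; apply: multM => //; exact: multM.
apply/funext => t; rewrite /= indicE /e.
have [pa|pa|->] := ltgtP a (psi t).
- by rewrite mem_set//= gtr0_sg ?subr_gt0//; field.
- rewrite ltr0_sg ?subr_lt0// memNset/=; first by field.
  by apply/negP; rewrite -leNgt ltW.
- by rewrite subrr sgr0 memNset/= ?ltxx//; field.
Qed.

Let multC A : mult (\1_A : mR -> R) -> mult (\1_(~` A) : mR -> R).
Proof.
move=> m; rewrite (_ : \1_(~` A) = cst 1 \+ (cst (-1) \* \1_A)).
  by apply: multD => //; exact: multM.
apply/funext => t /=; rewrite !indicE in_setC mulN1r.
by case: (t \in A); rewrite /= ?subrr ?subr0.
Qed.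

Let multI A A' : mult (\1_A : mR -> R) -> mult (\1_A' : mR -> R) ->
  mult (\1_(A `&` A') : mR -> R).
Proof. by move=> m m'; rewrite indicI; exact: multM. Qed.

Let multU A A' : mult (\1_A : mR -> R) -> mult (\1_A' : mR -> R) ->
  mult (\1_(A `|` A') : mR -> R).
Proof.
by move=> m m'; rewrite -[A `|` A']setCK setCU; apply/multC/multI; exact: multC.
Qed.

Let mult_ge psi a : mult psi -> (forall t, `|psi t| <= 1) -> `|a| <= 1 ->
  mult (\1_[set t | a <= psi t] : mR -> R).
Proof.
move=> m b1 a1; rewrite (_ : [set _ | _] = ~` [set t | - a < (cst (-1) \* psi) t]).
  apply/multC/mult_gt; first exact: multM.
    by move=> t; rewrite /= mulN1r normrN.
  by rewrite normrN.
apply/seteqP; split=> t /=; rewrite mulN1r ltrN2.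
  by move=> at_; apply/negP; rewrite -leNgt.
by move/negP; rewrite -leNgt.
Qed.

(** The algebra operations give complements and finite unions. A countable union is the limit of
    finite ones, whose indicators are eventually constant at each point. *)
Let mult_sigma_algebra : sigma_algebra setT [set A : set mR | mult (\1_A : mR -> R)].
Proof.
split=> /=.
- rewrite indic0; exact: (mult_cst 0).
- by move=> A; rewrite setTD; exact: multC.
- move=> F mF.
  pose U n := \big[setU/set0]_(i < n) F i.
  apply: (@mult_lim (fun n => \1_(U n)) _ 1).
  + elim=> [|n IH]; first by rewrite /U big_ord0 indic0; exact: (mult_cst 0).
    by rewrite /U big_ord_recr/=; apply: multU => //; exact: mF.
  + by move=> n t; rewrite indicE; case: (_ \in _); rewrite ?normr1 ?normr0.
  + move=> t; apply: cvg_near_cst.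
    have [[k _ Fk]|nF] := pselect ((\bigcup_n F n) t).
      exists k.+1 => // n /= kn; rewrite !indicE !mem_set//; first by exists k.
      by rewrite /U -bigcup_mkord; exists k.
    exists 0%N => // n _; rewrite !indicE !memNset//.
    by rewrite /U -bigcup_mkord => -[k _ Fk]; apply: nF; exists k.
Qed.

Let bm_indic (A : set mR) : measurable A -> bm (\1_A).
Proof.
move=> mA; split; first exact: measurable_indic.
by exists 1 => t; rewrite indicE; case: (_ \in _); rewrite ?normr1 ?normr0.
Qed.

Let sin_lt0 t : - pi < t < 0 -> sin t < 0 :> R.
Proof. by move=> t0; rewrite -oppr_gt0 -sinN sin_gt0_pi//; lra. Qed.

(* A half-line cuts the circle along an arc, described by the signs of
   [sin t] and [cos t - cos x]. *)
Let mult_itv x : mult (\1_`[x, +oo[%classic : mR -> R).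
Proof.
have bx : bm (\1_`[x, +oo[%classic : mR -> R) by exact: bm_indic.
have sinb := @sin_max R; have cosb := @cos_max R.
have ext (A : set mR) : mult (\1_A : mR -> R) ->
    (forall t, - pi < t <= pi -> A t <-> x <= t) ->
    mult (\1_`[x, +oo[%classic : mR -> R).
  move=> mA Ax; apply: (mult_ext mA bx) => t; rewrite in_itv/= => /Ax {}Ax.
  rewrite !indicE (_ : (t \in A) = (t \in `[x, +oo[%classic))//.
  by apply/idP/idP; rewrite !inE/= in_itv/= andbT => /Ax.
have [xpi|xpi] := leP x (- pi).
  apply: (ext setT) => [|t /andP[t1 t2]]; first by rewrite indicT; exact: mult_cst.
  by split=> // _; rewrite (le_trans xpi)// ltW.
have [xpi'|xpi'] := ltP pi x.
  apply: (ext set0) => [|t /andP[t1 t2]]; first by rewrite indic0; exact: (mult_cst 0).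
  by split=> // xt; have := lt_le_trans xpi' xt; rewrite ltNge t2.
have msin : mult (\1_[set t | 0 <= sin t] : mR -> R).
  by apply: mult_ge => //; rewrite normr0.
have cosE s t : - pi < s < 0 -> - pi < t < 0 -> (cos s <= cos t) = (s <= t) :> bool.
  move=> /andP[s1 s2] /andP[t1 t2]; rewrite -(cosN s) -(cosN t).
  rewrite leNgt ltr_cos ?in_itv/=; last 2 first.
  - by apply/andP; split; lra.
  - by apply/andP; split; lra.
  by rewrite ltrN2 -leNgt.
have cosE' s t : 0 <= s <= pi -> 0 <= t <= pi -> (cos s <= cos t) = (t <= s) :> bool.
  by move=> s0 t0; rewrite leNgt ltr_cos ?in_itv//= -leNgt.
have [x0|x0] := ltP x 0.
  (* Cosine increases on []-pi, 0[], so [cos x <= cos t] selects the part of the arc there;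
     [0 <= sin t] adds the angles of [[0, pi]]. *)
  apply: (ext ([set t | 0 <= sin t] `|` [set t | cos x <= cos t])) => [|t /andP[t1 t2]].
    by apply: multU => //; exact: mult_ge.
  have [t0|t0] := ltP t 0.
    split=> [[/=|/=]|xt]; first by rewrite leNgt sin_lt0 ?t1.
      by rewrite cosE ?xpi ?t1.
    by right; rewrite /= cosE ?xpi ?t1.
  split=> [_|_]; first by rewrite (le_trans (ltW x0)).
  by left; rewrite /= sin_ge0_pi ?t0.
(* Here the arc lies in [[0, pi]], where cosine decreases; complementing a strict inequality keeps
   [t = x]. *)
apply: (ext ([set t | 0 <= sin t] `&` ~` [set t | cos x < cos t])) => [|t /andP[t1 t2]].
  by apply: multI => //; apply: multC; exact: mult_gt.
have [t0|t0] := ltP t 0.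
  split=> [[/=]|xt]; first by rewrite leNgt sin_lt0 ?t1.
  by have := lt_le_trans t0 (le_trans x0 xt); rewrite ltxx.
split=> [[_ /= /negP]|xt]; first by rewrite -leNgt cosE' ?t0 ?x0.
by split=> /=; [rewrite sin_ge0_pi ?t0|apply/negP; rewrite -leNgt cosE' ?t0 ?x0].
Qed.

Let mult_indic A : measurable A -> mult (\1_A : mR -> R).
Proof.
rewrite [measurable]RGenCInfty.measurableE.
apply: (smallest_sub mult_sigma_algebra) => _ [x ->]/=; exact: mult_itv.
Qed.

Hypothesis u_cos : forall k, \int[nu]_t (u t * cos (k%:~R * t)) = 0.
Hypothesis u_sin : forall k, \int[nu]_t (u t * sin (k%:~R * t)) = 0.

(** The hypotheses say [orth (cst 1)], hence [orth] holds for every Borel indicator. Its cosine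
    coefficient at [k = 0] is the integral of [u] over the set. *)
Lemma trigonometric_uniqueness : \forall t \ae nu, u t = 0.
Proof.
have o1 : orth (cst 1).
  split=> // k; split; rewrite /I.
    by rewrite -[RHS](u_cos k); apply: eq_Rintegral => t _; rewrite mul1r.
  by rewrite -[RHS](u_sin k); apply: eq_Rintegral => t _; rewrite mul1r.
have uA A : measurable A -> (\int[nu]_(t in A) (u t)%:E = 0)%E.
  move=> mA; have [[b _] m] := mult_indic mA.
  have [_ /(_ 0)[+ _]] := m _ o1.
  rewrite /I (_ : (fun _ => _) = fun t => u t * \1_A t); last first.
    by apply/funext => t /=; rewrite mul1r mul0r cos0 mulr1.
  move=> I0; rewrite integral_mkcond.
  rewrite (_ : _ \_ _ = EFin \o (fun t => u t * \1_A t)); last first.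
    apply/funext => t; rewrite patchE /= indicE.
    by case: ifP => _; rewrite ?mulr1 ?mulr0.
  rewrite -[LHS]fineK; first by rewrite -[fine _]/(\int[nu]_t _) I0.
  by apply: integrable_fin_num => //; apply: integrable_bm; have [] := mult_indic mA.
have := @integral_ae_eq _ _ _ nu setT measurableT (cst 0%E) _ iu (measurable_cst _).
move=> h; have {h} : ae_eq nu setT (EFin \o u) (cst 0%E).
  by apply: h => A _ mA; rewrite uA// integral0.
by apply: filterS => t /(_ Logic.I)/= [].
Qed.

End trigonometric_uniqueness.

(** * Fourier coefficients on the circle *)

Section complex_measurable.
Context d (T : measurableType d) (R : realType).
Implicit Types f g : T -> R[i].

Lemma cmeasurableM f g : cmeasurable f -> cmeasurable g ->
  cmeasurable (fun x => f x * g x).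
Proof.
move=> [f1 f2] [g1 g2]; split.
  rewrite (_ : (fun _ => _) = (fun x => complex.Re (f x) * complex.Re (g x)) \-
      (fun x => complex.Im (f x) * complex.Im (g x))).
    by apply: measurable_funB; exact: measurable_funM.
  by apply/funext => x /=; case: (f x) (g x) => [a b] [c e].
rewrite (_ : (fun _ => _) = (fun x => complex.Re (f x) * complex.Im (g x)) \+
    (fun x => complex.Im (f x) * complex.Re (g x))).
  by apply: measurable_funD; exact: measurable_funM.
by apply/funext => x /=; case: (f x) (g x) => [a b] [c e].
Qed.

Lemma cmeasurable_cst (c : R[i]) : cmeasurable (fun _ : T => c).
Proof. by split; exact: measurable_cst. Qed.

Lemma cmeasurableX f n : cmeasurable f -> cmeasurable (fun x => f x ^+ n).
Proof.
move=> mf; elim: n => [|n IH].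
  under eq_fun do rewrite expr0; exact: cmeasurable_cst.
under eq_fun do rewrite exprS; exact: cmeasurableM.
Qed.

Lemma cmeasurable_comp d' (T' : measurableType d') (h : T' -> T) f :
  cmeasurable f -> measurable_fun setT h -> cmeasurable (fun x => f (h x)).
Proof. by move=> [f1 f2] mh; split; [exact: measurableT_comp f1 mh|exact: measurableT_comp f2 mh]. Qed.

End complex_measurable.

Section expi.
Context (R : realType).
Local Notation mR := (measurableTypeR R).
Implicit Types (t : R) (n k : int).

Lemma expiD (x y : R) : expi (x + y) = expi x * expi y.
Proof. by apply/eqP; rewrite eq_complex /= cosD sinD eqxx addrC !(mulrC (sin _)) eqxx. Qed.

Lemma rnorm_expi (x : R) : rnorm (expi x) = 1.
Proof.
apply/eqP; rewrite -(@eqrXn2 _ 2)// ?rnorm_ge0// sqr_rnormE/=.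
by rewrite cos2Dsin2 expr1n.
Qed.

Lemma cmeasurable_expi n : cmeasurable (fun t : mR => expi (n%:~R * t)).
Proof.
split; rewrite /=.
  exact: measurableT_comp (@measurable_cos R) (mulrl_measurable _).
exact: measurableT_comp (@measurable_sin R) (mulrl_measurable _).
Qed.

Lemma circle_measureT : circle_measure (setT : set mR) = (2 * pi)%:E.
Proof.
have pi0 := pi_gt0 R.
rewrite /circle_measure/= /mrestr setTI lebesgue_measure_itv/= lte_fin.
by rewrite ifT; [rewrite -EFinB; congr (_%:E); ring|lra].
Qed.

Lemma cintegral_circle (f : mR -> R[i]) : cmeasurable f ->
  cintegral (@lebesgue_measure R) `]-pi, pi] f =
  cintegral (@circle_measure R) setT f.
Proof.
move=> [f1 f2]; rewrite /cintegral /Rintegral.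
by congr (Complex (fine _) (fine _)); rewrite integral_circle//; exact/measurable_EFinP.
Qed.

Lemma cintegral_expi n : cintegral (@circle_measure R) setT
  (fun t => expi (n%:~R * t)) = (if n == 0 then 2 * pi else 0)%:C%C.
Proof.
have pi0 := pi_gt0 R.
have [->|n0] := eqVneq n 0.
  rewrite /cintegral; congr Complex.
    rewrite (_ : (fun _ => _) = cst 1).
      by rewrite Rintegral_cst// mul1r [X in fine X]circle_measureT.
    by apply/funext => t; rewrite /= mul0r cos0.
  rewrite (_ : (fun _ => _) = cst 0).
    by rewrite Rintegral_cst// mul0r.
  by apply/funext => t; rewrite /= mul0r sin0.
have nR0 : n%:~R != 0 :> R by rewrite intr_eq0.
have [mc ms] := cmeasurable_expi n.
have sinpiz : sin (n%:~R * pi) = 0 :> R.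
  have sinm (m : nat) : sin (m%:R * pi) = 0 :> R.
    by rewrite mulr_natl -[_ *+ _]add0r (alternatingn (@sinDpi R)) sin0 mulr0.
  case: (n) => m; first exact: sinm.
  by rewrite NegzE rmorphN/= mulNr sinN sinm oppr0.
have lin (t : R) : is_derive t 1 ( *%R (n%:~R : R)) n%:~R.
  rewrite -[X in is_derive _ _ _ X]mulr1.
  exact: (is_deriveZ _ (is_derive_id t 1)).
have dsin (t : R) : is_derive t 1 (fun t : R => n%:~R^-1 * sin (n%:~R * t)) (cos (n%:~R * t)).
  have := is_deriveZ n%:~R^-1 (is_derive1_comp (is_derive_sin _) (lin t)).
  by rewrite /GRing.scale/= mulrCA mulVf ?mulr1.
have dcos (t : R) : is_derive t 1 (fun t : R => - n%:~R^-1 * cos (n%:~R * t)) (sin (n%:~R * t)).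
  have := is_deriveZ (- n%:~R^-1) (is_derive1_comp (is_derive_cos _) (lin t)).
  by rewrite /GRing.scale/= mulNr mulrCA mulVf// mulr1 opprK.
have clin : continuous ( *%R (n%:~R : R)).
  move=> t; apply: differentiable_continuous.
  exact/derivable1_diffP/(@ex_derive _ _ _ _ _ _ _ (lin t)).
rewrite /cintegral /Rintegral; congr Complex.
  rewrite integral_circle; last exact/measurable_EFinP.
  rewrite integral_itv_obnd_cbnd; last by apply/measurable_EFinP/measurable_funTS.
  rewrite (@integral_derive _ (fun t => n%:~R^-1 * sin (n%:~R * t))) //.
  - by rewrite mulrN sinN sinpiz oppr0 mulr0 subr0.
  - lra.
  - by move=> t _; apply: continuous_comp; [exact: clin|exact: continuous_cos].
rewrite integral_circle; last exact/measurable_EFinP.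
rewrite integral_itv_obnd_cbnd; last by apply/measurable_EFinP/measurable_funTS.
rewrite (@integral_derive _ (fun t => - n%:~R^-1 * cos (n%:~R * t))) //.
- by rewrite mulrN cosN subrr.
- lra.
- by move=> t _; apply: continuous_comp; [exact: clin|exact: continuous_sin].
Qed.

End expi.

(** * The orthonormal exponentials on one circle *)

Section circle_coefficients.
Context (R : realType).
Local Notation mR := (measurableTypeR R).
Local Notation mu := (@lebesgue_measure R).
Local Notation nu := (@circle_measure R).
Local Notation s := ((Num.sqrt (2 * pi))^-1 : R).
Implicit Types (h : mR -> R[i]) (k : int) (c : R[i]).

(** The same formula as [fourier_coef] on a single circle, so that the two agree by conversion. *)
Definition circle_coef h k : R[i] :=
  s%:C%C * cintegral mu `]-pi, pi] (fun t => h t * expi (- (k%:~R * t))).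

Definition circle_basis k (t : mR) : R[i] := s%:C%C * expi (k%:~R * t).

Lemma sqr_circle_const : s ^+ 2 * (2 * pi) = 1.
Proof.
have pi0 := pi_gt0 R.
by rewrite exprVn sqr_sqrtr ?mulVf ?gt_eqF//; lra.
Qed.

Lemma cmeasurable_circle_basis k : cmeasurable (circle_basis k).
Proof. by apply: cmeasurableM; [exact: cmeasurable_cst|exact: cmeasurable_expi]. Qed.

Lemma cmeasurable_twist h k : cmeasurable h ->
  cmeasurable (fun t => h t * expi (- (k%:~R * t))).
Proof.
move=> mh; apply: cmeasurableM => //.
rewrite (_ : (fun _ => _) = fun t : mR => expi ((- k)%:~R * t)).
  exact: cmeasurable_expi.
by apply/funext => t; rewrite rmorphN mulNr.
Qed.

Lemma twist_L2 (h : L2fun nu) k : (fun t => h t * expi (- (k%:~R * t))) \in L2pred nu.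
Proof.
have [mh lh] := L2funP h; rewrite inE; split; first exact: cmeasurable_twist.
rewrite /L2int; under eq_integral do rewrite rnormM rnorm_expi mulr1; exact: lh.
Qed.

(** Bundled as an [L2fun], for which integrability and linearity of [cintegral] are available. *)
Definition twist (h : L2fun nu) k : L2fun nu := MkL2fun (twist_L2 h k).

Lemma circle_coefE h k : cmeasurable h -> circle_coef h k =
  s%:C%C * cintegral nu setT (fun t => h t * expi (- (k%:~R * t))).
Proof.
by move=> mh; rewrite /circle_coef cintegral_circle//; exact: cmeasurable_twist.
Qed.

Lemma circle_coef_linear (h g : L2fun nu) c k :
  circle_coef (fun t => c * h t + g t) k = c * circle_coef h k + circle_coef g k.
Proof.
have [mh _] := L2funP h; have [mg _] := L2funP g; have [mhg _] := L2funP (c *: h + g).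
rewrite [LHS](circle_coefE _ mhg) !circle_coefE// mulrCA -mulrDr; congr (_ * _).
rewrite -(cintegralZ c (twist h k)) -(cintegralD (c *: twist h k) (twist g k)).
by congr cintegral; apply/funext => t; rewrite /= mulrDl -mulrA.
Qed.

Lemma circle_coef_basis c j k :
  circle_coef (fun t => c * circle_basis j t) k = if k == j then c else 0.
Proof.
have mc : cmeasurable (fun t => c * circle_basis j t).
  by apply: cmeasurableM; [exact: cmeasurable_cst|exact: cmeasurable_circle_basis].
rewrite circle_coefE//.
have expi_L2 n : (fun t : mR => expi (n%:~R * t)) \in L2pred nu.
  rewrite inE; split; first exact: cmeasurable_expi.
  rewrite /L2int; under eq_integral do rewrite rnorm_expi expr1n.
  by rewrite integral_cst// mul1e [ltLHS]circle_measureT ltry.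
pose E : L2fun nu := MkL2fun (expi_L2 (j - k)).
rewrite (_ : (fun _ => _) = (c * s%:C%C) *: (E : mR -> R[i])).
  rewrite cintegralZ cintegral_expi subr_eq0 eq_sym.
  case: ifP => _; last by rewrite rmorph0 !mulr0.
  transitivity (c * (s ^+ 2 * (2 * pi))%:C%C).
    by rewrite expr2 !rmorphM/=; ring.
  by rewrite sqr_circle_const rmorph1 mulr1.
apply/funext => t; rewrite /circle_basis /= /GRing.scale/=.
rewrite -!mulrA -expiD rmorphB/= mulrBl; exact: mulrA.
Qed.

(* Expanding a square in the orthonormal system [circle_basis]. *)
Lemma circle_bessel (h : L2fun nu) c k :
  (L2int nu (fun t => h t - c * circle_basis k t)%R +
     (rnorm (circle_coef h k) ^+ 2)%:E =
   L2int nu h + (rnorm (circle_coef h k - c)%R ^+ 2)%:E)%E.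
Proof.
have [mh lh] := L2funP h; have [mt _] := L2funP (twist h k).
have [iP iQ] := L2fun_integrable (twist h k).
pose N t := rnorm (h t) ^+ 2.
pose P t := complex.Re (twist h k t); pose Q t := complex.Im (twist h k t).
have iN : nu.-integrable setT (EFin \o N).
  apply/integrableP; split; first exact: measurable_sqr_rnorm.
  by under eq_integral do rewrite gee0_abs ?lee_fin ?sqr_ge0//.
case: c => c1 c2.
(* The last term is twice the real part of [s] times the conjugate of [c] times [h t * e^{-ikt}];
   integrating [P] and [Q] produces the coefficient of [h]. *)
pose W t : R := N t + s ^+ 2 * (c1 ^+ 2 + c2 ^+ 2) - 2 * s * (c1 * P t + c2 * Q t).
have WE t : rnorm (h t - Complex c1 c2 * circle_basis k t) ^+ 2 = W t.
  rewrite sqr_rnormE /W /N /P /Q /circle_basis /= sqr_rnormE.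
  case: (h t) => a b /=; rewrite cosN sinN.
  have := cos2Dsin2 (k%:~R * t); move: (cos _) (sin _) => C S CS.
  rewrite (_ : _ + _ = (a ^+ 2 + b ^+ 2) + s ^+ 2 * (c1 ^+ 2 + c2 ^+ 2) * (C ^+ 2 + S ^+ 2) -
    2 * s * (c1 * (a * C + b * S) + c2 * (b * C - a * S))); last by ring.
  by rewrite CS; ring.
pose iP' := integrableZl measurableT (2 * s * c1) iP.
pose iQ' := integrableZl measurableT (2 * s * c2) iQ.
pose K := s ^+ 2 * (c1 ^+ 2 + c2 ^+ 2).
have iK : nu.-integrable setT (EFin \o cst K) by exact: finite_measure_integrable_cst.
have iNK : nu.-integrable setT (EFin \o (fun t => N t + K)) by exact: (integrableD _ iN iK).
have iPQ : nu.-integrable setT (EFin \o (fun t => 2 * s * c1 * P t + 2 * s * c2 * Q t)).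
  exact: (integrableD _ iP' iQ').
have WE' t : W t = (N t + K) - (2 * s * c1 * P t + 2 * s * c2 * Q t).
  by rewrite /W /K; ring.
have iW : nu.-integrable setT (EFin \o W).
  rewrite (_ : EFin \o W = EFin \o (fun t => (N t + K) -
      (2 * s * c1 * P t + 2 * s * c2 * Q t))); last by apply/funext => t /=; rewrite WE'.
  exact: (integrableB _ iNK iPQ).
have EFin_int (F : mR -> R) : nu.-integrable setT (EFin \o F) ->
    (\int[nu]_t (F t)%:E = (\int[nu]_t F t)%:E)%E.
  by move=> iF; rewrite /Rintegral fineK//; exact: integrable_fin_num iF.
rewrite {1}/L2int; under eq_integral do rewrite WE.
rewrite EFin_int// -[L2int nu h]/(\int[nu]_t (N t)%:E)%E EFin_int// -!EFinD; congr EFin.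
under eq_Rintegral do rewrite WE'.
rewrite RintegralB//= RintegralD// RintegralD// RintegralZl// RintegralZl//.
rewrite Rintegral_cst// [X in fine X]circle_measureT/=.
rewrite !sqr_rnormE circle_coefE//.
rewrite -[cintegral _ _ _]/(Complex (\int[nu]_t P t) (\int[nu]_t Q t)).
move: (\int[nu]_t P t) (\int[nu]_t Q t) (\int[nu]_t N t) => p q n /=.
rewrite /K -mulrA [X in _ + X - _](_ : _ = (c1 ^+ 2 + c2 ^+ 2) * (s ^+ 2 * (2 * pi))); last by ring.
by rewrite sqr_circle_const; ring.
Qed.

(** A complex coefficient mixes cosine integrals of one of the parts of [h] with sine integrals of
    the other. Passing from [k] to [- k] changes the sign of the sine integrals only, so both
    coefficients together separate the four. *)
Lemma circle_coef_eq0 (h : L2fun nu) :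
  (forall k, circle_coef h k = 0) -> \forall t \ae nu, h t = 0.
Proof.
move=> h0; have [mh _] := L2funP h.
have [ia ib] := L2fun_integrable h.
pose a t := complex.Re (h t); pose b t := complex.Im (h t).
have [ma mb] : measurable_fun setT a /\ measurable_fun setT b by have [] := mh.
have trig (f g : mR -> R) : measurable_fun setT g -> (forall t, `|g t| <= 1) ->
    nu.-integrable setT (EFin \o f) -> nu.-integrable setT (EFin \o (fun t => f t * g t)).
  move=> mg g1 fi; apply: le_integrable (fi) => //.
    apply/measurable_EFinP/measurable_funM => //.
    by have /integrableP[/measurable_EFinP] := fi.
  by move=> t _; rewrite /= lee_fin normrM ler_piMr.
have mC k : measurable_fun setT (fun t : mR => cos (k%:~R * t)) by have [] := cmeasurable_expi R k.
have mS k : measurable_fun setT (fun t : mR => sin (k%:~R * t)) by have [] := cmeasurable_expi R k.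
have iaC k : nu.-integrable setT (EFin \o (fun t => a t * cos (k%:~R * t))).
  by apply: trig => // t; exact: cos_max.
have iaS k : nu.-integrable setT (EFin \o (fun t => a t * sin (k%:~R * t))).
  by apply: trig => // t; exact: sin_max.
have ibC k : nu.-integrable setT (EFin \o (fun t => b t * cos (k%:~R * t))).
  by apply: trig => // t; exact: cos_max.
have ibS k : nu.-integrable setT (EFin \o (fun t => b t * sin (k%:~R * t))).
  by apply: trig => // t; exact: sin_max.
pose aC k := \int[nu]_t (a t * cos (k%:~R * t)).
pose aS k := \int[nu]_t (a t * sin (k%:~R * t)).
pose bC k := \int[nu]_t (b t * cos (k%:~R * t)).
pose bS k := \int[nu]_t (b t * sin (k%:~R * t)).
have coef0 k : aC k + bS k = 0 /\ bC k - aS k = 0.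
  have s0 : s != 0 by rewrite invr_eq0 gt_eqF// sqrtr_gt0 mulr_gt0// pi_gt0.
  have /eqP := h0 k; rewrite circle_coefE// mulf_eq0 => /orP[|].
    by rewrite eq_complex/= (negPf s0).
  rewrite eq_complex/= => /andP[/eqP p0 /eqP q0]; split.
    rewrite -RintegralD// -[RHS]p0; apply: eq_Rintegral => t _.
    by rewrite /a /b; case: (h t) => x y /=; rewrite cosN sinN mulrN opprK.
  rewrite -RintegralB// -[RHS]q0; apply: eq_Rintegral => t _.
  by rewrite /a /b; case: (h t) => x y /=; rewrite cosN sinN mulrN addrC.
have kN k (t : R) : (- k)%:~R * t = - (k%:~R * t) by rewrite rmorphN mulNr.
have aCN k : aC (- k) = aC k by apply: eq_Rintegral => t _; rewrite kN cosN.
have bCN k : bC (- k) = bC k by apply: eq_Rintegral => t _; rewrite kN cosN.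
have EN (f : mR -> R) k : nu.-integrable setT (EFin \o (fun t => f t * sin (k%:~R * t))) ->
    \int[nu]_t (f t * sin ((- k)%:~R * t)) = - \int[nu]_t (f t * sin (k%:~R * t)).
  move=> fi; rewrite -[RHS]mulN1r -RintegralZl//.
  by apply: eq_Rintegral => t _; rewrite kN sinN mulrN mulN1r.
have aSN k : aS (- k) = - aS k by exact: EN.
have bSN k : bS (- k) = - bS k by exact: EN.
have all0 k : [/\ aC k = 0, aS k = 0, bC k = 0 & bS k = 0].
  have [e1 e2] := coef0 k; have [] := coef0 (- k).
  by rewrite aCN bCN aSN bSN => e3 e4; split; lra.
have a0 := @trigonometric_uniqueness _ a ia.
have b0 := @trigonometric_uniqueness _ b ib.
have {}a0 : \forall t \ae nu, a t = 0 by apply: a0 => k; have [] := all0 k.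
have {}b0 : \forall t \ae nu, b t = 0 by apply: b0 => k; have [] := all0 k.
apply: filterS2 a0 b0 => t; rewrite /a /b; case: (h t) => x y /= -> ->; exact: erefl.
Qed.

End circle_coefficients.

(** * Completeness of L2 *)

Section L2_completeness.
Context d (T : measurableType d) (R : realType).
Variable mu : {measure set T -> \bar R}.

Lemma limn_einf_le (u : (\bar R)^nat) (c : \bar R) :
  (forall n, (u n <= c)%E) -> (limn_einf u <= c)%E.
Proof.
move=> uc; rewrite limn_einf_lim; apply: lime_le; first exact: is_cvg_einfs.
apply: nearW => n; apply: le_trans (uc n).
by apply: ereal_inf_lbound; exists n => /=.
Qed.

Lemma cvg_sqr_rnorm (z : nat -> R[i]) (w c : R[i]) :
  complex.Re (z n) @[n --> \oo] --> complex.Re w ->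
  complex.Im (z n) @[n --> \oo] --> complex.Im w ->
  rnorm (z n - c) ^+ 2 @[n --> \oo] --> rnorm (w - c) ^+ 2.
Proof.
move=> zr zi; under eq_fun do rewrite sqr_rnormE raddfB/= (raddfB (@complex.Im R))/=.
rewrite sqr_rnormE raddfB/= (raddfB (@complex.Im R))/= !expr2.
under eq_fun do rewrite !expr2.
have zrc : complex.Re (z n) - complex.Re c @[n --> \oo] --> complex.Re w - complex.Re c.
  by apply: cvgB => //; exact: cvg_cst.
have zic : complex.Im (z n) - complex.Im c @[n --> \oo] --> complex.Im w - complex.Im c.
  by apply: cvgB => //; exact: cvg_cst.
by apply: cvgD; [exact: (cvgM zrc zrc)|exact: (cvgM zic zic)].
Qed.

(* Summable even after multiplication by [4 ^+ n], so that a sequence with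
   squared steps below this rate has steps of size O(2^-n) almost everywhere. *)
Definition fast_rate n : R := (4 ^+ n * 2 ^+ n.+1)^-1.

(** The steps are at most [sqrt C * 2^-n], so the telescoping series converges absolutely. *)
Lemma cvgn_of_geometric_steps (a : R^nat) (C : R) :
  (forall n, `|a n.+1 - a n| ^+ 2 <= C / 4 ^+ n) -> cvgn a.
Proof.
move=> aC; have C0 : 0 <= C.
  by have := aC 0%N; rewrite expr0 divr1; apply: le_trans; rewrite sqr_ge0.
have le n : `|a n.+1 - a n| <= geometric (Num.sqrt C) 2^-1 n.
  rewrite /geometric/= -(@ler_pXn2r _ 2)// ?nnegrE// ?mulr_ge0 ?sqrtr_ge0 ?exprn_ge0//.
  rewrite exprMn sqr_sqrtr// -exprM mulnC exprM (_ : 2^-1 ^+ 2 = 4^-1); last by field.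
  by rewrite exprVn.
rewrite (_ : a = fun n => a 0%N + series (telescope a) n); last first.
  by apply/funext => n; exact: eq_sum_telescope.
apply: is_cvgD; first exact: is_cvg_cst.
apply: normed_cvg; apply: (series_le_cvg _ _ le) => //.
- by move=> n; rewrite /geometric/= mulr_ge0 ?sqrtr_ge0 ?exprn_ge0.
- apply: is_cvg_geometric_series; rewrite ger0_norm//; lra.
Qed.

(** The sum [W] of the squared steps weighted by [4 ^+ n] is integrable, hence finite almost
    everywhere, and there [g n x] converges. Fatou's lemma bounds the distance to the limit. *)
Lemma L2fun_complete (g : nat -> L2fun mu) :
  (forall n m, (n <= m)%N -> (L2int mu (g m - g n)%R <= (fast_rate n)%:E)%E) ->
  exists G : L2fun mu, forall n, (L2int mu (G - g n)%R <= (fast_rate n)%:E)%E.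
Proof.
move=> gC.
pose D n x : R := rnorm (g n.+1 x - g n x) ^+ 2.
have mg n : cmeasurable (g n) by have [] := L2funP (g n).
have mD n : measurable_fun setT (fun x => (4 ^+ n * D n x)%:E).
  apply/measurable_EFinP/measurable_funM => //.
  apply/measurable_EFinP.
  have [m _] := L2funP (g n.+1 - g n); exact: (measurable_sqr_rnorm m).
have D0 n x : (0 <= (4 ^+ n * D n x)%:E)%E.
  by rewrite lee_fin; apply: mulr_ge0; [exact: exprn_ge0|exact: sqr_ge0].
pose W x := (\sum_(0 <= n <oo) (4 ^+ n * D n x)%:E)%E.
have W0 x : (0 <= W x)%E by apply: nneseries_ge0 => n _ _; exact: D0.
have mW : measurable_fun setT W.
  exact: (ge0_emeasurable_sum (P := xpredT) (h := fun n x => (4 ^+ n * D n x)%:E)).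
have iW : mu.-integrable setT W.
  apply/integrableP; split => //.
  under eq_integral do rewrite gee0_abs//.
  rewrite /W integral_nneseries//.
  (* The terms have integrals at most [4 ^+ n * fast_rate n = 2^-(n+1)], with sum 1. *)
  have := @cvg_geometric_eseries_half R 1 0; rewrite expr0 divr1 => h.
  apply: (@le_lt_trans _ _ 1%E); last exact: ltry.
  rewrite -(cvg_lim _ h)//; apply: lee_nneseries => [n _ _|n _].
    by apply: integral_ge0 => x _; exact: D0.
  under eq_integral do rewrite EFinM.
  rewrite ge0_integralZl//; last 2 first.
  - apply/measurable_EFinP.
    have [m _] := L2funP (g n.+1 - g n); apply/measurable_EFinP; exact: (measurable_sqr_rnorm m).
  - by move=> x _; rewrite lee_fin sqr_ge0.
  have := gC n n.+1 (leqnSn n); rewrite /L2int => le.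
  have p0 : (0 <= (4 ^+ n)%:E :> \bar R)%E by rewrite lee_fin exprn_ge0.
  apply: le_trans (lee_wpmul2l p0 le) _.
  have n4 : 4 ^+ n != 0 :> R by rewrite expf_neq0.
  by rewrite -EFinM lee_fin /fast_rate addn1 natrX invfM mulrA divff.
pose E := [set x | (W x < +oo)%E].
have mE : measurable E.
  have := emeasurable_fun_infty_o measurableT mW +oo%E; rewrite setTI; exact.
have aeE : \forall x \ae mu, E x.
  have := integrable_ae measurableT iW; apply: filterS => x /(_ Logic.I).
  by rewrite ge0_fin_numE.
(* Truncation to [E] makes the sequence converge at every point, so that the limit is measurable. *)
pose h n x : R[i] := (\1_E x)%:C%C * g n x.
have mh n : cmeasurable (h n).
  apply: cmeasurableM => //; split; last exact: measurable_cst.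
  exact: measurable_indic.
have hE n x : E x -> h n x = g n x.
  by move=> Ex; rewrite /h indicE mem_set// rmorph1 mul1r.
have steps x n : E x -> D n x <= fine (W x) / 4 ^+ n.
  move=> Ex; rewrite ler_pdivlMr ?exprn_gt0// mulrC -lee_fin fineK; last first.
    by rewrite ge0_fin_numE.
  rewrite /W (@nneseriesD1 _ _ n)//.
  by apply: leeDl; apply: nneseries_ge0 => k _ _; exact: D0.
have cr x : cvgn (fun n => complex.Re (h n x)).
  have [Ex|nEx] := pselect (E x).
    apply: (@cvgn_of_geometric_steps _ (fine (W x))) => n; rewrite !hE//.
    apply: le_trans (steps x n Ex); rewrite /D sqr_rnormE real_normK ?num_real//.
    by rewrite raddfB lerDl sqr_ge0.
  under eq_fun do rewrite /h indicE memNset// mul0r; exact: is_cvg_cst.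
have ci x : cvgn (fun n => complex.Im (h n x)).
  have [Ex|nEx] := pselect (E x).
    apply: (@cvgn_of_geometric_steps _ (fine (W x))) => n; rewrite !hE//.
    apply: le_trans (steps x n Ex); rewrite /D sqr_rnormE real_normK ?num_real//.
    by rewrite [X in _ <= _ + X ^+ 2]raddfB lerDr sqr_ge0.
  under eq_fun do rewrite /h indicE memNset// mul0r; exact: is_cvg_cst.
pose G x := Complex (limn (fun n => complex.Re (h n x))) (limn (fun n => complex.Im (h n x))).
have mG : cmeasurable G.
  split.
    by apply: (measurable_fun_cvg (fun n => (mh n).1)) => x _ /=; exact: (cr x).
  by apply: (measurable_fun_cvg (fun n => (mh n).2)) => x _ /=; exact: (ci x).
have mGg n : cmeasurable (G - g n).
  by rewrite -scaleN1r; apply: cmeasurableD mG _; exact: (cmeasurableZ _ (mg n)).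
have Gg n : (L2int mu (G - g n)%R <= (fast_rate n)%:E)%E.
  (* Indices start at [n], so that [gC] bounds the integral of every term by the same rate. *)
  pose f m x := (rnorm (g (m + n)%N x - g n x) ^+ 2)%:E.
  have mf m : measurable_fun setT (f m).
    have [mm _] := L2funP (g (m + n)%N - g n); exact: (measurable_sqr_rnorm mm).
  have lim x : E x -> limn_einf (f ^~ x) = (rnorm (G x - g n x) ^+ 2)%:E.
    move=> Ex; apply: (cvg_limn_einf_sup _).1; apply: cvg_EFin; first exact: nearW.
    rewrite (cvg_shiftn n (fun m => rnorm (g m x - g n x) ^+ 2)).
    apply: cvg_sqr_rnorm => /=.
      by have := cr x; under eq_fun do rewrite hE//.
    by have := ci x; under eq_fun do rewrite hE//.
  rewrite /L2int (@ae_eq_integral _ _ _ mu setT (fun x => limn_einf (f ^~ x)))//.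
  - apply: le_trans (fatou mu measurableT mf _) _.
      by move=> m x _; rewrite lee_fin sqr_ge0.
    by apply: limn_einf_le => m; apply: gC; exact: leq_addl.
  - exact: (measurable_sqr_rnorm (mGg n)).
  - apply: (emeasurable_fun_cvg (fun m x => einfs (f ^~ x) m)).
      by move=> m; exact: measurable_fun_einfs.
    by move=> x _; rewrite limn_einf_lim; exact: is_cvg_einfs.
  - by apply: filterS aeE => x Ex _; rewrite lim.
have GL : G \in L2pred mu.
  have -> : G = (G - g 0%N) + g 0%N by rewrite subrK.
  apply: rpredD; last exact: valP.
  rewrite inE; split => //; exact: le_lt_trans (Gg 0%N) (ltry _).
by exists (MkL2fun GL) => n; exact: Gg.
Qed.

End L2_completeness.

(** * Fourier coefficients on the body *)

(** Tonelli's theorem covers the positive and negative parts, whose section integrals define the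
    signed one. *)
Lemma measurable_integral_section d1 d2 (T1 : measurableType d1)
    (T2 : measurableType d2) (R : realType)
    (m2 : {sigma_finite_measure set T2 -> \bar R}) (g : T1 * T2 -> \bar R) :
  measurable_fun setT g ->
  measurable_fun setT (fun x => \int[m2]_y g (x, y))%E.
Proof.
move=> mg.
rewrite (_ : (fun _ => _) = fun x => (\int[m2]_y g^\+ (x, y) - \int[m2]_y g^\- (x, y))%E).
  apply: emeasurable_funB.
    apply: (measurable_fun_fubini_tonelli_F (m2 := m2) (g^\+)%E) => //.
    exact: measurable_funepos.
  apply: (measurable_fun_fubini_tonelli_F (m2 := m2) (g^\-)%E) => //.
  exact: measurable_funeneg.
apply/funext => x; rewrite [LHS]integralE; congr (_ - _)%E.
  by apply: eq_integral => y _; rewrite funepos_comp.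
by apply: eq_integral => y _; rewrite funeneg_comp.
Qed.

Section analysis_and_synthesis.
Context (R : realType) (B : axisymmetric_domain R).
Local Notation mR := (measurableTypeR R).
Local Notation nu := (@circle_measure R).
Local Notation M := (meridian_measure B).
Local Notation beta := (body_measure B).
Local Notation fcoef f k := (fourier_coef f k : mR * mR -> R[i]).
Local Notation s := ((Num.sqrt (2 * pi))^-1 : R).
Implicit Types (f g : mR * mR * mR -> R[i]) (x : mR * mR -> R[i]) (k j : int).

Definition fibre f (p : mR * mR) (t : mR) : R[i] := f (cylindrical p.1 t p.2).

Lemma fourier_coefE f k p : fourier_coef f k p = circle_coef (fibre f p) k.
Proof. by []. Qed.

Lemma cmeasurable_fibre2 f : cmeasurable f ->
  cmeasurable (fun q : mR * mR * mR => fibre f q.1 q.2).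
Proof.
move=> mf; exact: (cmeasurable_comp mf (@measurable_cylindrical R)).
Qed.

Lemma cmeasurable_fibre f p : cmeasurable f -> cmeasurable (fibre f p).
Proof.
move=> mf; have mp : measurable_fun setT (fun t : mR => (p, t) : mR * mR * mR).
  exact: measurable_fun_pair.
exact: (cmeasurable_comp (cmeasurable_fibre2 mf) mp).
Qed.

Lemma L2int_body f : cmeasurable f ->
  (L2int beta f = \int[M]_p L2int nu (fibre f p))%E.
Proof.
move=> mf; rewrite /L2int ge0_integral_body//; first exact: measurable_sqr_rnorm.
by move=> x; exact: sqr_rnorm_ge0.
Qed.

Lemma measurable_L2int_fibre f : cmeasurable f ->
  measurable_fun setT (fun p => L2int nu (fibre f p)).
Proof.
move=> /cmeasurable_fibre2/measurable_sqr_rnorm mf.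
exact: (measurable_integral_section nu mf).
Qed.

Lemma cmeasurable_fourier_coef f k : cmeasurable f ->
  cmeasurable (fourier_coef f k : mR * mR -> R[i]).
Proof.
move=> mf; rewrite (_ : fourier_coef f k = fun p : mR * mR => s%:C%C *
    cintegral nu setT (fun t => fibre f p t * expi (- (k%:~R * t)))); last first.
  by apply/funext => p; rewrite fourier_coefE circle_coefE//; exact: cmeasurable_fibre.
apply: cmeasurableM; first exact: cmeasurable_cst.
have [m1 m2] : cmeasurable (fun q : mR * mR * mR => fibre f q.1 q.2 * expi (- (k%:~R * q.2))).
  apply: cmeasurableM; first exact: cmeasurable_fibre2.
  have me : measurable_fun setT (fun q : mR * mR * mR => q.2) by exact: measurable_snd.
  have := cmeasurable_comp (cmeasurable_expi R (- k)) me.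
  by rewrite (_ : (fun _ => _) = fun q : mR * mR * mR => expi (- (k%:~R * q.2)))//;
    apply/funext => q; rewrite rmorphN mulNr.
move/measurable_EFinP: m1 => m1; move/measurable_EFinP: m2 => m2.
split; rewrite /cintegral /Rintegral/=.
  apply: (measurableT_comp (@fine_measurable R setT measurableT)).
  exact: (measurable_integral_section nu m1).
apply: (measurableT_comp (@fine_measurable R setT measurableT)).
exact: (measurable_integral_section nu m2).
Qed.

Lemma ae_half_section : \forall p \ae M, (half_section B : set (mR * mR)) p.
Proof.
exists (~` half_section B); split => //.
  by apply: measurableC; exact: half_section_measurable.
transitivity (\int[@lebesgue2 R]_(p in (~` half_section B) `&` half_section B) p.1%:E)%E => //.
by rewrite setICl integral_set0.
Qed.

Lemma ae_fibre_L2 f : cmeasurable f -> (L2int beta f < +oo)%E ->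
  \forall p \ae M, fibre f p \in L2pred nu.
Proof.
move=> mf; rewrite L2int_body// => lf.
have iL : M.-integrable setT (fun p => L2int nu (fibre f p)).
  apply/integrableP; split; first exact: measurable_L2int_fibre.
  by under eq_integral do rewrite gee0_abs ?L2int_ge0//.
have := integrable_ae measurableT iL; apply: filterS => p /(_ Logic.I).
rewrite ge0_fin_numE ?L2int_ge0// => lp.
by rewrite inE; split => //; exact: cmeasurable_fibre.
Qed.

Let FM : Filter (almost_everywhere M).
Proof. exact: ae_filter_ringOfSetsType. Qed.

(* [e^{i k theta}] in Cartesian coordinates, which avoids choosing a measurable
   angle; on the axis, [r^-1 = 0] makes it [0] for [k != 0]. *)
Definition phase k (q : mR * mR * mR) : R[i] :=
  let r := Num.sqrt (q.1.1 ^+ 2 + q.1.2 ^+ 2) in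
  match k with
  | Posz n => Complex (q.1.1 * r^-1) (q.1.2 * r^-1) ^+ n
  | Negz n => Complex (q.1.1 * r^-1) (- (q.1.2 * r^-1)) ^+ n.+1
  end.

Definition synthesis k x (q : mR * mR * mR) : R[i] :=
  x (Num.sqrt (q.1.1 ^+ 2 + q.1.2 ^+ 2), q.2) * (s%:C%C * phase k q).

Lemma expiX (y : R) n : expi y ^+ n = expi (n%:R * y).
Proof.
elim: n => [|n IH]; first by rewrite expr0 mul0r /expi cos0 sin0.
by rewrite exprS IH -expiD -natr1 mulrDl mul1r addrC.
Qed.

Lemma sqrt_cylindrical (r t : R) : 0 < r ->
  Num.sqrt ((r * cos t) ^+ 2 + (r * sin t) ^+ 2) = r.
Proof.
move=> r0; rewrite !exprMn -mulrDr cos2Dsin2 mulr1 sqrtr_sqr gtr0_norm//.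
Qed.

Lemma phase_cylindrical k (r t z : R) : 0 < r ->
  phase k (cylindrical r t z) = expi (k%:~R * t).
Proof.
move=> r0; rewrite /phase /cylindrical /= sqrt_cylindrical// (mulrAC r) (mulrAC r (sin t)).
rewrite divff ?gt_eqF// !mul1r.
case: k => n; first by rewrite -[Complex _ _]/(expi t) expiX.
rewrite -[Complex _ _]/(Complex (cos t) (- sin t)) -cosN -sinN.
rewrite -[Complex _ _]/(expi (- t)) expiX NegzE rmorphN/= mulNr mulrN.
by [].
Qed.

Lemma fibre_synthesis k x p t : 0 < p.1 ->
  fibre (synthesis k x) p t = x p * circle_basis k t.
Proof.
move=> p0; rewrite /fibre /synthesis phase_cylindrical//= sqrt_cylindrical//.
by case: p p0.
Qed.

Lemma cmeasurable_synthesis k x : cmeasurable x -> cmeasurable (synthesis k x).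
Proof.
move=> mx.
have m1 : measurable_fun setT (fun q : mR * mR * mR => q.1.1).
  exact: measurableT_comp measurable_fst measurable_fst.
have m2 : measurable_fun setT (fun q : mR * mR * mR => q.1.2).
  exact: measurableT_comp measurable_snd measurable_fst.
have mr : measurable_fun setT (fun q : mR * mR * mR => Num.sqrt (q.1.1 ^+ 2 + q.1.2 ^+ 2)).
  apply: (measurableT_comp (@measurable_sqrt R)).
  by apply: measurable_funD; exact: measurable_funX.
have mri : measurable_fun setT (fun q : mR * mR * mR => (Num.sqrt (q.1.1 ^+ 2 + q.1.2 ^+ 2))^-1).
  exact: (measurableT_comp (@measurable_inv R) mr).
apply: cmeasurableM.
  apply: (cmeasurable_comp mx).
  by apply: measurable_fun_pair => //; exact: measurable_snd.
apply: cmeasurableM; first exact: cmeasurable_cst.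
case: k => n; apply: cmeasurableX; split => /=; try exact: measurable_funM.
by apply: measurableT_comp => //; exact: measurable_funM.
Qed.

Lemma fourier_coef_synthesis j k x : cmeasurable x ->
  \forall p \ae M, fcoef (synthesis k x) j p = if j == k then x p else 0.
Proof.
move=> mx; have := ae_half_section; apply: (filterS (F := almost_everywhere M)) => p [p0 _].
have e := circle_coef_basis (x p) k j; rewrite -{}e.
rewrite (_ : (fun t => _) = fibre (synthesis k x) p)//.
by apply/funext => t; rewrite (fibre_synthesis k x t p0).
Qed.

(** This is [circle_bessel] integrated over the half section. Being written with sums only, it makes
    sense before the coefficient is known to be square integrable, a fact that [fourier_coef_L2]
    draws from it. *)
Lemma bessel_identity f k x : cmeasurable f -> (L2int beta f < +oo)%E ->
  cmeasurable x ->
  (L2int beta (f - synthesis k x)%R + L2int M (fourier_coef f k) =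
   L2int beta f + L2int M (fourier_coef f k - x)%R)%E.
Proof.
move=> mf lf mx.
have cmB d (T : measurableType d) (a b : T -> R[i]) :
    cmeasurable a -> cmeasurable b -> cmeasurable (a - b).
  by move=> ma mb; rewrite -scaleN1r; apply: cmeasurableD => //; exact: cmeasurableZ.
have mS := cmeasurable_synthesis k mx.
have mF := cmeasurable_fourier_coef k mf.
have mfS := cmB _ _ _ _ mf mS; have mFx := cmB _ _ _ _ mF mx.
rewrite !L2int_body//.
pose a p := L2int nu (fibre (f - synthesis k x) p).
pose a' p := (rnorm (fcoef f k p) ^+ 2)%:E.
pose b p := L2int nu (fibre f p).
pose b' p := (rnorm ((fcoef f k - x) p) ^+ 2)%:E.
have ma : measurable_fun setT a by exact: measurable_L2int_fibre.
have mb : measurable_fun setT b by exact: measurable_L2int_fibre.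
have ma' : measurable_fun setT a' by exact: measurable_sqr_rnorm.
have mb' : measurable_fun setT b' by exact: measurable_sqr_rnorm.
have a0 p : (0 <= a p)%E by exact: L2int_ge0.
have b0 p : (0 <= b p)%E by exact: L2int_ge0.
have a0' p : (0 <= a' p)%E by rewrite lee_fin sqr_ge0.
have b0' p : (0 <= b' p)%E by rewrite lee_fin sqr_ge0.
transitivity (\int[M]_p (a p + a' p))%E.
  exact: (esym (ge0_integralD M measurableT (fun p _ => a0 p) ma (fun p _ => a0' p) ma')).
transitivity (\int[M]_p (b p + b' p))%E; last first.
  exact: (ge0_integralD M measurableT (fun p _ => b0 p) mb (fun p _ => b0' p) mb').
apply: ge0_ae_eq_integral => //; try exact: emeasurable_funD;
  try by move=> p _; exact: adde_ge0.
have := ae_fibre_L2 mf lf; have := ae_half_section.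
apply: (filterS2 (F := almost_everywhere M)) => p [p0 _] fL _.
rewrite -[RHS](circle_bessel (MkL2fun fL) (x p) k); congr (_ + _)%E.
congr L2int; apply/funext => t.
by rewrite -(fibre_synthesis k x t p0).
Qed.

Lemma fourier_coef_linear f g (z : R[i]) k :
  cmeasurable f -> (L2int beta f < +oo)%E -> cmeasurable g -> (L2int beta g < +oo)%E ->
  \forall p \ae M, fcoef (z *: f + g) k p =
    z * fcoef f k p + fcoef g k p.
Proof.
move=> mf lf mg lg.
have := ae_fibre_L2 mg lg; have := ae_fibre_L2 mf lf.
apply: (filterS2 (F := almost_everywhere M)) => p fL gL.
exact: (circle_coef_linear (MkL2fun fL) (MkL2fun gL) z k).
Qed.

Lemma fourier_coef_eq0 f : cmeasurable f -> (L2int beta f < +oo)%E ->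
  (forall k, \forall p \ae M, fcoef f k p = 0) -> L2int beta f = 0%E.
Proof.
move=> mf lf f0; rewrite L2int_body//.
have all0 : \forall p \ae M, forall k, fcoef f k p = 0.
  (* Enumerating the integers by naturals makes the union of the exceptional sets a countable
     one. *)
  have : \forall p \ae M, forall n : nat, forall k, unpickle n = Some k -> fcoef f k p = 0.
    apply/ae_foralln => n; case E : (unpickle n) => [k|]; last exact: nearW.
    by have := f0 k; apply: filterS => p fp _ [<-].
  by apply: filterS => p h k; apply: (h (pickle k)); rewrite pickleK.
transitivity (\int[M]_p (cst 0%E p : \bar R))%E; last by rewrite integral0.
apply: ge0_ae_eq_integral => //.
- exact: measurable_L2int_fibre.
- by move=> p _; exact: L2int_ge0.
have := ae_fibre_L2 mf lf; move: all0.
apply: (filterS2 (F := almost_everywhere M)) => p fp fL _.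
have h0 := @circle_coef_eq0 _ (MkL2fun fL) fp.
rewrite -[LHS](sqr_L2fnorm (MkL2fun fL)) (L2fnorm0_ae _).2// expr0n//.
Qed.

End analysis_and_synthesis.

(** * Fubini's theorem and means on the body *)

Section body_means.
Context (R : realType) (B : axisymmetric_domain R).
Local Notation mR := (measurableTypeR R).
Local Notation nu := (@circle_measure R).
Local Notation M := (meridian_measure B).
Local Notation beta := (body_measure B).
Local Notation s := ((Num.sqrt (2 * pi))^-1 : R).

(** Fubini's theorem from [ge0_integral_body] for both parts of [g]: their angular integrals are
    finite at almost every [p], where [fine] commutes with the difference. *)
Lemma Rintegral_body (g : mR * mR * mR -> R) : beta.-integrable setT (EFin \o g) ->
  \int[beta]_x g x = \int[M]_p \int[nu]_t g (cylindrical p.1 t p.2).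
Proof.
move=> ig; have /integrableP[mg _] := ig.
pose G := (EFin \o g : mR * mR * mR -> \bar R).
pose P (p : mR * mR) := (\int[nu]_t (G^\+ (cylindrical p.1 t p.2)))%E.
pose N (p : mR * mR) := (\int[nu]_t (G^\- (cylindrical p.1 t p.2)))%E.
have mc := @measurable_cylindrical R.
have mP : measurable_fun setT (P : mR * mR -> \bar R).
  exact: (measurable_integral_section nu (measurableT_comp (measurable_funepos mg) mc)).
have mN : measurable_fun setT (N : mR * mR -> \bar R).
  exact: (measurable_integral_section nu (measurableT_comp (measurable_funeneg mg) mc)).
have P0 p : (0 <= P p)%E by exact: integral_ge0.
have N0 p : (0 <= N p)%E by exact: integral_ge0.
have EP : (\int[beta]_x G^\+ x = \int[M]_p P p)%E.
  by apply: ge0_integral_body => //; exact: measurable_funepos.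
have EN : (\int[beta]_x G^\- x = \int[M]_p N p)%E.
  by apply: ge0_integral_body => //; exact: measurable_funeneg.
have iP : M.-integrable setT P.
  apply/integrableP; split=> //.
  rewrite (eq_integral P); last by move=> p _; exact: gee0_abs (P0 p).
  by rewrite -EP ltey_eq (integrable_fin_num measurableT (integrable_funepos measurableT ig)).
have iN : M.-integrable setT N.
  apply/integrableP; split=> //.
  rewrite (eq_integral N); last by move=> p _; exact: gee0_abs (N0 p).
  by rewrite -EN ltey_eq (integrable_fin_num measurableT (integrable_funeneg measurableT ig)).
have fibreE p : (\int[nu]_t (g (cylindrical p.1 t p.2))%:E = P p - N p)%E.
  rewrite [LHS]integralE; congr (_ - _)%E; apply: eq_integral => t _.
    by rewrite /G !funeposE.
  by rewrite /G !funenegE.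
rewrite /Rintegral; congr fine.
rewrite [LHS]integralE EP EN -(integralB measurableT iP iN).
apply: ae_eq_integral => //.
- exact: emeasurable_funB.
- apply/measurable_EFinP; apply: (measurableT_comp (@fine_measurable R setT measurableT)).
  rewrite (_ : (fun p => _) = (fun p => P p - N p)%E); last exact/funext.
  exact: emeasurable_funB.
have := integrable_ae measurableT iP; have := integrable_ae measurableT iN.
apply: (filterS2 (F := almost_everywhere M)) => p /(_ Logic.I) Np /(_ Logic.I) Pp _.
by rewrite fibreE fineK// fin_numB Pp Np.
Qed.

(** Taking the coefficient itself as [x] in [bessel_identity] removes the last term and leaves
    Bessel's inequality. *)
Lemma fourier_coef_L2 (f : L2fun beta) k :
  (fourier_coef f k : mR * mR -> R[i]) \in L2pred M.
Proof.
have [mf lf] := L2funP f; have mF := cmeasurable_fourier_coef k mf.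
rewrite inE; split=> //; have := bessel_identity k mf lf mF.
rewrite subrr L2int0 adde0 => E.
by apply: le_lt_trans lf; rewrite -E leeDr// L2int_ge0.
Qed.

Lemma cintegral_fourier_coef0 (f : L2fun beta) :
  cintegral M setT (fourier_coef f 0) = s%:C%C * cintegral beta setT f.
Proof.
have [mf lf] := L2funP f; have [ir ii] := L2fun_integrable f.
have E p : fourier_coef f 0 p = Complex (s * \int[nu]_t complex.Re (f (cylindrical p.1 t p.2)))
    (s * \int[nu]_t complex.Im (f (cylindrical p.1 t p.2))).
  rewrite fourier_coefE circle_coefE; last exact: cmeasurable_fibre.
  rewrite (_ : (fun t => _) = fibre f p); last first.
    apply/funext => t; rewrite mul0r oppr0 /expi cos0 sin0.
    exact: mulr1.
  by rewrite /cintegral /fibre; congr Complex; rewrite mul0r ?subr0 ?addr0.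
rewrite /cintegral [RHS](_ : _ = Complex (s * \int[beta]_x complex.Re (f x))
  (s * \int[beta]_x complex.Im (f x))); last first.
  by congr Complex; rewrite mul0r ?subr0 ?addr0.
rewrite !Rintegral_body//.
have [iF1 iF2] := L2fun_integrable (MkL2fun (fourier_coef_L2 f 0)).
have s0 : s != 0 by rewrite invr_eq0 gt_eqF// sqrtr_gt0 mulr_gt0// pi_gt0.
congr Complex.
  (* The scalar is moved through the integral of the coefficient, whose integrability is known from
     [fourier_coef_L2]. *)
  rewrite [X in s * X](_ : _ = s^-1 * \int[M]_p complex.Re (fourier_coef f 0 p)).
    by rewrite mulrA divff ?mul1r.
  rewrite -RintegralZl//; apply: eq_Rintegral => p _.
  by rewrite E/= mulKf.
rewrite [X in s * X](_ : _ = s^-1 * \int[M]_p complex.Im (fourier_coef f 0 p)).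
  by rewrite mulrA divff ?mul1r.
rewrite -RintegralZl//; apply: eq_Rintegral => p _.
by rewrite E/= mulKf.
Qed.

End body_means.

(** * Orthonormal expansions in normed spaces *)

(* Spaces of the type [L2] carry no inner product, so orthonormality and
   adjointness of [E] and [F] are encoded by [FE] and [bessel]. *)
Section orthonormal_expansion.
Context (R : realType) (V W : normedModType R[i]).
Variables (E : int -> W -> V) (F : int -> V -> W).
Hypothesis FB : forall k f g, F k (f - g) = F k f - F k g.
Hypothesis FE : forall j k x, F j (E k x) = if j == k then x else 0.
Hypothesis bessel : forall k f x,
  rnorm (f - E k x) ^+ 2 + rnorm (F k f) ^+ 2 =
  rnorm f ^+ 2 + rnorm (F k f - x) ^+ 2.
Hypothesis F_inj : forall f, (forall k, F k f = 0) -> f = 0.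
Hypothesis complete : forall g : nat -> V,
  (forall n m, (n <= m)%N -> rnorm (g m - g n) ^+ 2 <= fast_rate R n) ->
  exists G, forall n, rnorm (G - g n) ^+ 2 <= fast_rate R n.
Implicit Types (f : V) (x : int -> W) (s : seq int).

Let F0 k : F k 0 = 0.
Proof. by rewrite -(subrr (0 : V)) FB subrr. Qed.

Let partial x s := \sum_(k <- s) E k (x k).

Let F_partial x s j : uniq s -> F j (partial x s) = if j \in s then x j else 0.
Proof.
rewrite /partial; elim: s => [|k s IH] /=; first by rewrite big_nil F0.
move=> /andP[ks us]; rewrite big_cons inE.
have FD f g : F j (f + g) = F j f + F j g.
  by rewrite -[g in LHS]opprK FB -[- g]sub0r FB F0 sub0r opprK.
rewrite FD FE IH//; case: eqVneq => [->|_] /=; last by rewrite add0r.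
by rewrite (negPf ks) addr0.
Qed.

(** [bessel] is applied to one index at a time: subtracting terms with indices other than [k] leaves
    the [k]-th coefficient unchanged. *)
Let bessel_seq f x s : uniq s ->
  rnorm (f - partial x s) ^+ 2 + \sum_(k <- s) rnorm (F k f) ^+ 2 =
  rnorm f ^+ 2 + \sum_(k <- s) rnorm (F k f - x k) ^+ 2.
Proof.
rewrite /partial; elim: s => [|k s IH] /=; first by rewrite !big_nil subr0.
move=> /andP[ks us]; rewrite !big_cons.
have FkE : F k (f - partial x s) = F k f.
  by rewrite FB F_partial// (negPf ks) subr0.
have := bessel k (f - partial x s) (x k); rewrite FkE -/(partial x s) => e.
have := IH us; rewrite -/(partial x s) => e'.
rewrite -/(partial x s) [f - _](_ : _ = f - partial x s - E k (x k)); last first.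
  by rewrite opprD addrA addrAC.
by rewrite [LHS]addrA e addrAC e' -addrA [X in _ + X]addrC.
Qed.

Let rnormN f : rnorm (- f) = rnorm f.
Proof. by rewrite /rnorm normrN. Qed.

(** Pythagoras, obtained from [bessel_seq] at [f = 0]. *)
Let rnorm_partial x s : uniq s ->
  rnorm (partial x s) ^+ 2 = \sum_(k <- s) rnorm (x k) ^+ 2.
Proof.
move=> us; have := bessel_seq 0 x us; rewrite sub0r rnormN rnorm0 expr0n/= add0r.
under eq_bigr do rewrite F0 rnorm0 expr0n.
rewrite big1// addr0 => ->; apply: eq_bigr => k _.
by rewrite F0 sub0r /rnorm normrN.
Qed.

Let le_sum_rnorm f s : uniq s -> \sum_(k <- s) rnorm (F k f) ^+ 2 <= rnorm f ^+ 2.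
Proof.
move=> us; have := bessel_seq f (F^~ f) us.
under [X in _ = _ + X]eq_bigr do rewrite subrr rnorm0 expr0n.
rewrite [X in _ = _ + X]big1// addr0 => <-.
by rewrite lerDr sqr_ge0.
Qed.

Let le_rnormF f k : rnorm (F k f) ^+ 2 <= rnorm f ^+ 2.
Proof. by have := @le_sum_rnorm f [:: k] isT; rewrite big_seq1. Qed.

Let sum_fset (a : int -> R) (A : set int) : finite_set A ->
  exists2 s, uniq s & (\sum_(k \in A) (a k)%:E = (\sum_(k <- s) a k)%:E)%E.
Proof.
move=> fA; exists (finmap.enum_fset (fset_set A)); first exact: finmap.fset_uniq.
by rewrite fsbig_finite//= sumEFin.
Qed.

Let sum_le_esum (a : int -> R) s : (forall k, 0 <= a k) -> uniq s ->
  ((\sum_(k <- s) a k)%:E <= \esum_(k in [set: int]) (a k)%:E)%E.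
Proof.
move=> a0 us; apply: esum_ge; exists [set` s]; first by split=> //; exact: finite_seq.
by rewrite -sumEFin fsbig_seq.
Qed.

Lemma esum_coef_le f :
  (\esum_(k in [set: int]) (rnorm (F k f) ^+ 2)%:E <= (rnorm f ^+ 2)%:E)%E.
Proof.
apply: ub_ereal_sup => _ [A [fA _] <-].
have [s us ->] := sum_fset (fun k => rnorm (F k f) ^+ 2) fA.
by rewrite lee_fin; exact: le_sum_rnorm.
Qed.

Let rate_eq0 (a C : R) : 0 <= a -> (forall n, a <= C * fast_rate R n) -> a = 0.
Proof.
move=> a0 aC; apply/eqP; rewrite eq_le a0 andbT.
have C0 : 0 <= C.
  have : 0 <= C * fast_rate R 0 by exact: le_trans (aC 0%N).
  by rewrite pmulr_lge0// /fast_rate invr_gt0 mulr_gt0.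
have cv : geometric C (2^-1 : R) n @[n --> \oo] --> (0 : R).
  by apply: cvg_geometric; rewrite ger0_norm//; lra.
rewrite -(cvg_lim (@Rhausdorff R) cv); apply: limr_ge; first by apply/cvg_ex; exists 0.
apply: nearW => n; apply: le_trans (aC n) _; rewrite ler_wpM2l//.
rewrite /fast_rate exprVn lef_pV2 ?posrE ?mulr_gt0 ?exprn_gt0//.
rewrite exprS mulrA ler_peMl ?exprn_ge0//.
by rewrite -[leLHS]mul1r ler_pM// ?exprn_ege1// ler1n.
Qed.

Lemma riesz_fischer x : (\esum_(k in [set: int]) (rnorm (x k) ^+ 2)%:E < +oo)%E ->
  exists2 G, forall k, F k G = x k &
    (rnorm G ^+ 2)%:E = \esum_(k in [set: int]) (rnorm (x k) ^+ 2)%:E.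
Proof.
pose a k := rnorm (x k) ^+ 2.
have a0 k : 0 <= a k by exact: sqr_ge0.
move=> xoo.
have tfin : (\esum_(k in [set: int]) (a k)%:E)%E \is a fin_num.
  by rewrite ge0_fin_numE ?esum_ge0// => k _; rewrite lee_fin.
pose tot := fine (\esum_(k in [set: int]) (a k)%:E).
have totE : (\esum_(k in [set: int]) (a k)%:E = tot%:E)%E by rewrite fineK.
have sum_tot s : uniq s -> \sum_(k <- s) a k <= tot.
  by move=> us; rewrite -lee_fin -totE; exact: sum_le_esum.
have rate_gt0 n : 0 < fast_rate R n by rewrite invr_gt0 mulr_gt0 ?exprn_gt0.
(* The factor 1/4 pays for two comparisons, each doubled by [sqr_rnormD], when partial sums are
   compared below. *)
have ex n : exists s, uniq s /\ tot - \sum_(k <- s) a k <= fast_rate R n / 4.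
  have d0 : 0 < fast_rate R n / 4 by rewrite divr_gt0.
  have [_ [A [fA _] <-]] := ub_ereal_sup_adherent d0 tfin.
  have [s us ->] := sum_fset a fA.
  rewrite -/(esum _ _) totE -EFinB lte_fin => h.
  by exists s; split => //; lra.
have [s_ sP] := choice ex.
have us n : uniq (s_ n) by have [] := sP n.
have ds n : tot - \sum_(k <- s_ n) a k <= fast_rate R n / 4 by have [] := sP n.
(* The sums over [s] and [u] share their coefficients on [s], so the squared distance is the part of
   the sum over [u] outside [s]. *)
have gap s u : uniq s -> uniq u -> {subset s <= u} ->
    rnorm (partial x u - partial x s) ^+ 2 <= tot - \sum_(k <- s) a k.
  move=> us_ uu su; have := bessel_seq (partial x u) x us_.
  rewrite rnorm_partial//.
  have -> : \sum_(k <- s) rnorm (F k (partial x u) - x k) ^+ 2 = 0.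
    rewrite big_seq big1// => k ks.
    by rewrite F_partial// su// subrr rnorm0 expr0n.
  have -> : \sum_(k <- s) rnorm (F k (partial x u)) ^+ 2 = \sum_(k <- s) a k.
    by rewrite big_seq [RHS]big_seq; apply: eq_bigr => k ks; rewrite F_partial// su.
  have := sum_tot u uu; rewrite /a => h1 h2; lra.
have rateS n m : (n <= m)%N -> fast_rate R m <= fast_rate R n.
  move=> nm; rewrite /fast_rate lef_pV2 ?posrE ?mulr_gt0 ?exprn_gt0//.
  by rewrite ler_pM ?exprn_ge0// ler_weXn2l ?ler1n.
have [G GP] : exists G, forall n, rnorm (G - partial x (s_ n)) ^+ 2 <= fast_rate R n.
  apply: (complete (g := fun n => partial x (s_ n))) => n m nm.
  (* The chosen finite sets need not be nested; both partial sums are compared with the one over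
     their union. *)
  pose u := undup (s_ n ++ s_ m).
  have uu : uniq u by exact: undup_uniq.
  have su n' : n' = n \/ n' = m -> {subset s_ n' <= u}.
    by move=> [->|->] k ks; rewrite mem_undup mem_cat ks ?orbT.
  have g1 := gap _ _ (us n) uu (su n (or_introl erefl)).
  have g2 := gap _ _ (us m) uu (su m (or_intror erefl)).
  have := sqr_rnormD (- (partial x u - partial x (s_ m))) (partial x u - partial x (s_ n))
    (@ltr01 R) (@ltr01 R).
  rewrite rnormN opprB addrA subrK !divr1 => h.
  have d1 := ds n; have d2 := ds m; have r := rateS _ _ nm.
  lra.
have FG k : F k G = x k.
  apply/eqP; rewrite -subr_eq0; apply/eqP/rnorm0_eq0/eqP; rewrite -sqrf_eq0; apply/eqP.
  apply: (@rate_eq0 _ 4); first exact: sqr_ge0.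
  move=> n; have h1 := GP n; have h2 := le_rnormF (G - partial x (s_ n)) k.
  have h3 : rnorm (F k (partial x (s_ n)) - x k) ^+ 2 <= fast_rate R n / 4.
    rewrite F_partial//; case: ifPn => [_|ks].
      by rewrite subrr rnorm0 expr0n/= ltW// divr_gt0.
    (* An index outside [s_ n] contributes a single omitted term, which is at most the whole
       tail. *)
    have := @sum_tot (k :: s_ n); rewrite /= ks us big_cons => /(_ isT) h.
    rewrite sub0r /rnorm normrN -/(rnorm _) -/(a k).
    by have := ds n; lra.
  have := sqr_rnormD (F k G - F k (partial x (s_ n))) (F k (partial x (s_ n)) - x k)
    (@ltr01 R) (@ltr01 R).
  rewrite addrA subrK !divr1 -FB => h4.
  have r0 := rate_gt0 n; lra.
exists G => //; apply/eqP; rewrite eq_le; apply/andP; split; last first.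
  under eq_esum do rewrite -FG; exact: esum_coef_le.
rewrite totE lee_fin -subr_le0.
rewrite leNgt; apply/negP => gt0.
suff z : rnorm G ^+ 2 - tot = 0 by rewrite z ltxx in gt0.
apply: (@rate_eq0 _ 1) => [|n]; first exact: ltW.
(* Now that [G] has coefficients [x], its squared norm exceeds the sum over [s_ n] by the squared
   distance to that partial sum, hence exceeds [tot] by at most the rate. *)
have := bessel_seq G x (us n).
under eq_bigr do rewrite FG.
under [X in _ = _ + X]eq_bigr do rewrite FG subrr rnorm0 expr0n.
rewrite [X in _ = _ + X]big1// addr0 mul1r => h.
by have := GP n; have := sum_tot _ (us n); rewrite /a; lra.
Qed.

(** [riesz_fischer] rebuilds from the coefficients of [f] a vector with the right norm, and [F_inj]
    identifies it with [f]. *)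
Lemma parseval f :
  (rnorm f ^+ 2)%:E = \esum_(k in [set: int]) (rnorm (F k f) ^+ 2)%:E.
Proof.
have [G FG NG] := riesz_fischer (le_lt_trans (esum_coef_le f) (ltry _)).
suff -> : f = G by rewrite {1}NG; apply: eq_esum => k _; rewrite -FG.
by apply/eqP; rewrite -subr_eq0; apply/eqP/F_inj => k; rewrite FB FG subrr.
Qed.

End orthonormal_expansion.

(** * The isomorphism *)

Section L2_classes.
Context d (T : measurableType d) (R : realType).
Variable mu : {measure set T -> \bar R}.

Lemma L2classB (f g : L2fun mu) : L2class (f - g) = L2class f - L2class g.
Proof.
by rewrite -[- g]scaleN1r L2classD L2classZ scaleN1r.
Qed.

Lemma sqr_rnorm_L2class (f : L2fun mu) : (rnorm (L2class f) ^+ 2)%:E = L2int mu f.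
Proof. by rewrite /rnorm norm_L2class sqr_L2fnorm. Qed.

Lemma L2class_eq0 (f : L2fun mu) : L2class f = 0 <-> \forall x \ae mu, f x = 0.
Proof. exact: L2classP. Qed.

Lemma L2_complete (g : nat -> L2 mu) :
  (forall n m, (n <= m)%N -> rnorm (g m - g n) ^+ 2 <= fast_rate R n) ->
  exists G, forall n, rnorm (G - g n) ^+ 2 <= fast_rate R n.
Proof.
have gE n : g n = L2class (repr (g n)) by rewrite L2class_repr.
move=> gC; have [G GP] : exists G : L2fun mu, forall n,
    (L2int mu (G - repr (g n))%R <= (fast_rate R n)%:E)%E.
  apply: L2fun_complete => n m nm.
  by rewrite -sqr_rnorm_L2class lee_fin L2classB !L2class_repr; exact: gC.
exists (L2class G) => n.
by rewrite gE -L2classB -lee_fin sqr_rnorm_L2class.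
Qed.

End L2_classes.

(** * The coefficient map on almost everywhere classes *)

Section fourier_isomorphism.
Context (R : realType) (B : axisymmetric_domain R).
Local Notation mR := (measurableTypeR R).
Local Notation M := (meridian_measure B).
Local Notation beta := (body_measure B).
Local Notation s := ((Num.sqrt (2 * pi))^-1 : R).
Implicit Types (f g : L2fun beta) (u v : L2 beta) (x : L2 M) (k : int).

Definition fourier_fun f k : L2fun M := MkL2fun (fourier_coef_L2 f k).

Lemma fourier_fun_linear (z : R[i]) f g k :
  L2class (fourier_fun (z *: f + g) k) =
  z *: L2class (fourier_fun f k) + L2class (fourier_fun g k).
Proof.
rewrite -L2classZ -L2classD; apply/L2classP.
have [mf lf] := L2funP f; have [mg lg] := L2funP g.
exact: (fourier_coef_linear z k mf lf mg lg).
Qed.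

Lemma fourier_coef0 k : fourier_coef (0 : mR * mR * mR -> R[i]) k = 0.
Proof.
apply/funext => p; rewrite fourier_coefE.
rewrite (_ : fibre _ p = fun t => 0 * circle_basis 0 t).
  by rewrite circle_coef_basis; case: ifP.
by apply/funext => t; rewrite mul0r.
Qed.

(** The case [f = 0] of [bessel_identity]; it is what places synthesized functions in [L2pred]. *)
Lemma L2int_synthesis k (a : mR * mR -> R[i]) : cmeasurable a ->
  L2int beta (synthesis k a) = L2int M a.
Proof.
move=> ma; have oo : (L2int beta 0%R < +oo)%E by rewrite L2int0 ltry.
have := bessel_identity k (cmeasurable0 _ _) oo ma.
rewrite fourier_coef0 !L2int0 adde0 add0e !sub0r.
have N d (T : measurableType d) (mu : {measure set T -> \bar R}) (b : T -> R[i]) :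
    cmeasurable b -> L2int mu (- b) = L2int mu b.
  by move=> mb; rewrite -scaleN1r L2intZ// /rnorm normrN normr1 expr1n mul1e.
by rewrite !N//; exact: cmeasurable_synthesis.
Qed.

Lemma synthesis_L2 k (a : L2fun M) : synthesis k a \in L2pred beta.
Proof.
have [ma la] := L2funP a; rewrite inE; split; first exact: cmeasurable_synthesis.
by rewrite L2int_synthesis.
Qed.

Definition synthesis_class k x : L2 beta := L2class (MkL2fun (synthesis_L2 k (repr x))).

Lemma fourier_fun_bessel k f (a : L2fun M) :
  rnorm (L2class f - L2class (MkL2fun (synthesis_L2 k a))) ^+ 2 +
    rnorm (L2class (fourier_fun f k)) ^+ 2 =
  rnorm (L2class f) ^+ 2 + rnorm (L2class (fourier_fun f k) - L2class a) ^+ 2.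
Proof.
rewrite -!L2classB; apply: EFin_inj; rewrite !EFinD !sqr_rnorm_L2class.
have [mf lf] := L2funP f; have [ma la] := L2funP a.
exact: bessel_identity.
Qed.

Definition fourier_class k u : L2 M := L2class (fourier_fun (repr u) k).

(** Independence of the representative: the difference of two representatives has norm zero, so
    Bessel's inequality annihilates its coefficient. *)
Lemma fourier_classE k f : fourier_class k (L2class f) = L2class (fourier_fun f k).
Proof.
set g := repr (L2class f).
have fg0 : rnorm (L2class (-1 *: f + g)) ^+ 2 = 0.
  by rewrite L2classD L2classZ L2class_repr scaleN1r addNr rnorm0 expr0n.
have := fourier_fun_bessel k (-1 *: f + g) (fourier_fun (-1 *: f + g) k).
rewrite fg0 subrr rnorm0 expr0n addr0 => e.
have /eqP : rnorm (L2class (fourier_fun (-1 *: f + g) k)) ^+ 2 = 0.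
  apply/eqP; rewrite eq_le sqr_ge0 andbT -e lerDr; exact: sqr_ge0.
rewrite sqrf_eq0 => /eqP/rnorm0_eq0; rewrite fourier_fun_linear scaleN1r addrC.
by move=> /eqP; rewrite subr_eq0 => /eqP.
Qed.

Lemma fourier_class_linear k : linear (fourier_class k).
Proof.
move=> z u v; rewrite -(L2class_repr u) -(L2class_repr v) -L2classZ -L2classD.
by rewrite !fourier_classE fourier_fun_linear.
Qed.

Lemma fourier_classB k u v :
  fourier_class k (u - v) = fourier_class k u - fourier_class k v.
Proof.
by rewrite -scaleN1r addrC fourier_class_linear scaleN1r addrC.
Qed.

Lemma fourier_class_synthesis j k x :
  fourier_class j (synthesis_class k x) = if j == k then x else 0.
Proof.
rewrite /synthesis_class fourier_classE -(L2class_repr x).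
have [mx _] := L2funP (repr x).
have := fourier_coef_synthesis B j k mx; rewrite L2class_repr.
by case: eqVneq => _ h; [rewrite -[RHS]L2class_repr|]; apply/L2classP.
Qed.

Lemma fourier_class_bessel k u x :
  rnorm (u - synthesis_class k x) ^+ 2 + rnorm (fourier_class k u) ^+ 2 =
  rnorm u ^+ 2 + rnorm (fourier_class k u - x) ^+ 2.
Proof.
have := fourier_fun_bessel k (repr u) (repr x).
by rewrite !L2class_repr.
Qed.

Lemma fourier_class_inj u : (forall k, fourier_class k u = 0) -> u = 0.
Proof.
move=> u0; apply/rnorm0_eq0/eqP; rewrite -sqrf_eq0 -(L2class_repr u); apply/eqP.
apply: EFin_inj; rewrite sqr_rnorm_L2class.
have [mu_ lu] := L2funP (repr u).
by apply: fourier_coef_eq0 => // k; exact: ((L2class_eq0 _).1 (u0 k)).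
Qed.

Definition fourier_parseval := parseval fourier_classB fourier_class_synthesis
  fourier_class_bessel fourier_class_inj (@L2_complete _ _ _ beta).

Definition fourier_riesz_fischer := riesz_fischer fourier_classB
  fourier_class_synthesis fourier_class_bessel (@L2_complete _ _ _ beta).

(** The two means differ by the nonzero factor [s]; this is what singles out the component
    [k = 0]. *)
Lemma zero_mean_fourier_class u :
  (fourier_class 0 u \in zero_mean M) = (u \in zero_mean beta).
Proof.
rewrite -(L2class_repr u) fourier_classE !zero_meanE [X in X == _]cintegral_fourier_coef0.
have s0 : s != 0 by rewrite invr_eq0 gt_eqF// sqrtr_gt0 mulr_gt0// pi_gt0.
rewrite mulf_eq0 [X in X || _](_ : _ = false)//; apply/negbTE.
by rewrite eq_complex/= negb_and s0.
Qed.

Lemma fourier_class_k0 (q : L2_0 B) k :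
  fourier_class k (subspace_val q) \in @L2_k0_pred R B k.
Proof.
rewrite inE; have [->|//] := eqVneq k 0.
by rewrite zero_mean_fourier_class; exact: valP.
Qed.

Definition fourier_seq (q : L2_0 B) k : L2_k0 B k :=
  MkSubspace (fourier_class_k0 q k).

Lemma sumsq_fourier_seq (q : L2_0 B) :
  sumsq (fourier_seq q) = (rnorm (subspace_val q) ^+ 2)%:E.
Proof. by rewrite fourier_parseval. Qed.

Lemma fourier_seq_fin (q : L2_0 B) : (sumsq (fourier_seq q) < +oo)%E.
Proof. by rewrite sumsq_fourier_seq ltry. Qed.

Definition fourier_map (q : L2_0 B) : l2sum (L2_k0 B) :=
  MkL2sum (fourier_seq_fin q).

Lemma fourier_map_linear : linear fourier_map.
Proof.
move=> z p q; apply: l2sum_eq => k; apply: val_inj.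
exact: (fourier_class_linear k z (subspace_val p) (subspace_val q)).
Qed.

HB.instance Definition _ := GRing.isLinear.Build R[i] (L2_0 B) (l2sum (L2_k0 B))
  *:%R fourier_map fourier_map_linear.

Lemma norm_fourier_map (q : L2_0 B) : `|fourier_map q| = `|q|.
Proof.
rewrite norm_l2sum -[RHS]rnormE; congr (_%:C%C).
rewrite /l2rnorm sumsq_fourier_seq/= sqrtr_sqr.
by rewrite ger0_norm ?rnorm_ge0.
Qed.

Lemma fourier_map_surj (y : l2sum (L2_k0 B)) : exists q, fourier_map q = y.
Proof.
have [G Gy _] := @fourier_riesz_fischer (fun k => subspace_val (y k)) (l2seq_fin y).
(* The constraint on [y 0] is exactly the zero mean of the function that Riesz-Fischer provides. *)
have G0 : G \in zero_mean beta.
  by rewrite -zero_mean_fourier_class Gy; have := valP (y 0); rewrite inE eqxx.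
exists (MkSubspace G0); apply: l2sum_eq => k; apply: val_inj; exact: Gy.
Qed.

Lemma fourier_map_bij : bijective fourier_map.
Proof.
have [g gK] := choice fourier_map_surj.
exists g => // q; apply/eqP; rewrite -subr_eq0 -normr_eq0 -norm_fourier_map.
by rewrite raddfB/= gK subrr normr0.
Qed.

End fourier_isomorphism.

Theorem corollary5p3 (R : realType) (B : axisymmetric_domain R) :
  exists F : {linear L2_0 B -> l2sum (L2_k0 B)},
    [/\ forall (q : L2_0 B) (f : R * R * R -> R[i]),
          L2represents (body_measure B) f (subspace_val q) ->
          forall k : int, L2represents (meridian_measure B)
            (fourier_coef f k) (subspace_val (F q k)),
        bijective F,
        forall q : L2_0 B, `|F q| = `|q| &
        forall (q : L2_0 B) (k : int),
          `|F q k| = `|subspace_val (F q k) : L2_1 B| ].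
Proof.
exists (@fourier_map R B : {linear L2_0 B -> l2sum (L2_k0 B)}); split.
- move=> q f [g [<- gq]] k; exists (fourier_fun g k); split=> //.
  by rewrite -fourier_classE gq.
- exact: fourier_map_bij.
- exact: norm_fourier_map.
- by [].
Qed.
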